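(* Assume $c=1$, i.e. $a^{ij}b_ib_j=-1$. Fix $x\in M$, put $A=b+\frac12gq$, and for tangent vectors $y_1,y_2\in T_xM$ define the angle $$\alpha_{\{x\}}(y_1,y_2)=\frac1h\operatorname{arccosh}\frac{h^2\,r_{ij}(x)y_1^iy_2^j-A(x,y_1)A(x,y_2)}{\sqrt{|B(x,y_1)|}\,\sqrt{|B(x,y_2)|}}\quad\text{in the future-time-like sector},$$ $$\alpha_{\{x\}}(y_1,y_2)=\frac1h\arccos\frac{A(x,y_1)A(x,y_2)-h^2\,r_{ij}(x)y_1^iy_2^j}{\sqrt{|B(x,y_1)|}\,\sqrt{|B(x,y_2)|}}\quad\text{in the space-like sector}.$$ Then, in both sectors, $\alpha_{\{x\}}(y_1,y_2)$ is the length of the geodesic curve on the indicatrix which joins the points at which the vectors $y_1,y_2$ intersect the indicatrix; infinitesimally, $d\alpha$ is the arc-length on the indicatrix. Here the indicatrix is $\{y\in T_xM: F^2(x,y)=1\}$ for time-like vectors and $\{y\in T_xM: F^2(x,y)=-1\}$ for space-like vectors, and lengths on it are measured by means of the Finslerian metric tensor $g_{ij}$.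
   Context: Let $M$ be an $N$-dimensional smooth manifold with a pseudo-Riemannian metric tensor $a_{ij}(x)$ of signature $(+,-,\dots,-)$ and inverse $a^{ij}$, a 1-form $b_i(x)$ with $a^{ij}b_ib_j=-1$, and a scalar field $g(x)$. For $y\in T_xM$ put $$b=b_i(x)y^i,\quad r_{ij}=a_{ij}+b_ib_j,\quad \gamma=r_{ij}y^iy^j,\quad q=\sqrt{|\gamma|},\quad B=\gamma-g\,b\,q-b^2 .$$ In both sectors below $G=g/h$ and $g_\pm=-\frac12g\pm h$, with $h$ as specified for the sector. Future-time-like sector ($-\infty<g<\infty$, $h=\sqrt{1+g^2/4}$): the future-directed $y\in T_xM$ with $\gamma>0$ such that either $b\ge0$ and $q>-g_-b$, or $b\le0$ and $q>-g_+b$. There $B=q^2-gbq-b^2=(b-g_-q)(g_+q-b)>0$ and $J=\left(\frac{b-g_-q}{g_+q-b}\right)^{-G/4}$. Space-like sector ($-2<g<2$, $h=\sqrt{1-g^2/4}$): the $y\in T_xM$ with $\gamma<0$ such that either $b\ge0$ and $q<-g_-b$, or $b\le0$ and $q<-g_+b$. There $B=-(q^2+gbq+b^2)<0$ and $J=e^{-\frac12Gf}$, where, with $L=q+\frac g2b$, $f=-\arctan\frac G2+\arctan\frac{L}{hb}$ if $b\le0$ and $f=-\pi-\arctan\frac G2+\arctan\frac{L}{hb}$ if $b\ge0$. In both sectors the squared metric function is $F^2(x,y)=B(x,y)J^2(x,y)$, and $g_{ij}=\frac12\frac{\partial^2F^2}{\partial y^i\partial y^j}$ is the Finslerian metric 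tensor.
   Formalization: In the space-like sector, claims are made only where the arccos argument lies in [-1,1], and a joining geodesic is asserted to exist only when b has the same sign at both vectors and γ<0 on all nonzero nonnegative combinations of them; otherwise α is undefined or no joining geodesic exists. *)

(* Defs.v *)
(* MathComp / MathComp-Analysis *)
From HB Require Import structures.
From mathcomp Require Import all_boot all_order all_algebra.
From mathcomp Require Import all_classical all_reals all_analysis.
Set Implicit Arguments.
Unset Strict Implicit.
Unset Printing Implicit Defensive.
Import Order.TTheory GRing.Theory Num.Theory.
Import numFieldNormedType.Exports.
Local Open Scope classical_set_scope.
Local Open Scope ring_scope.

(* The tangent space T_xM at the fixed point x is 'rV[R]_N (components y^i);
   a_ij(x), b_i(x) and g(x) are a matrix, a row of covariant components and a
   scalar. *)

(* Signature (+,-,...,-): a is diag(1,-1,...,-1) in some basis of T_xM, whose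
   vectors are the rows of P. *)
Definition lorentzian (R : realType) (N : nat) (a : 'M[R]_N) : Prop :=
  a^T = a /\
  exists2 P : 'M[R]_N, P \in unitmx &
    P *m a *m P^T =
    diag_mx (\row_(j < N) if (j : nat) == 0%N then 1 else -1).

Definition bilin (R : realType) (N : nat) (s : 'M[R]_N) (y z : 'rV[R]_N) : R :=
  \sum_i \sum_j s i j * y 0 i * z 0 j.

(* a^{ij} b_i b_j *)
Definition conorm2 (R : realType) (N : nat) (a : 'M[R]_N) (b : 'rV[R]_N) : R :=
  \sum_i \sum_j (invmx a) i j * b 0 i * b 0 j.

Definition bform (R : realType) (N : nat) (b y : 'rV[R]_N) : R :=
  \sum_i b 0 i * y 0 i.

Definition rmx (R : realType) (N : nat) (a : 'M[R]_N) (b : 'rV[R]_N) : 'M[R]_N :=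
  \matrix_(i, j) (a i j + b 0 i * b 0 j).

Section Scalars.
Variables (R : realType) (N : nat) (a : 'M[R]_N) (b : 'rV[R]_N) (g : R).
Implicit Types (y : 'rV[R]_N) (h : R).

Definition rform (y1 y2 : 'rV[R]_N) : R := bilin (rmx a b) y1 y2.
Definition gam y : R := rform y y.
Definition qf y : R := Num.sqrt `|gam y|.
Definition Bf y : R := gam y - g * bform b y * qf y - bform b y ^+ 2.
Definition Af y : R := bform b y + g / 2 * qf y.
Definition gminus h : R := - (g / 2) - h.
Definition gplus h : R := - (g / 2) + h.

Definition h_time : R := Num.sqrt (1 + g ^+ 2 / 4).
Definition h_space : R := Num.sqrt (1 - g ^+ 2 / 4).

(* The time orientation is given by a vector T with a(T,T) > 0.  Vectors of the
   sector need not be time-like for a, so "future-directed" refers to the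
   component of {gamma > 0} containing T: since a^{ij} b_i b_j = -1, rform T y
   is a(T, y') with y' the a-orthogonal projection of y on the kernel of b, and
   it has the sign of a(T, y) whenever a(y, y) > 0. *)
Definition time_sector (T : 'rV[R]_N) : set 'rV[R]_N :=
  [set y | [/\ 0 < gam y, 0 < rform T y &
     (0 <= bform b y /\ - gminus h_time * bform b y < qf y) \/
     (bform b y <= 0 /\ - gplus h_time * bform b y < qf y)]].

Definition space_sector : set 'rV[R]_N :=
  [set y | gam y < 0 /\
     ((0 <= bform b y /\ qf y < - gminus h_space * bform b y) \/
      (bform b y <= 0 /\ qf y < - gplus h_space * bform b y))].

Definition J_time y : R :=
  ((bform b y - gminus h_time * qf y) / (gplus h_time * qf y - bform b y))
    `^ (- (g / h_time / 4)).

(* The two branches overlap at b = 0, which does not occur in the space-like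
   sector. *)
Definition f_space y : R :=
  let G := g / h_space in
  let L := qf y + g / 2 * bform b y in
  if bform b y <= 0
  then - atan (G / 2) + atan (L / (h_space * bform b y))
  else - pi - atan (G / 2) + atan (L / (h_space * bform b y)).

Definition J_space y : R := expR (- (1 / 2) * (g / h_space) * f_space y).

Definition F2_time y : R := Bf y * J_time y ^+ 2.
Definition F2_space y : R := Bf y * J_space y ^+ 2.

End Scalars.

Section FinslerMetric.
Variables (R : realType) (N : nat) (F2 : 'rV[R]_N -> R).
Implicit Types (y v : 'rV[R]_N) (i j k : 'I_N).

Definition partial (f : 'rV[R]_N -> R) i y : R := 'D_(delta_mx 0 i) f y.

Definition gij y : 'M[R]_N :=
  \matrix_(i, j) (1 / 2 * partial (partial F2 j) i y).

(* Christoffel symbols of the first kind Gamma_{k,ij} of the pseudo-Riemannian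
   metric y |-> gij y on T_xM. *)
Definition Gamma1 k i j y : R :=
  1 / 2 * (partial (fun z => gij z j k) i y + partial (fun z => gij z i k) j y
           - partial (fun z => gij z i j) k y).

(* The covariant components of the acceleration of c with respect to the
   Levi-Civita connection of gij. *)
Definition coacceleration (c : R -> 'rV[R]_N) (t : R) k : R :=
  (\sum_i gij (c t) k i * (derive1 (derive1 c) t) 0 i) +
  \sum_i \sum_j Gamma1 k i j (c t) * (derive1 c t) 0 i * (derive1 c t) 0 j.

(* The level is 1 for time-like and -1 for space-like vectors. *)
Definition indicatrix (D : set 'rV[R]_N) (level : R) : set 'rV[R]_N :=
  [set y | D y /\ F2 y = level].

Definition ray_meets (S : set 'rV[R]_N) (y p : 'rV[R]_N) : Prop :=
  S p /\ exists2 k : R, 0 < k & p = k *: y.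

(* Affinely parametrized geodesics of the hypersurface S = {F2 = const} with
   the induced metric: the tangential part of the ambient covariant acceleration
   vanishes.  The vectors tangent to S at p are the v with 'D_v F2 p = 0. *)
Definition geodesic_joining (S : set 'rV[R]_N) (p1 p2 : 'rV[R]_N)
    (c : R -> 'rV[R]_N) : Prop :=
  [/\ c 0 = p1, c 1 = p2 &
      forall t : R, 0 <= t <= 1 ->
        [/\ S (c t), derivable c t 1, derivable (derive1 c) t 1 &
            forall v : 'rV[R]_N, 'D_v F2 (c t) = 0 ->
              \sum_k coacceleration c t k * v 0 k = 0]].

(* ds = sqrt |g_ij v^i v^j|; the induced metric is negative definite on the
   time-like indicatrix and indefinite on the space-like one. *)
Definition ds y v : R := Num.sqrt `|bilin (gij y) v v|.

Definition arc_length (c : R -> 'rV[R]_N) : R :=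
  \int[lebesgue_measure]_(t in [set` `[0, 1]]) ds (c t) (derive1 c t).

End FinslerMetric.

(* Specified in the same way as the library's acos. *)
Definition arccosh (R : realType) (x : R) : R :=
  get [set t : R | 0 <= t /\ (expR t + expR (- t)) / 2 = x].

Section Angles.
Variables (R : realType) (N : nat) (a : 'M[R]_N) (b : 'rV[R]_N) (g : R).

Definition cosh_angle_time (y1 y2 : 'rV[R]_N) : R :=
  (h_time g ^+ 2 * rform a b y1 y2 - Af a b g y1 * Af a b g y2)
  / (Num.sqrt `|Bf a b g y1| * Num.sqrt `|Bf a b g y2|).

Definition angle_time (y1 y2 : 'rV[R]_N) : R :=
  (h_time g)^-1 * arccosh (cosh_angle_time y1 y2).

Definition cos_angle_space (y1 y2 : 'rV[R]_N) : R :=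
  (Af a b g y1 * Af a b g y2 - h_space g ^+ 2 * rform a b y1 y2)
  / (Num.sqrt `|Bf a b g y1| * Num.sqrt `|Bf a b g y2|).

Definition angle_space (y1 y2 : 'rV[R]_N) : R :=
  (h_space g)^-1 * acos (cos_angle_space y1 y2).

(* The metric induced on the space-like indicatrix is indefinite, and the
   argument of arccos can lie outside [-1, 1]. *)
Definition angle_space_defined (y1 y2 : 'rV[R]_N) : Prop :=
  -1 <= cos_angle_space y1 y2 <= 1.

(* The space-like sector is not connected, and an arc between two of its points
   may have to leave {gamma < 0}.  The first condition puts both vectors in the
   part b > 0 or both in the part b < 0; the second says that gamma < 0 at every
   nonzero combination of y1 and y2 with nonnegative coefficients. *)
Definition joinable_space (y1 y2 : 'rV[R]_N) : Prop :=
  0 < bform b y1 * bform b y2 /\ rform a b y1 y2 < qf a b y1 * qf a b y2.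

End Angles.

(* Main.v *)
Require Import Defs.
From HB Require Import structures.
From mathcomp Require Import all_boot all_order all_algebra.
From mathcomp Require Import all_classical all_reals all_analysis.
From mathcomp Require Import ring lra.
Set Implicit Arguments.
Unset Strict Implicit.
Unset Printing Implicit Defensive.
Import Order.TTheory GRing.Theory Num.Theory.
Import numFieldNormedType.Exports.
Local Open Scope classical_set_scope.
Local Open Scope ring_scope.

(** With [beta] the vector a^{ij} b_j and A = b + g q / 2, put
      Z(y) = h y + ((h - 1) b - g q / 2) beta  and  zeta(y) = J(y) Z(y).
    In both sectors zeta is a positively homogeneous diffeomorphism onto its image
    such that a(zeta, zeta) = F^2 and
      h^2 g_ij = a(d_i zeta, d_j zeta) + (h^2 - 1) d_i F^2 d_j F^2 / (4 F^2).
    Hence zeta maps the indicatrix to the pseudo-sphere a(z, z) = eps, with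
    eps = 1 (time-like) or -1 (space-like), and multiplies the induced metric by
    h^2.  The geodesics of the pseudo-sphere solve z'' = K z with K constant, so
    that arccosh or arccos of eps a(z_1, z_2) is sqrt |K|, i.e. h times the length;
    since J cancels, eps a(zeta_1, zeta_2) is the argument of the angle formula. *)

(** * Bilinear forms and derivatives along curves *)

Section Bilinear.
Context {R : realType} {N : nat}.
Implicit Types (s : 'M[R]_N) (u v w : 'rV[R]_N) (k : R).

(** [zeta] comes from completing a square. Since [b] takes the value -1 on [beta], the coefficient
    of [beta] in [Z] is the one for which [b] of [Z y] is [A y], while the component in the kernel
    of [b] is multiplied by [h]; hence the [a]-square of [Z] is [h^2 gamma - A^2 = B]. Both [J], a
    power in one sector and the exponential of an arctangent in the other, have the logarithmic
    derivative [g / 2 (b dq - q db) / B]; besides positivity and degree 0, nothing else about [J]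
    enters the common argument. Two obstacles shape the rest. To avoid a differential calculus in
    several variables, every function is differentiated along an arbitrary differentiable curve, and
    lines give back the partial derivatives. And a geodesic is constrained only for [0 <= t <= 1],
    while its derivatives at 0 and 1 are two-sided: identities found by differentiating the
    constraint hold in the open interval and reach the end points through constancy. Uniqueness
    rests on the bound [- pi ^+ 2 < K], which excludes conjugate points and which each sector
    supplies in its own way. *)

Lemma bilinDl s u v w : bilin s (u + v) w = bilin s u w + bilin s v w.
Proof.
rewrite /bilin -big_split; apply: eq_bigr => i _ /=.
by rewrite -big_split; apply: eq_bigr => j _ /=; rewrite mxE mulrDr mulrDl.
Qed.

Lemma bilinZl s k u w : bilin s (k *: u) w = k * bilin s u w.
Proof.
rewrite /bilin mulr_sumr; apply: eq_bigr => i _.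
by rewrite mulr_sumr; apply: eq_bigr => j _ /=; rewrite mxE; ring.
Qed.

Lemma bilinC s u v : s^T = s -> bilin s u v = bilin s v u.
Proof.
move=> sT; rewrite /bilin exchange_big; apply: eq_bigr => i _.
by apply: eq_bigr => j _; rewrite -{1}sT mxE; ring.
Qed.

Lemma bilinDr s u v w : bilin s w (u + v) = bilin s w u + bilin s w v.
Proof.
rewrite /bilin -big_split; apply: eq_bigr => i _ /=.
by rewrite -big_split; apply: eq_bigr => j _ /=; rewrite mxE mulrDr.
Qed.

Lemma bilinZr s k u w : bilin s w (k *: u) = k * bilin s w u.
Proof.
rewrite /bilin mulr_sumr; apply: eq_bigr => i _.
by rewrite mulr_sumr; apply: eq_bigr => j _ /=; rewrite mxE; ring.
Qed.

Lemma bilinBl s u v w : bilin s (u - v) w = bilin s u w - bilin s v w.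
Proof. by rewrite -scaleN1r bilinDl bilinZl mulN1r. Qed.

Lemma bilinBr s u v w : bilin s w (u - v) = bilin s w u - bilin s w v.
Proof. by rewrite -scaleN1r bilinDr bilinZr mulN1r. Qed.

Lemma bformD (b u v : 'rV[R]_N) : bform b (u + v) = bform b u + bform b v.
Proof.
by rewrite /bform -big_split; apply: eq_bigr => i _; rewrite mxE mulrDr.
Qed.

Lemma bformZ (b u : 'rV[R]_N) k : bform b (k *: u) = k * bform b u.
Proof.
by rewrite /bform mulr_sumr; apply: eq_bigr => i _; rewrite mxE; ring.
Qed.

Lemma bformN (b u : 'rV[R]_N) : bform b (- u) = - bform b u.
Proof. by rewrite -scaleN1r bformZ mulN1r. Qed.

Lemma scalar_sum_delta (f : 'rV[R]_N -> R) v :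
  (forall u w, f (u + w) = f u + f w) -> (forall k u, f (k *: u) = k * f u) ->
  \sum_i f (delta_mx 0 i) * v 0 i = f v.
Proof.
move=> fD fZ; rewrite {2}(row_sum_delta v).
have f0 : f 0 = 0 by rewrite -(scale0r 0) fZ mul0r.
rewrite (big_morph f fD f0).
by apply: eq_bigr => i _; rewrite fZ mulrC.
Qed.

End Bilinear.

Section CurveDerivatives.
Context {R : realType} {N : nat}.
Implicit Types (c d : R -> 'rV[R]_N) (f p q : R -> R).

Lemma is_derive_mxP c t (x : 'rV[R]_N) :
  is_derive t (1:R) c x <-> forall i, is_derive t (1:R) (fun s => c s 0 i) (x 0 i).
Proof.
split=> [[dc <-] i|dc].
  split; first by move/derivable_mxP : dc; apply.
  by rewrite derive_mx // mxE.
have D : derivable c t 1 by apply/derivable_mxP => i j; rewrite ord1; case: (dc j).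
split=> //; rewrite derive_mx //; apply/rowP => i; rewrite mxE.
by case: (dc i).
Qed.

Lemma derivable_derive1 (V : normedModType R) (f : R -> V) (t : R) :
  derivable f t 1 -> is_derive t (1:R) f (derive1 f t).
Proof. by move=> df; rewrite derive1E; exact: derivableP. Qed.

Lemma is_derive1_unique (V : normedModType R) (f : R -> V) (t : R) (x y : V) :
  is_derive t (1:R) f x -> is_derive t (1:R) f y -> x = y.
Proof. by move=> [_ <-] [_ <-]. Qed.

Lemma is_derive1_continuous (V : normedModType R) (f : R -> V) t (x : V) :
  is_derive t (1:R) f x -> {for t, continuous f}.
Proof. by move=> [df _]; apply/differentiable_continuous/derivable1_diffP. Qed.

Lemma is_derive1M f p t df dp : is_derive t (1:R) f df -> is_derive t (1:R) p dp ->
  is_derive t (1:R) (fun s => f s * p s) (df * p t + f t * dp).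
Proof. by move=> ? ?; apply: is_derive_eq; rewrite addrC /GRing.scale /= (mulrC df). Qed.

Lemma is_derive1D (V : normedModType R) (f p : R -> V) t df dp :
  is_derive t (1:R) f df -> is_derive t (1:R) p dp ->
  is_derive t (1:R) (fun s => f s + p s) (df + dp).
Proof. by move=> ? ?; exact: is_deriveD. Qed.

Lemma is_derive1N f t df : is_derive t (1:R) f df ->
  is_derive t (1:R) (fun s => - f s) (- df).
Proof. by move=> ?; exact: is_deriveN. Qed.

Lemma is_derive1B f p t df dp : is_derive t (1:R) f df -> is_derive t (1:R) p dp ->
  is_derive t (1:R) (fun s => f s - p s) (df - dp).
Proof. by move=> ? ?; exact: is_deriveB. Qed.

Lemma is_derive1_cst (V : normedModType R) (k : V) (t : R) :
  is_derive t (1:R) (fun=> k) 0.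
Proof. exact: is_derive_cst. Qed.

Lemma is_derive1Ml k f t df : is_derive t (1:R) f df ->
  is_derive t (1:R) (fun s => k * f s) (k * df).
Proof. by move=> ?; exact: is_deriveZ. Qed.

Lemma is_derive1V f t df : f t != 0 -> is_derive t (1:R) f df ->
  is_derive t (1:R) (fun s => (f s)^-1) (- df / (f t) ^+ 2).
Proof.
move=> f0 Df; have := is_deriveV f0 Df => D.
by apply: is_derive_eq D _; rewrite /GRing.scale /= mulNr mulrC mulNr.
Qed.

Lemma is_derive1_chain f p t df dp : is_derive (p t) (1:R) f df ->
  is_derive t (1:R) p dp -> is_derive t (1:R) (fun s => f (p s)) (df * dp).
Proof. by move=> ? ?; exact: is_derive1_comp. Qed.

Lemma is_derive1Z f c t df (dc : 'rV[R]_N) :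
  is_derive t (1:R) f df -> is_derive t (1:R) c dc ->
  is_derive t (1:R) (fun s => f s *: c s) (df *: c t + f t *: dc).
Proof.
move=> Df /is_derive_mxP Dc; apply/is_derive_mxP => i.
have := is_derive1M Df (Dc i); rewrite !mxE.
by apply: near_eq_is_derive; near=> s; rewrite mxE.
Unshelve. end_near. Qed.

Lemma is_derive1_bigsum (h : 'I_N -> R -> R) (dh : 'I_N -> R) t :
  (forall i, is_derive t (1:R) (h i) (dh i)) ->
  is_derive t (1:R) (fun s => \sum_i h i s) (\sum_i dh i).
Proof.
move=> Dh.
have -> : (fun s => \sum_i h i s) = \sum_i h i by apply/funext => s; rewrite fct_sumE.
exact: is_derive_sum.
Qed.

Lemma is_derive1_bform (b : 'rV[R]_N) c t x : is_derive t (1:R) c x ->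
  is_derive t (1:R) (fun s => bform b (c s)) (bform b x).
Proof.
move=> /is_derive_mxP Dc; exact: is_derive1_bigsum (fun i => is_derive1Ml (b 0 i) (Dc i)).
Qed.

Lemma is_derive1_bilin (m : 'M[R]_N) c d t x y :
  is_derive t (1:R) c x -> is_derive t (1:R) d y ->
  is_derive t (1:R) (fun s => bilin m (c s) (d s))
    (bilin m x (d t) + bilin m (c t) y).
Proof.
move=> /is_derive_mxP Dc /is_derive_mxP Dd.
have D i j := is_derive1M (is_derive1Ml (m i j) (Dc i)) (Dd j).
have := is_derive1_bigsum (fun i => is_derive1_bigsum (D i)).
move/is_derive_eq; apply; rewrite /bilin -big_split /=.
by apply: eq_bigr => i _; rewrite -big_split.
Qed.

Lemma is_derive1_line (u y : 'rV[R]_N) (t : R) :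
  is_derive t (1:R) (fun s => s *: u + y) u.
Proof.
have D := is_derive1D (is_derive1Z (is_derive_id t (1:R)) (is_derive1_cst u t))
  (is_derive1_cst y t).
by apply: is_derive_eq D _; rewrite scale1r scaler0 !addr0.
Qed.

(** ['D_u f y] sees [f] only on the line through [y], and the two difference quotients agree term by
    term. This turns derivatives along curves into partial derivatives. *)
Lemma is_derive_lineP (f : 'rV[R]_N -> R) y u l :
  is_derive (0:R) (1:R) (fun s => f (s *: u + y)) l -> is_derive y u f l.
Proof.
move=> [D1 D2]; have D : derivable f y u by exact: (derivable1P f y u).2 D1.
split=> //; rewrite -D2 /derive.
set F1 := (X in lim (X @ _) = _); set F2 := (X in _ = lim (X @ _)).
suff -> : F1 = F2 by [].
by apply/funext => s; rewrite /F1 /F2 /= scale0r add0r addr0 [_%:A]mulr1.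
Qed.

End CurveDerivatives.

(** * Real functions of one variable *)

Section OneVariable.
Context {R : realType}.
Implicit Types (f : R -> R) (t x y K : R).

Lemma within_continuous f x y :
  (forall t, x <= t <= y -> derivable f t 1) -> {within `[x, y], continuous f}.
Proof.
move=> fd; apply: continuous_in_subspaceT => t; rewrite inE /= in_itv /= => /fd df.
exact/differentiable_continuous/derivable1_diffP.
Qed.

Lemma near_itv01 t : 0 < t < 1 -> \forall s \near t, 0 < s < 1.
Proof.
move=> /andP[t0 t1]; near=> s; apply/andP; split; near: s.
  exact: lt_nbhsr.
exact: lt_nbhsl.
Unshelve. all: by end_near. Qed.

(** By the mean value theorem. Differentiability at 0 and 1 serves for continuity there, so a
    derivative known to vanish in the interior suffices. *)
Lemma derive0_constant f : (forall t, 0 <= t <= 1 -> derivable f t 1) ->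
  (forall t, 0 < t < 1 -> is_derive t (1:R) f 0) ->
  forall t, 0 <= t <= 1 -> f t = f 0.
Proof.
move=> fd f0 t /andP[]; rewrite le_eqVlt => /predU1P[<- //|t0 t1].
apply/eqP; rewrite -subr_eq0; apply/eqP.
have [||c _ ->] := @MVT R f (fun=> 0) 0 t t0; last by rewrite mul0r.
  move=> x; rewrite in_itv /= => /andP[x0 xt]; apply: f0.
  by rewrite x0 (lt_le_trans xt).
by apply: within_continuous => x /andP[x0 xt]; apply: fd; rewrite x0 (le_trans xt).
Qed.

Lemma nonvanishing_gt0 f : (forall t, 0 <= t <= 1 -> derivable f t 1) ->
  (forall t, 0 <= t <= 1 -> f t != 0) -> 0 < f 0 ->
  forall t, 0 <= t <= 1 -> 0 < f t.
Proof.
move=> fd f0 p t /andP[t0 t1]; rewrite lt_neqAle eq_sym f0 ?t0 // leNgt.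
apply/negP => ft.
have := @IVT R f 0 t 0 t0; case.
- by apply: within_continuous => x /andP[x0 xt]; apply: fd; rewrite x0 (le_trans xt).
- by rewrite ge_min le_max (ltW ft) (ltW p) orbT.
- move=> c; rewrite in_itv /= => /andP[c0 ct] /eqP.
  by apply/negP/f0; rewrite c0 (le_trans ct).
Qed.

(** * Hyperbolic functions and [arccosh] *)

Definition cosh x := (expR x + expR (- x)) / 2.
Definition sinh x := (expR x - expR (- x)) / 2.

Lemma is_derive_expRN x : is_derive x (1:R) (fun t => expR (- t)) (- expR (- x)).
Proof.
have D := is_derive1_chain (p := fun t => - t) (is_derive_expR (- x))
  (is_derive1N (is_derive_id x 1)).
by apply: is_derive_eq D _; rewrite mulrN1.
Qed.

Lemma is_derive_cosh x : is_derive x (1:R) cosh (sinh x).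
Proof.
have D := is_derive1M (is_derive1D (is_derive_expR x) (is_derive_expRN x))
  (is_derive1_cst (2^-1 : R) x).
by apply: is_derive_eq D _; rewrite mulr0 addr0.
Qed.

Lemma is_derive_sinh x : is_derive x (1:R) sinh (cosh x).
Proof.
have D := is_derive1M (is_derive1B (is_derive_expR x) (is_derive_expRN x))
  (is_derive1_cst (2^-1 : R) x).
by apply: is_derive_eq D _; rewrite mulr0 addr0 opprK.
Qed.

Lemma cosh0 : cosh 0 = 1.
Proof. by rewrite /cosh oppr0 expR0; field. Qed.

Lemma sinh0 : sinh 0 = 0.
Proof. by rewrite /sinh oppr0 expR0; field. Qed.

Lemma expR_expRN x : expR x * expR (- x) = 1.
Proof. by rewrite -expRD subrr expR0. Qed.

Lemma coshDsqr x : cosh x ^+ 2 = 1 + sinh x ^+ 2.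
Proof.
rewrite /cosh /sinh; have := expR_expRN x.
by move: (expR x) (expR (- x)) => u v uv; rewrite -[X in _ = X + _]uv; field.
Qed.

(** For [x = cosh u] this exhibits [2 (x - 1)] as the square of [2 sinh (u / 2)], the quantity
    against which [u] is compared near [u = 0]. *)
Lemma cosh_sinh_half x : cosh x - 1 = 2 * sinh (x / 2) ^+ 2.
Proof.
have -> : cosh x = cosh (x / 2 + x / 2) by congr cosh; field.
rewrite /cosh /sinh opprD !expRD; have := expR_expRN (x / 2).
move: (expR (x / 2)) (expR (- (x / 2))) => u v uv.
by rewrite -[X in _ - X = _]uv; field.
Qed.

Lemma cosh_cosh_half x : cosh x + 1 = 2 * cosh (x / 2) ^+ 2.
Proof. by have := cosh_sinh_half x; rewrite coshDsqr; lra. Qed.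

Lemma cosh_lt x y : 0 <= x -> x < y -> cosh x < cosh y.
Proof.
move=> x0 xy; have ex : 1 <= expR x by rewrite -expR0 ler_expR.
have exy : expR x < expR y by rewrite ltr_expR.
rewrite /cosh !expRN ltr_pM2r ?invr_gt0 // -subr_gt0.
have ex0 := expR_gt0 x; have ey0 := expR_gt0 y.
have -> : expR y + (expR y)^-1 - (expR x + (expR x)^-1) =
   (expR y - expR x) * (expR x * expR y - 1) / (expR x * expR y).
  by field; rewrite !lt0r_neq0.
by rewrite divr_gt0 ?mulr_gt0 // subr_gt0 //; nra.
Qed.

Lemma cosh_le x y : 0 <= x -> x <= y -> cosh x <= cosh y.
Proof.
by move=> x0; rewrite le_eqVlt => /predU1P[-> //|xy]; exact/ltW/cosh_lt.
Qed.

Lemma cosh_ge1 x : 0 <= x -> 1 <= cosh x.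
Proof. by move=> x0; rewrite -cosh0 cosh_le. Qed.

Lemma cosh_gt1 x : 0 < x -> 1 < cosh x.
Proof. by move=> x0; rewrite -cosh0 cosh_lt. Qed.

Lemma cosh_inj x y : 0 <= x -> 0 <= y -> cosh x = cosh y -> x = y.
Proof.
move=> x0 y0 xy; case: (ltrgtP x y) => // /cosh_lt; rewrite xy ltxx.
  by move/(_ x0).
by move/(_ y0).
Qed.

Lemma sinh_gt0 x : 0 < x -> 0 < sinh x.
Proof.
by move=> x0; rewrite /sinh divr_gt0 // subr_gt0 ltr_expR; lra.
Qed.

(** The mean value theorem gives [sinh x = x cosh c] with [0 < c < x], and [cosh] increases
    there. *)
Lemma sinh_bounds x : 0 <= x -> x <= sinh x <= x * cosh x.
Proof.
rewrite le_eqVlt => /predU1P[<-|x0]; first by rewrite sinh0 mul0r lexx.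
have cont : {within `[0, x], continuous sinh}.
  by apply: within_continuous => t _; case: (is_derive_sinh t).
have [c] := MVT x0 (fun t _ => is_derive_sinh t) cont.
rewrite in_itv /= sinh0 !subr0 => /andP[c0 cx] ->.
rewrite [_ * x]mulrC ler_peMr ?(ltW x0) ?cosh_ge1 ?(ltW c0) //=.
by rewrite ler_pM2l // cosh_le // ltW.
Qed.

Lemma sin_bounds x : 0 <= x <= pi / 2 -> x * cos x <= sin x <= x.
Proof.
move=> /andP[]; rewrite le_eqVlt => /predU1P[<-|x0 xpi].
  by rewrite sin0 mul0r lexx.
have cont : {within `[0, x], continuous sin}.
  by apply: within_continuous => t _; case: (is_derive_sin t).
have [c] := MVT x0 (fun t _ => is_derive_sin t) cont.
rewrite in_itv /= sin0 !subr0 => /andP[c0 cx] ->.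
have pi0 := @pi_gt0 R.
rewrite [cos c * x]mulrC ler_pM2l // ger_pMr // cos_le1 andbT ltW // ltr_cos //.
- by rewrite in_itv /=; lra.
- by rewrite in_itv /=; lra.
Qed.

Lemma arccosh_def x : 1 <= x -> 0 <= arccosh x /\ cosh (arccosh x) = x.
Proof.
move=> x1; apply: (@getPex _ [set t | 0 <= t /\ cosh t = x]).
(* The classical closed form; with [s] for the square root, [(x + s) (x - s) = 1]. *)
exists (ln (x + Num.sqrt (x ^+ 2 - 1))); have s0 := sqrtr_ge0 (x ^+ 2 - 1).
have x0 : 0 < x + Num.sqrt (x ^+ 2 - 1) by lra.
have s2 : Num.sqrt (x ^+ 2 - 1) ^+ 2 = x ^+ 2 - 1 by rewrite sqr_sqrtr //; nra.
split; first by rewrite ln_ge0 //; lra.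
rewrite /cosh expRN lnK //; move: (Num.sqrt _) s2 x0 => s s2 x0.
have -> : (x + s)^-1 = x - s; last by field.
apply: (mulfI (lt0r_neq0 x0)); rewrite mulfV ?lt0r_neq0 //.
by apply/esym; transitivity (x ^+ 2 - s ^+ 2); [ring|rewrite s2; ring].
Qed.

Lemma coshK x : 0 <= x -> arccosh (cosh x) = x.
Proof. by move=> x0; have [? ?] := arccosh_def (cosh_ge1 x0); exact: cosh_inj. Qed.

(** The solutions of [f'' = K f] with initial data [(1, 0)] and, for [snK], [(0, 1)]. All signs of
    [K] are covered because the metric of the space-like indicatrix is indefinite. At [K = 0] the
    [cosh] branch is the constant 1. *)
Definition csK K t := if K < 0 then cos (Num.sqrt (- K) * t) else cosh (Num.sqrt K * t).
Definition snK K t := if K < 0 then sin (Num.sqrt (- K) * t) / Num.sqrt (- K)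
  else if K == 0 then t else sinh (Num.sqrt K * t) / Num.sqrt K.

Lemma is_derive_Ml k f df t : is_derive (k * t) (1:R) f df ->
  is_derive t (1:R) (fun s => f (k * s)) (df * k).
Proof.
move=> D; have D' := is_derive1_chain (p := fun s => k * s) D
  (is_derive1Ml k (is_derive_id t 1)).
by apply: is_derive_eq D' _; rewrite mulr1.
Qed.

Lemma is_derive_csK K t : is_derive t (1:R) (csK K) (K * snK K t).
Proof.
rewrite /csK /snK; case: ifPn => [K0|]; last rewrite -leNgt => K0.
  have s0 : Num.sqrt (- K) != 0 by rewrite lt0r_neq0 // sqrtr_gt0 oppr_gt0.
  apply: is_derive_eq (is_derive_Ml (is_derive_cos _)) _.
  have : Num.sqrt (- K) ^+ 2 = - K by rewrite sqr_sqrtr // oppr_ge0 ltW.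
  move: (Num.sqrt _) s0 => s s0 s2.
  by rewrite -[K]opprK -s2; field.
apply: is_derive_eq (is_derive_Ml (is_derive_cosh _)) _.
have [->|Kn0] := eqVneq K 0; first by rewrite sqrtr0 mulr0 mul0r.
have s0 : Num.sqrt K != 0 by rewrite lt0r_neq0 // sqrtr_gt0 lt_neqAle eq_sym Kn0.
have := sqr_sqrtr K0; move: (Num.sqrt K) s0 => s s0 s2.
by rewrite -s2; field.
Qed.

Lemma is_derive_snK K t : is_derive t (1:R) (snK K) (csK K t).
Proof.
rewrite /csK /snK; case: ifPn => [K0|]; last rewrite -leNgt => K0.
  have s0 : Num.sqrt (- K) != 0 by rewrite lt0r_neq0 // sqrtr_gt0 oppr_gt0.
  have D := is_derive1M (is_derive_Ml (is_derive_sin (Num.sqrt (- K) * t)))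
    (is_derive1_cst ((Num.sqrt (- K))^-1 : R) t).
  by apply: is_derive_eq D _; rewrite mulr0 addr0 mulfK.
have [->|Kn0] := eqVneq K 0.
  by apply: is_derive_eq (is_derive_id t 1) _; rewrite sqrtr0 mul0r cosh0.
have s0 : Num.sqrt K != 0 by rewrite lt0r_neq0 // sqrtr_gt0 lt_neqAle eq_sym Kn0.
have D := is_derive1M (is_derive_Ml (is_derive_sinh (Num.sqrt K * t)))
  (is_derive1_cst ((Num.sqrt K)^-1 : R) t).
by apply: is_derive_eq D _; rewrite mulr0 addr0 mulfK.
Qed.

Lemma csK0 K : csK K 0 = 1.
Proof. by rewrite /csK !mulr0 cos0 cosh0; case: ifP. Qed.

Lemma snK0 K : snK K 0 = 0.
Proof. by rewrite /snK !mulr0 sin0 sinh0 !mul0r; case: ifP => // _; case: ifP. Qed.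

(** A first integral of [f'' = K f], evaluated at 0. *)
Lemma csK_sqr K t : csK K t ^+ 2 - K * snK K t ^+ 2 = 1.
Proof.
pose f := fun s => csK K s * csK K s - K * (snK K s * snK K s).
have -> : csK K t ^+ 2 - K * snK K t ^+ 2 = f t by rewrite /f !expr2.
suff Df (s : R) : is_derive s (1:R) f 0.
  by rewrite (is_derive_0_is_cst t 0 Df) /f csK0 snK0; ring.
have C := is_derive_csK K s; have S := is_derive_snK K s.
have D := is_derive1B (is_derive1M C C) (is_derive1Ml K (is_derive1M S S)).
by apply: is_derive_eq D _; ring.
Qed.

Lemma csK_ge1 K : 0 <= K -> 1 <= csK K 1.
Proof.
by move=> K0; rewrite /csK ltNge K0 /= mulr1 cosh_ge1 // sqrtr_ge0.
Qed.

Lemma sqrt_lt_pi K : - pi ^+ 2 < K -> Num.sqrt (- K) < pi.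
Proof.
have pi0 := @pi_gt0 R.
move=> Kpi; rewrite -[ltRHS](gtr0_norm pi0) -sqrtr_sqr ltr_sqrt ?exprn_gt0 //.
by rewrite ltrNl.
Qed.

Lemma csK_lt1 K : - pi ^+ 2 < K -> K < 0 -> csK K 1 < 1.
Proof.
move=> Kpi K0; rewrite /csK K0 mulr1 -cos0 ltr_cos ?in_itv /= ?lexx ?pi_ge0 //.
  by rewrite sqrtr_gt0 oppr_gt0.
by rewrite sqrtr_ge0 ltW // sqrt_lt_pi.
Qed.

(** The value 1 separates the two branches, and the bound keeps [Num.sqrt (- K)] where [cos] is
    injective. So the inner product of the end points of a geodesic determines [K]. *)
Lemma csK_inj K L : - pi ^+ 2 < K -> - pi ^+ 2 < L -> csK K 1 = csK L 1 -> K = L.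
Proof.
move=> Kpi Lpi; case: (leP 0 K) (leP 0 L) => K0 [] L0.
- rewrite /csK !ltNge K0 L0 /= !mulr1 => /cosh_inj.
  by rewrite !sqrtr_ge0 => /(_ isT isT)/(congr1 (fun x => x ^+ 2)); rewrite !sqr_sqrtr.
- by move=> KL; have := csK_lt1 Lpi L0; rewrite -KL ltNge csK_ge1.
- by move=> KL; have := csK_lt1 Kpi K0; rewrite KL ltNge csK_ge1.
- rewrite /csK K0 L0 !mulr1 => /cos_inj.
  rewrite !in_itv /= !sqrtr_ge0 !ltW ?sqrt_lt_pi // => /(_ isT isT).
  move/(congr1 (fun x => x ^+ 2)); rewrite !sqr_sqrtr ?oppr_ge0 ?ltW //.
  exact: oppr_inj.
Qed.

(** No conjugate point occurs up to time 1; this permits solving for the initial velocity from the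
    end points. *)
Lemma snK_gt0 K t : - pi ^+ 2 < K -> 0 < t <= 1 -> 0 < snK K t.
Proof.
move=> Kpi /andP[t0 t1]; rewrite /snK; case: ifPn => [K0|]; last rewrite -leNgt => K0.
  have s0 : 0 < Num.sqrt (- K) by rewrite sqrtr_gt0 oppr_gt0.
  rewrite divr_gt0 // sin_gt0_pi // mulr_gt0 //=.
  by rewrite (le_lt_trans _ (sqrt_lt_pi Kpi)) // ger_pMr.
have [//|Kn0] := eqVneq K 0.
have s0 : 0 < Num.sqrt K by rewrite sqrtr_gt0 lt_neqAle eq_sym Kn0.
by rewrite divr_gt0 // sinh_gt0 // mulr_gt0.
Qed.

(* [f C - f' S] and [f' C - K f S] are constant. *)
Lemma linear_ode f f' K : (forall t, 0 <= t <= 1 -> is_derive t (1:R) f (f' t)) ->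
  (forall t, 0 <= t <= 1 -> derivable f' t 1) ->
  (forall t, 0 < t < 1 -> is_derive t (1:R) f' (K * f t)) ->
  forall t, 0 <= t <= 1 -> f t = csK K t * f 0 + snK K t * f' 0.
Proof.
move=> Df df' Df' t t01.
pose p s := f s * csK K s - f' s * snK K s.
pose q s := f' s * csK K s - K * (f s * snK K s).
have p_derivable (s : R) : 0 <= s <= 1 -> derivable p s 1.
  move=> /[dup]/Df D /df'/derivableP D'.
  have := is_derive1B (is_derive1M D (is_derive_csK K s))
    (is_derive1M D' (is_derive_snK K s)).
  by case.
have q_derivable (s : R) : 0 <= s <= 1 -> derivable q s 1.
  move=> /[dup]/Df D /df'/derivableP D'.
  have := is_derive1B (is_derive1M D' (is_derive_csK K s))
    (is_derive1Ml K (is_derive1M D (is_derive_snK K s))).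
  by case.
have p' (s : R) : 0 < s < 1 -> is_derive s (1:R) p 0.
  move=> s01; have D : is_derive s (1:R) f (f' s) by apply: Df; lra.
  have D2 := is_derive1B (is_derive1M D (is_derive_csK K s))
    (is_derive1M (Df' _ s01) (is_derive_snK K s)).
  by apply: is_derive_eq D2 _; ring.
have q' (s : R) : 0 < s < 1 -> is_derive s (1:R) q 0.
  move=> s01; have D : is_derive s (1:R) f (f' s) by apply: Df; lra.
  have D2 := is_derive1B (is_derive1M (Df' _ s01) (is_derive_csK K s))
    (is_derive1Ml K (is_derive1M D (is_derive_snK K s))).
  by apply: is_derive_eq D2 _; ring.
have P := derive0_constant p_derivable p' t01.
have Q := derive0_constant q_derivable q' t01.
move: P Q; rewrite /p /q csK0 snK0 !mulr1 !mulr0 !subr0 => P Q.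
by rewrite -P -Q -[LHS]mulr1 -(csK_sqr K t); ring.
Qed.

(** The reflected function solves the same equation, with value [snK K 1] and slope [- csK K 1] at
    0, so [linear_ode] yields this addition formula for all signs of [K] at once. *)
Lemma snK_sub K t : 0 <= t <= 1 ->
  snK K (1 - t) = csK K t * snK K 1 - snK K t * csK K 1.
Proof.
move=> t01.
have D (s : R) : is_derive s (1:R) (fun s => 1 - s) (-1).
  have D := is_derive1B (is_derive1_cst (1:R) s) (is_derive_id s (1:R)).
  by apply: is_derive_eq D _; rewrite sub0r.
have Df (s : R) : is_derive s (1:R) (fun s => snK K (1 - s)) (- csK K (1 - s)).
  have D' := is_derive1_chain (p := fun s => 1 - s) (is_derive_snK K (1 - s)) (D s).
  by apply: is_derive_eq D' _; rewrite mulrN1.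
have Df' (s : R) : is_derive s (1:R) (fun s => - csK K (1 - s)) (K * snK K (1 - s)).
  have D' := is_derive1N (is_derive1_chain (p := fun s => 1 - s) (is_derive_csK K (1 - s)) (D s)).
  by apply: is_derive_eq D' _; rewrite mulrN1 opprK.
rewrite (linear_ode (f := fun s => snK K (1 - s)) (fun s _ => Df s) _ (fun s _ => Df' s) t01).
  by rewrite subr0 mulrN.
by move=> s _; case: (Df' s).
Qed.

(** * Second-order behaviour of [arccosh] and [acos] at 1 *)

Lemma near_eq_cvg_to (f p : R -> R) (l : R) :
  (\forall t \near (0:R)^', f t = p t) ->
  f t @[t --> (0:R)^'] --> l -> p t @[t --> (0:R)^'] --> l.
Proof. by move=> fp fl; apply: cvg_trans fl; exact: near_eq_cvg. Qed.

(** [arccosh] and [acos] are not differentiable at 1, so their squares are squeezed and the root is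
    taken in the limit. *)
Lemma squeeze_sqrt (u v th : R -> R) K :
  (\forall t \near 0^', 0 <= th t /\ u t <= th t ^+ 2 <= v t) ->
  u t / t ^+ 2 @[t --> 0^'] --> K -> v t / t ^+ 2 @[t --> 0^'] --> K ->
  th t / `|t| @[t --> 0^'] --> Num.sqrt K.
Proof.
move=> uv uK vK.
have tK : th t ^+ 2 / t ^+ 2 @[t --> 0^'] --> K.
  apply: squeeze_cvgr uK vK; near=> t.
  have [_ /andP[ut tv]] : 0 <= th t /\ u t <= th t ^+ 2 <= v t by near: t.
  by rewrite !ler_wpM2r ?invr_ge0 ?sqr_ge0.
have := cvg_comp _ _ tK (@sqrt_continuous R K).
apply: cvg_trans; apply: near_eq_cvg; near=> t => /=.
have [t0 _] : 0 <= th t /\ u t <= th t ^+ 2 <= v t by near: t.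
by rewrite sqrtrM ?sqr_ge0 // sqrtrV ?sqr_ge0 // !sqrtr_sqr ger0_norm.
Unshelve. all: by end_near. Qed.

Lemma cvg_of_second_order (x : R -> R) K :
  2 * (x t - 1) / t ^+ 2 @[t --> 0^'] --> K -> x t @[t --> 0^'] --> (1:R).
Proof.
move=> xK.
have T : (t : R) ^+ 2 / 2 @[t --> 0^'] --> (0:R).
  pose f (t : R) := t * (2^-1 * t).
  have D : is_derive (0:R) (1:R) f _ := is_derive1M (is_derive_id (0:R) (1:R))
    (is_derive1Ml 2^-1 (is_derive_id (0:R) (1:R))).
  have : f t @[t --> 0^'] --> f 0.
    by apply: cvg_within_filter; exact: (is_derive1_continuous D).
  rewrite {2}/f mul0r; apply: near_eq_cvg_to.
  by near=> t; rewrite /f; ring.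
have : t ^+ 2 / 2 * (2 * (x t - 1) / t ^+ 2) + 1 @[t --> 0^'] --> 0 * K + 1.
  by apply: cvgD; [exact: cvgM|exact: cvg_cst].
rewrite mul0r add0r; apply: near_eq_cvg_to; near=> t.
have t0 : t != 0 by near: t; exact: nbhs_dnbhs_neq.
by field.
Unshelve. all: by end_near. Qed.

Lemma second_order_ge0 (x : R -> R) K : (\forall t \near 0^', 1 <= x t) ->
  2 * (x t - 1) / t ^+ 2 @[t --> 0^'] --> K -> 0 <= K.
Proof.
move=> x1 xK; rewrite leNgt; apply/negP => K0.
have xlt : \forall t \near 0^', 2 * (x t - 1) / t ^+ 2 < 0 by exact: cvgr_lt xK _ K0.
have [t [xt]] := @filter_ex _ _ (Proper_dnbhs_numFieldType (0:R)) _ (filterI x1 xlt).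
apply/negP; rewrite -leNgt.
by rewrite divr_ge0 ?sqr_ge0 // mulr_ge0 // subr_ge0.
Qed.

Lemma arccosh_cvg (x : R -> R) K : (\forall t \near 0^', 1 <= x t) ->
  2 * (x t - 1) / t ^+ 2 @[t --> 0^'] --> K ->
  arccosh (x t) / `|t| @[t --> 0^'] --> Num.sqrt `|K|.
Proof.
move=> x1 xK; rewrite (ger0_norm (second_order_ge0 x1 xK)); have x_1 := cvg_of_second_order xK.
(* With [x = cosh u] the bounds are [(2 tanh (u / 2))^2 <= u^2 <= (2 sinh (u / 2))^2]; they differ
   by the factor [2 / (x + 1)], which tends to 1. *)
apply: (@squeeze_sqrt (fun t => 2 * (x t - 1) * (2 / (x t + 1)))
   (fun t => 2 * (x t - 1))) => //.
  near=> t; have xt : 1 <= x t by near: t.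
  have [a0 ax] := arccosh_def xt; split=> //.
  move: (arccosh (x t)) a0 ax => u u0 xu.
  have u20 : 0 <= u / 2 by lra.
  have /andP[b1 b2] := sinh_bounds u20.
  have := cosh_sinh_half u; have := cosh_cosh_half u; rewrite xu => -> ->.
  have ch := cosh_ge1 u20; set C := cosh _ in b2 ch *; set S := sinh _ in b1 b2 *.
  have C0 : C != 0 by rewrite lt0r_neq0 //; lra.
  have -> : 2 * (2 * S ^+ 2) * (2 / (2 * C ^+ 2)) = (2 * (S / C)) ^+ 2 by field.
  have -> : 2 * (2 * S ^+ 2) = (2 * S) ^+ 2 by ring.
  have SC : 0 <= S / C by rewrite divr_ge0 //; lra.
  have SCu : S / C <= u / 2 by rewrite ler_pdivrMr //; lra.
  by rewrite !lerXn2r ?nnegrE //; lra.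
have V : 2 / (x t + 1) @[t --> 0^'] --> (1:R).
  rewrite [X in _ --> X](_ : _ = 2 * (1 + 1)^-1); last by field.
  apply: cvgM; first exact: cvg_cst.
  by apply: cvgV => //; apply: cvgD x_1 _; exact: cvg_cst.
have : 2 * (x t - 1) / t ^+ 2 * (2 / (x t + 1)) @[t --> 0^'] --> K * 1.
  exact: cvgM.
by rewrite mulr1; apply: near_eq_cvg_to; near=> t; ring.
Unshelve. all: by end_near. Qed.

Lemma acos_cvg (x : R -> R) K : (\forall t \near 0^', -1 <= x t <= 1) ->
  2 * (x t - 1) / t ^+ 2 @[t --> 0^'] --> K ->
  acos (x t) / `|t| @[t --> 0^'] --> Num.sqrt `|K|.
Proof.
move=> x1 xK; have x_1 := cvg_of_second_order xK.
have xNK : 2 * (1 - x t) / t ^+ 2 @[t --> 0^'] --> - K.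
  have : - (2 * (x t - 1) / t ^+ 2) @[t --> 0^'] --> - K by exact: cvgN.
  by apply: near_eq_cvg_to; near=> t; ring.
have K0 : 0 <= - K.
  (* Reflection at 1 turns [x <= 1] into the lower bound that [second_order_ge0] asks for. *)
  apply: (@second_order_ge0 (fun t => 2 - x t)).
    by near=> t; have : -1 <= x t <= 1 by [near: t]; lra.
  by move: xNK; apply: near_eq_cvg_to; near=> t; ring.
rewrite -normrN (ger0_norm K0).
(* This keeps away from [x = -1], where [cos (u / 2)] vanishes and the upper bound
   [(2 tan (u / 2))^2] is meaningless. *)
have x0 : \forall t \near 0^', 0 < x t by apply: cvgr_gt x_1 _ _; lra.
apply: (@squeeze_sqrt (fun t => 2 * (1 - x t))
   (fun t => 2 * (1 - x t) * (2 / (x t + 1)))) => //.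
  near=> t; have xt : -1 <= x t <= 1 by near: t.
  have xt0 : 0 < x t by near: t.
  have [/andP[a0 api] ax] := acos_def xt; split=> //.
  move: (acos (x t)) a0 api ax => u u0 upi xu.
  have u20 : 0 <= u / 2 <= pi / 2 by lra.
  have /andP[b1 b2] := sin_bounds u20.
  have C0 : 0 <= cos (u / 2) by rewrite cos_ge0_pihalf //; have := @pi_ge0 R; lra.
  have s0 : 0 <= sin (u / 2) by rewrite sin_ge0_pi //; lra.
  have c1 : x t + 1 = 2 * cos (u / 2) ^+ 2.
    rewrite -xu; have -> : cos u = cos (u / 2 + u / 2) by congr cos; field.
    by rewrite cosD; have := cos2Dsin2 (u / 2); nra.
  have s1 : 1 - x t = 2 * sin (u / 2) ^+ 2.
    by have := cos2Dsin2 (u / 2); lra.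
  rewrite c1 s1; move: (cos _) (sin _) b1 b2 C0 s0 c1 => C S b1 b2 C0 s0 c1.
  have Cn0 : C != 0.
    by apply/eqP => C0'; move: c1; rewrite C0' expr0n mulr0; lra.
  have Cp : 0 < C by rewrite lt_neqAle eq_sym Cn0.
  have -> : 2 * (2 * S ^+ 2) * (2 / (2 * C ^+ 2)) = (2 * (S / C)) ^+ 2 by field.
  have -> : 2 * (2 * S ^+ 2) = (2 * S) ^+ 2 by ring.
  have SC : 0 <= S / C by rewrite divr_ge0 //; lra.
  have SCu : u / 2 <= S / C by rewrite ler_pdivlMr //; lra.
  by rewrite !lerXn2r ?nnegrE //; lra.
have V : 2 / (x t + 1) @[t --> 0^'] --> (1:R).
  rewrite [X in _ --> X](_ : _ = 2 * (1 + 1)^-1); last by field.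
  apply: cvgM; first exact: cvg_cst.
  by apply: cvgV => //; apply: cvgD x_1 _; exact: cvg_cst.
have : 2 * (1 - x t) / t ^+ 2 * (2 / (x t + 1)) @[t --> 0^'] --> - K * 1.
  exact: cvgM.
by rewrite mulr1; apply: near_eq_cvg_to; near=> t; ring.
Unshelve. all: by end_near. Qed.

End OneVariable.

(** * The map zeta *)

Section Metric.
Context {R : realType} {N : nat}.
Variables (a : 'M[R]_N) (b : 'rV[R]_N).
Implicit Types u v w y : 'rV[R]_N.
Hypothesis aT : a^T = a.
Hypothesis a_unit : a \in unitmx.
Hypothesis b_norm : conorm2 a b = -1.

Definition raise : 'rV[R]_N := b *m invmx a.

Lemma bilin_mulmx (s : 'M[R]_N) u v : bilin s u v = (u *m s *m v^T) 0 0.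
Proof.
rewrite /bilin exchange_big mxE; apply: eq_bigr => j _.
rewrite [(u *m s) 0 j]mxE mulr_suml; apply: eq_bigr => i _.
by rewrite !mxE; ring.
Qed.

Lemma bilin_raise u : bilin a raise u = bform b u.
Proof.
rewrite bilin_mulmx mulmxKV // mxE; apply: eq_bigr => i _.
by rewrite mxE.
Qed.

Lemma bilin_raiser u : bilin a u raise = bform b u.
Proof. by rewrite bilinC ?bilin_raise. Qed.

Lemma bform_raise : bform b raise = -1.
Proof.
rewrite -b_norm /bform /conorm2 exchange_big; apply: eq_bigr => i _ /=.
by rewrite mxE mulr_sumr; apply: eq_bigr => j _; ring.
Qed.

Lemma rformE u v : rform a b u v = bilin a u v + bform b u * bform b v.
Proof.
rewrite /rform /bilin /bform mulr_suml -big_split; apply: eq_bigr => i _ /=.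
rewrite mulr_sumr -big_split; apply: eq_bigr => j _ /=.
by rewrite mxE; ring.
Qed.

Lemma bilinE u v : bilin a u v = rform a b u v - bform b u * bform b v.
Proof. by rewrite rformE addrK. Qed.

Lemma rformC u v : rform a b u v = rform a b v u.
Proof. by rewrite !rformE (bilinC _ _ aT) mulrC. Qed.

Lemma rformDl u v w : rform a b (u + v) w = rform a b u w + rform a b v w.
Proof. exact: bilinDl. Qed.
Lemma rformDr u v w : rform a b w (u + v) = rform a b w u + rform a b w v.
Proof. exact: bilinDr. Qed.
Lemma rformZl k v w : rform a b (k *: v) w = k * rform a b v w.
Proof. exact: bilinZl. Qed.
Lemma rformZr k v w : rform a b w (k *: v) = k * rform a b w v.
Proof. exact: bilinZr. Qed.

Lemma rform_raise u : rform a b raise u = 0.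
Proof. by rewrite rformE bilin_raise bform_raise; ring. Qed.

Lemma rform_raiser u : rform a b u raise = 0.
Proof. by rewrite rformC rform_raise. Qed.

Lemma bilin_nondegenerate u : (forall w, bilin a u w = 0) -> u = 0.
Proof.
move=> u0; rewrite -[u](mulmxK a_unit); suff -> : u *m a = 0 by rewrite mul0mx.
apply/rowP => i; rewrite [RHS]mxE -[RHS](u0 (delta_mx 0 i)) bilin_mulmx.
by rewrite trmx_delta -colE [RHS]mxE.
Qed.

End Metric.

Section Conformal.
Context {R : realType} {N : nat}.
Variables (a : 'M[R]_N) (b : 'rV[R]_N) (g eps h : R).
Implicit Types (u v w y : 'rV[R]_N) (c : R -> 'rV[R]_N).
Hypothesis aT : a^T = a.
Hypothesis a_unit : a \in unitmx.
Hypothesis b_norm : conorm2 a b = -1.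
(* [eps] is the sign of [gamma] in the sector. *)
Hypothesis eps2 : eps = 1 \/ eps = -1.
Hypothesis h_gt0 : 0 < h.
Hypothesis h2 : h ^+ 2 = 1 + eps * g ^+ 2 / 4.

Variables (J : 'rV[R]_N -> R) (U : set 'rV[R]_N).

Local Notation r := (rform a b).
Local Notation bf := (bform b).
Local Notation q := (qf a b).
Local Notation B := (Bf a b g).
Local Notation A := (Af a b g).
Local Notation beta := (raise a b).
Local Notation ip := (bilin a).
Local Notation F2 := (fun y => B y * J y ^+ 2).

(** A leading [d] marks the differential at [y] applied to [u]; [dl y u v] and [d2zeta y u v] are
    the derivatives along [u] of [l y v] and [dzeta y v] with [v] fixed. *)
Let dq y u := eps * r y u / q y.
Let dB y u := 2 * eps * q y * dq y u - g * (bf u * q y + bf y * dq y u)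
  - 2 * bf y * bf u.
(** Locally [J] depends on [y] only through the ratio of [q] and [b], whence the factor
    [b dq - q db]; the remaining factor is the same function of [B] in both sectors. *)
Definition dlogJ y u := g / 2 * (bf y * dq y u - q y * bf u) / B y.
Let l := dlogJ.

Definition Zvec y := h *: y + ((h - 1) * bf y - g / 2 * q y) *: beta.
Definition zeta y := J y *: Zvec y.
Let Z := Zvec.
Let dZ y u := h *: u + ((h - 1) * bf u - g / 2 * dq y u) *: beta.
Definition dzeta y u := J y *: (l y u *: Z y + dZ y u).
Let d2q y u v := (eps * r u v - dq y u * dq y v) / q y.
Let dl y u v := g / 2 * ((bf u * dq y v + bf y * d2q y u v - dq y u * bf v) * B y
   - dB y u * (bf y * dq y v - q y * bf v)) / (B y) ^+ 2.
Definition d2zeta y u v := J y *: ((l y u * l y v + dl y u v) *: Z y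
  + l y u *: dZ y v + l y v *: dZ y u - (g / 2 * d2q y u v) *: beta).

Hypothesis U_sign : forall y, U y -> [/\ 0 < eps * gam a b y, 0 < eps * B y & 0 < J y].
(** Openness along differentiable curves follows in each sector from the continuity of the functions
    that cut [U] out. *)
Hypothesis U_open : forall c (t : R) x, is_derive t (1:R) c x -> U (c t) ->
  \forall s \near t, U (c s).
Hypothesis J_derive : forall c (t : R) x, is_derive t (1:R) c x -> U (c t) ->
  is_derive t (1:R) (fun s => J (c s)) (J (c t) * dlogJ (c t) x).

(** * Derivatives of [zeta] along curves *)

Lemma sqr_eps : eps ^+ 2 = 1.
Proof. by case: eps2 => ->; ring. Qed.

Lemma normr_eps k : 0 < eps * k -> `|k| = eps * k.
Proof.
by case: eps2 => ->; rewrite ?mul1r ?mulN1r => k0;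
  [rewrite gtr0_norm|rewrite ltr0_norm // -oppr_gt0].
Qed.

Lemma qf_gt0 y : 0 < eps * gam a b y -> 0 < q y.
Proof. by move=> y0; rewrite sqrtr_gt0 normr_eps. Qed.

Lemma sqr_qf y : 0 < eps * gam a b y -> q y ^+ 2 = eps * gam a b y.
Proof. by move=> y0; rewrite sqr_sqrtr ?normr_eps // ltW. Qed.

Lemma gam_qf y : 0 < eps * gam a b y -> gam a b y = eps * q y ^+ 2.
Proof. by move=> y0; rewrite sqr_qf // mulrA -expr2 sqr_eps mul1r. Qed.

Lemma dq_rform y u : U y -> r y u = eps * q y * dq y u.
Proof.
move=> /U_sign[y0 _ _]; have q0 := lt0r_neq0 (qf_gt0 y0).
rewrite /dq -[LHS]mul1r -sqr_eps; field; exact: q0.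
Qed.

Lemma d2q_rform y u v : U y -> r u v = eps * (q y * d2q y u v + dq y u * dq y v).
Proof.
move=> /U_sign[y0 _ _]; have q0 := lt0r_neq0 (qf_gt0 y0).
rewrite /d2q -[LHS]mul1r -sqr_eps; field; exact: q0.
Qed.

Lemma BfE_sign y : 0 < eps * gam a b y ->
  B y = eps * q y ^+ 2 - g * bf y * q y - bf y ^+ 2.
Proof. by move=> y0; rewrite /Bf {1}gam_qf. Qed.

Lemma BfE y : U y -> B y = eps * q y ^+ 2 - g * bf y * q y - bf y ^+ 2.
Proof. by move=> /U_sign[y0 _ _]; exact: BfE_sign. Qed.

Lemma U_neq0 y : U y -> [/\ q y != 0, B y != 0 & J y != 0].
Proof.
move=> /U_sign[y0 B0 J0]; split; [|by apply: contraTneq B0 => ->; rewrite mulr0 ltxx|].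
  by rewrite lt0r_neq0 ?qf_gt0.
by rewrite lt0r_neq0.
Qed.

(** Stated under the sign condition alone: differentiating [Zinv] involves [q] at points of the
    image of [Z], which are not known to lie in [U]. *)
Lemma is_derive_qf_sign c t x : is_derive t (1:R) c x -> 0 < eps * gam a b (c t) ->
  is_derive t (1:R) (fun s => q (c s)) (dq (c t) x).
Proof.
move=> Dc y0.
have Dr := is_derive1Ml eps (is_derive1_bilin (rmx a b) Dc Dc).
have D := is_derive1_chain (p := fun s => eps * gam a b (c s)) (is_derive1_sqrt y0) Dr.
apply: (@is_derive_eq _ _ _ _ _ _ _ _
  (near_eq_is_derive (f := fun s => Num.sqrt (eps * gam a b (c s))) _ D)).
  near=> s; rewrite /qf normr_eps //; near: s.
  exact: cvgr_gt (is_derive1_continuous Dr) _ y0.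
rewrite -sqr_qf // sqrtr_sqr gtr0_norm ?qf_gt0 //.
rewrite -/(rform a b x (c t)) -/(rform a b (c t) x) (rformC b aT x).
by rewrite /dq; field; rewrite lt0r_neq0 // qf_gt0.
Unshelve. all: by end_near. Qed.

Lemma is_derive_qf c t x : is_derive t (1:R) c x -> U (c t) ->
  is_derive t (1:R) (fun s => q (c s)) (dq (c t) x).
Proof. by move=> Dc /U_sign[y0 _ _]; exact: is_derive_qf_sign. Qed.

Lemma is_derive_Bf c t x : is_derive t (1:R) c x -> U (c t) ->
  is_derive t (1:R) (fun s => B (c s)) (dB (c t) x).
Proof.
move=> Dc Uc.
have Db := is_derive1_bform b Dc; have Dq := is_derive_qf Dc Uc.
have Dr := is_derive1_bilin (rmx a b) Dc Dc.
have D := is_derive1B (is_derive1B Dr (is_derive1M (is_derive1Ml g Db) Dq))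
  (is_derive1M Db Db).
apply: is_derive_eq D _; rewrite /dB.
rewrite -/(rform a b x (c t)) -/(rform a b (c t) x) (rformC b aT x) dq_rform //; ring.
Qed.

(** The vector [v] moves with the curve, so that [v = derive1 c] produces the acceleration. *)
Lemma is_derive_dq c (v : R -> 'rV[R]_N) t x v' : is_derive t (1:R) c x -> is_derive t (1:R) v v' ->
  U (c t) ->
  is_derive t (1:R) (fun s => dq (c s) (v s)) (d2q (c t) x (v t) + dq (c t) v').
Proof.
move=> Dc Dv Uc; have [q0 _ _] := U_neq0 Uc.
have D := is_derive1M (is_derive1Ml eps (is_derive1_bilin (rmx a b) Dc Dv))
  (is_derive1V (f := fun s => q (c s)) q0 (is_derive_qf Dc Uc)).
apply: is_derive_eq D _; rewrite /d2q.
rewrite -/(rform a b x (v t)) -/(rform a b (c t) v') -/(rform a b (c t) (v t)).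
by rewrite /dq; field.
Qed.

Lemma is_derive_dlogJ c (v : R -> 'rV[R]_N) t x v' : is_derive t (1:R) c x ->
  is_derive t (1:R) v v' -> U (c t) ->
  is_derive t (1:R) (fun s => l (c s) (v s)) (dl (c t) x (v t) + l (c t) v').
Proof.
move=> Dc Dv Uc; have [_ B0 _] := U_neq0 Uc.
have Db := is_derive1_bform b Dc; have Dq := is_derive_qf Dc Uc.
have Dbv := is_derive1_bform b Dv; have Ddq := is_derive_dq Dc Dv Uc.
have D := is_derive1M (is_derive1Ml (g / 2)
    (is_derive1B (is_derive1M Db Ddq) (is_derive1M Dq Dbv)))
  (is_derive1V (f := fun s => B (c s)) B0 (is_derive_Bf Dc Uc)).
by apply: is_derive_eq D _; rewrite /dl /l /dlogJ; field.
Qed.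

Lemma is_derive_Zvec c t x : is_derive t (1:R) c x -> U (c t) ->
  is_derive t (1:R) (fun s => Z (c s)) (dZ (c t) x).
Proof.
move=> Dc Uc.
have D := is_derive1D (is_derive1Z (is_derive1_cst h t) Dc)
  (is_derive1Z (is_derive1B (is_derive1Ml (h - 1) (is_derive1_bform b Dc))
     (is_derive1Ml (g / 2) (is_derive_qf Dc Uc))) (is_derive1_cst beta t)).
by apply: is_derive_eq D _; rewrite scale0r add0r scaler0 addr0.
Qed.

Lemma is_derive_dZ c (v : R -> 'rV[R]_N) t x v' : is_derive t (1:R) c x ->
  is_derive t (1:R) v v' -> U (c t) ->
  is_derive t (1:R) (fun s => dZ (c s) (v s))
    (dZ (c t) v' - (g / 2 * d2q (c t) x (v t)) *: beta).
Proof.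
move=> Dc Dv Uc.
have D := is_derive1D (is_derive1Z (is_derive1_cst h t) Dv)
  (is_derive1Z (is_derive1B (is_derive1Ml (h - 1) (is_derive1_bform b Dv))
     (is_derive1Ml (g / 2) (is_derive_dq Dc Dv Uc))) (is_derive1_cst beta t)).
apply: is_derive_eq D _; rewrite scale0r add0r scaler0 addr0.
by rewrite /dZ -addrA -scalerBl; congr (_ + _ *: _); ring.
Qed.

Lemma is_derive_zeta c t x : is_derive t (1:R) c x -> U (c t) ->
  is_derive t (1:R) (fun s => zeta (c s)) (dzeta (c t) x).
Proof.
move=> Dc Uc; have D := is_derive1Z (J_derive Dc Uc) (is_derive_Zvec Dc Uc).
by apply: is_derive_eq D _; rewrite -scalerA -scalerDr.
Qed.

Lemma is_derive_dzeta c (v : R -> 'rV[R]_N) t x v' : is_derive t (1:R) c x ->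
  is_derive t (1:R) v v' -> U (c t) ->
  is_derive t (1:R) (fun s => dzeta (c s) (v s))
    (d2zeta (c t) x (v t) + dzeta (c t) v').
Proof.
move=> Dc Dv Uc.
have D := is_derive1Z (J_derive Dc Uc) (is_derive1D
  (is_derive1Z (is_derive_dlogJ Dc Dv Uc) (is_derive_Zvec Dc Uc))
  (is_derive_dZ Dc Dv Uc)).
apply: is_derive_eq D _; rewrite /d2zeta /dzeta -scalerA -!scalerDr.
by congr (_ *: _); apply/rowP => i; rewrite !mxE -/l; ring.
Qed.

(** * The Finslerian metric as a modified pull-back *)

Lemma bform_Zvec y : bf (Z y) = A y.
Proof. by rewrite bformD !bformZ bform_raise // /Af; ring. Qed.

Let dA y u := bf u + g / 2 * dq y u.

Lemma bform_dZ y u : bf (dZ y u) = dA y u.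
Proof. by rewrite bformD !bformZ bform_raise // /dA; ring. Qed.

Lemma rform_Zvec y u : r (Z y) u = h * r y u.
Proof. by rewrite rformDl !rformZl rform_raise // mulr0 addr0. Qed.

Lemma rform_dZ y u v : r (dZ y u) v = h * r u v.
Proof. by rewrite rformDl !rformZl rform_raise // mulr0 addr0. Qed.

Lemma rform_Zvecr y u : r u (Z y) = h * r u y.
Proof. by rewrite rformDr !rformZr rform_raiser // mulr0 addr0. Qed.

Lemma rform_dZr y u v : r v (dZ y u) = h * r v u.
Proof. by rewrite rformDr !rformZr rform_raiser // mulr0 addr0. Qed.

Definition bilinZE := (rform_Zvec, rform_dZ, rform_Zvecr, rform_dZr,
  bform_Zvec, bform_dZ).

Lemma bilin_Zvec2 y z : ip (Z y) (Z z) = h ^+ 2 * r y z - A y * A z.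
Proof. by rewrite (bilinE a b) !bilinZE; ring. Qed.

Lemma bilin_Zvec_sign y : 0 < eps * gam a b y -> ip (Z y) (Z y) = B y.
Proof.
move=> y0; rewrite bilin_Zvec2 -/(gam a b y) gam_qf //.
by rewrite BfE_sign // /Af h2; case: eps2 => ->; field.
Qed.

Lemma bilin_Zvec y : U y -> ip (Z y) (Z y) = B y.
Proof. by move=> /U_sign[y0 _ _]; exact: bilin_Zvec_sign. Qed.

Lemma bilin_zeta y : U y -> ip (zeta y) (zeta y) = F2 y.
Proof. by move=> Uy; rewrite bilinZl bilinZr bilin_Zvec //; ring. Qed.

Definition half_dF2 y u := ip (zeta y) (dzeta y u).
(** Half the second derivative of the [a]-square of [zeta]; [bilin_gij] identifies it with [gij]. *)
Definition metric y u v := ip (dzeta y u) (dzeta y v) + ip (zeta y) (d2zeta y u v).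

(** The pairings among [Z], its derivatives and [beta] depend on the vectors only through [b], [q],
    [dq] and [d2q]. What remains is a rational identity in these scalars and [J], verified for each
    value of [eps]. *)
Lemma metric_pullback y u v : U y ->
  h ^+ 2 * metric y u v = ip (dzeta y u) (dzeta y v)
    + (h ^+ 2 - 1) * (half_dF2 y u * half_dF2 y v / F2 y).
Proof.
move=> Uy; have [q0 B0 J0] := U_neq0 Uy.
have ZZ := bilin_Zvec Uy.
have Zd w : ip (Z y) (dZ y w) = h ^+ 2 * (eps * q y * dq y w) - A y * dA y w.
  by rewrite (bilinE a b) !bilinZE (dq_rform _ Uy); ring.
have dZ_Z w : ip (dZ y w) (Z y) = h ^+ 2 * (eps * q y * dq y w) - A y * dA y w.
  by rewrite bilinC.
have dd : ip (dZ y u) (dZ y v) =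
    h ^+ 2 * (eps * (q y * d2q y u v + dq y u * dq y v)) - dA y u * dA y v.
  by rewrite (bilinE a b) !bilinZE (d2q_rform _ _ Uy); ring.
have Zbeta : ip (Z y) (- beta) = - A y.
  by rewrite -scaleN1r bilinZr bilin_raiser // bform_Zvec mulN1r.
rewrite /metric /half_dF2 /zeta /dzeta /d2zeta -/(Z y) -scalerN.
move: (Z y) (dZ y u) (dZ y v) (- beta) ZZ (Zd u) (Zd v) (dZ_Z u) (dZ_Z v) dd Zbeta.
move=> z zu zv nb ZZ Zu Zv uZ vZ uv Zb.
rewrite !(bilinDl, bilinDr, bilinZl, bilinZr) ZZ Zu Zv uZ uv Zb {ZZ Zu Zv uZ vZ uv Zb}.
rewrite /l /dlogJ /dl /dB /dA /Af.
move: B0; rewrite !BfE //; move: (dq y u) (dq y v) (d2q y u v) => du dv d2.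
move: (bf y) (bf u) (bf v) (q y) (J y) q0 J0 => by_ bu bv qy j q0 j0.
rewrite h2.
by case: eps2 => -> B0; field; rewrite j0 // -[qy ^+ 2]mul1r.
Qed.

Lemma dqD y u v : dq y (u + v) = dq y u + dq y v.
Proof. by rewrite /dq rformDr; ring. Qed.

Lemma dqZ y k u : dq y (k *: u) = k * dq y u.
Proof. by rewrite /dq rformZr; ring. Qed.

Lemma dqN y u : dq y (- u) = - dq y u.
Proof. by rewrite -scaleN1r dqZ mulN1r. Qed.

Lemma dlogJD y u v : l y (u + v) = l y u + l y v.
Proof. by rewrite /l /dlogJ dqD bformD; ring. Qed.

Lemma dlogJZ y k u : l y (k *: u) = k * l y u.
Proof. by rewrite /l /dlogJ dqZ bformZ; ring. Qed.

Lemma dZD y u v : dZ y (u + v) = dZ y u + dZ y v.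
Proof. by rewrite /dZ dqD bformD; apply/rowP => i; rewrite !mxE; ring. Qed.

Lemma dZZ y k u : dZ y (k *: u) = k *: dZ y u.
Proof. by rewrite /dZ dqZ bformZ; apply/rowP => i; rewrite !mxE; ring. Qed.

Lemma dzetaD y u v : dzeta y (u + v) = dzeta y u + dzeta y v.
Proof.
by rewrite /dzeta dlogJD dZD; apply/rowP => i; rewrite !mxE; ring.
Qed.

Lemma dzetaZ y k u : dzeta y (k *: u) = k *: dzeta y u.
Proof.
by rewrite /dzeta dlogJZ dZZ; apply/rowP => i; rewrite !mxE; ring.
Qed.

Lemma d2qD y u v w : d2q y w (u + v) = d2q y w u + d2q y w v.
Proof. by rewrite /d2q rformDr dqD; ring. Qed.

Lemma d2qZ y k u w : d2q y w (k *: u) = k * d2q y w u.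
Proof. by rewrite /d2q rformZr dqZ; ring. Qed.

(** Only [dl] is not visibly symmetric; its symmetry says that the 1-form [dlogJ] is closed, a
    rational identity in [b], [q] and their derivatives. *)
Lemma d2zetaC y u v : U y -> d2zeta y u v = d2zeta y v u.
Proof.
move=> Uy; have [q0 B0 J0] := U_neq0 Uy; rewrite /d2zeta.
have -> : d2q y u v = d2q y v u by rewrite /d2q (rformC b aT); ring.
have -> : dl y u v = dl y v u.
  have d2 : d2q y v u = d2q y u v by rewrite /d2q (rformC b aT); ring.
  rewrite /dl /dB d2; move: B0; rewrite !BfE //.
  move: (dq y u) (dq y v) (d2q y u v) => du dv d2' B0.
  by case: eps2 B0 => -> B0; field; rewrite // -[q y ^+ 2]mul1r.
by apply/rowP => i; rewrite !mxE; ring.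
Qed.

Lemma d2zetaDr y w u v : d2zeta y w (u + v) = d2zeta y w u + d2zeta y w v.
Proof.
rewrite /d2zeta /dl dlogJD dZD d2qD dqD bformD.
by apply/rowP => i; rewrite !mxE; ring.
Qed.

Lemma d2zetaZr y w k u : d2zeta y w (k *: u) = k *: d2zeta y w u.
Proof.
rewrite /d2zeta /dl dlogJZ dZZ d2qZ dqZ bformZ.
by apply/rowP => i; rewrite !mxE; ring.
Qed.

Lemma half_dF2D y u v : half_dF2 y (u + v) = half_dF2 y u + half_dF2 y v.
Proof. by rewrite /half_dF2 dzetaD bilinDr. Qed.

Lemma half_dF2Z y k u : half_dF2 y (k *: u) = k * half_dF2 y u.
Proof. by rewrite /half_dF2 dzetaZ bilinZr. Qed.

Lemma metricDr y u v w : metric y w (u + v) = metric y w u + metric y w v.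
Proof. by rewrite /metric dzetaD d2zetaDr !bilinDr; ring. Qed.

Lemma metricZr y k u w : metric y w (k *: u) = k * metric y w u.
Proof. by rewrite /metric dzetaZ d2zetaZr !bilinZr; ring. Qed.

Lemma metricC y u v : U y -> metric y u v = metric y v u.
Proof. by move=> Uy; rewrite /metric d2zetaC // (bilinC _ _ aT). Qed.

Lemma F2_neq0 y : U y -> F2 y != 0.
Proof.
by move=> /U_neq0[_ B0 J0]; rewrite mulf_neq0 ?sqrf_eq0 // expf_neq0.
Qed.

Lemma is_derive_F2 c (t : R) x : is_derive t (1:R) c x -> U (c t) ->
  is_derive t (1:R) (fun s => F2 (c s)) (2 * half_dF2 (c t) x).
Proof.
move=> Dc Uc; have D := is_derive1_bilin a (is_derive_zeta Dc Uc) (is_derive_zeta Dc Uc).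
have -> : 2 * half_dF2 (c t) x =
    ip (dzeta (c t) x) (zeta (c t)) + ip (zeta (c t)) (dzeta (c t) x).
  by rewrite /half_dF2 (bilinC (dzeta _ _) _ aT); ring.
apply: near_eq_is_derive D; near=> s; rewrite bilin_zeta //.
by near: s; exact: U_open Dc Uc.
Unshelve. all: by end_near. Qed.

Lemma is_derive_half_dF2 c (t : R) x u : is_derive t (1:R) c x -> U (c t) ->
  is_derive t (1:R) (fun s => half_dF2 (c s) u) (metric (c t) x u).
Proof.
move=> Dc Uc.
have D := is_derive1_bilin a (is_derive_zeta Dc Uc)
  (is_derive_dzeta Dc (is_derive1_cst u t) Uc).
(* The derivative [0] of the constant vector [u] is written as [0 *: 0], so that homogeneity of
   [dzeta] removes its term. *)
apply: is_derive_eq D _; rewrite /metric -(scale0r 0) dzetaZ scale0r addr0.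
by [].
Qed.

(** Differentiating [metric] as defined would call for third derivatives of [zeta]; in the form
    given by [metric_pullback] second derivatives suffice. *)
Lemma is_derive_metric c (t : R) x u v : is_derive t (1:R) c x -> U (c t) ->
  is_derive t (1:R) (fun s => metric (c s) u v)
    (h ^- 2 * (ip (d2zeta (c t) x u) (dzeta (c t) v)
             + ip (dzeta (c t) u) (d2zeta (c t) x v)
       + (h ^+ 2 - 1) * ((metric (c t) x u * half_dF2 (c t) v
             + half_dF2 (c t) u * metric (c t) x v) / F2 (c t)
          - 2 * half_dF2 (c t) u * half_dF2 (c t) v * half_dF2 (c t) x
            / F2 (c t) ^+ 2))).
Proof.
move=> Dc Uc; have F0 := F2_neq0 Uc; have h0 := lt0r_neq0 h_gt0.
have Du := is_derive_dzeta Dc (is_derive1_cst u t) Uc.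
have Dv := is_derive_dzeta Dc (is_derive1_cst v t) Uc.
have D := is_derive1Ml (h ^- 2) (is_derive1D (is_derive1_bilin a Du Dv)
  (is_derive1Ml (h ^+ 2 - 1) (is_derive1M (is_derive1M
      (is_derive_half_dF2 u Dc Uc) (is_derive_half_dF2 v Dc Uc))
    (is_derive1V (f := fun s => F2 (c s)) F0 (is_derive_F2 Dc Uc))))).
apply: is_derive_eq (near_eq_is_derive _ D) _.
  near=> s; have Us : U (c s) by near: s; exact: U_open Dc Uc.
  by rewrite -metric_pullback // mulKf // expf_neq0.
rewrite -(scale0r 0) !dzetaZ !scale0r !addr0; field.
by have [_ -> ->] := U_neq0 Uc; rewrite h0.
Unshelve. all: by end_near. Qed.

(** * Metric tensor, Christoffel symbols and covariant acceleration *)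

Lemma derive_F2 y u : U y -> 'D_u F2 y = 2 * half_dF2 y u.
Proof.
move=> Uy; have Uy' : U (0 *: u + y) by rewrite scale0r add0r.
have := is_derive_F2 (is_derive1_line u y 0) Uy'.
by rewrite scale0r add0r => D; case: (is_derive_lineP (f := F2) D).
Qed.

Lemma near_line y u : U y -> \forall s \near (0:R), U (s *: u + y).
Proof.
move=> Uy; apply: U_open (is_derive1_line u y 0) _.
by rewrite scale0r add0r.
Qed.

Lemma gijE y i j : U y -> gij F2 y i j = metric y (delta_mx 0 i) (delta_mx 0 j).
Proof.
move=> Uy; rewrite mxE /partial; set ei := delta_mx 0 i; set ej := delta_mx 0 j.
have Uy' : U (0 *: ei + y) by rewrite scale0r add0r.
have := is_derive1Ml 2 (is_derive_half_dF2 ej (is_derive1_line ei y 0) Uy').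
rewrite scale0r add0r => D.
have : is_derive (0:R) (1:R) (fun s => 'D_ej F2 (s *: ei + y)) (2 * metric y ei ej).
  apply: near_eq_is_derive D; near=> s; rewrite derive_F2 //.
  by near: s; exact: near_line.
by move=> D'; have [_ ->] := is_derive_lineP (f := 'D_ej F2) D'; field.
Unshelve. all: by end_near. Qed.

Lemma bilin_gij y u v : U y -> bilin (gij F2 y) u v = metric y u v.
Proof.
move=> Uy; rewrite -(scalar_sum_delta (f := fun w => metric y w v) u).
- rewrite /bilin; apply: eq_bigr => i _.
  rewrite -(scalar_sum_delta (f := metric y (delta_mx 0 i)) v).
  + by rewrite mulr_suml; apply: eq_bigr => j _; rewrite gijE //; ring.
  + by move=> w w'; rewrite metricDr.
  + by move=> k w; rewrite metricZr.
- by move=> w w'; rewrite !(metricC _ v) // metricDr.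
- by move=> k w; rewrite !(metricC _ v) // metricZr.
Qed.

Lemma partial_gij y i j k : U y ->
  let e m := delta_mx 0 m in
  partial (fun z => gij F2 z j k) i y =
  h ^- 2 * (ip (d2zeta y (e i) (e j)) (dzeta y (e k))
             + ip (dzeta y (e j)) (d2zeta y (e i) (e k))
       + (h ^+ 2 - 1) * ((metric y (e i) (e j) * half_dF2 y (e k)
             + half_dF2 y (e j) * metric y (e i) (e k)) / F2 y
          - 2 * half_dF2 y (e j) * half_dF2 y (e k) * half_dF2 y (e i)
            / F2 y ^+ 2)).
Proof.
move=> Uy e; rewrite /partial -/(e i).
have Uy' : U (0 *: e i + y) by rewrite scale0r add0r.
have := is_derive_metric (e j) (e k) (is_derive1_line (e i) y 0) Uy'.
rewrite scale0r add0r => D; set X := (X in _ = X).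
have : is_derive (0:R) (1:R) (fun s => gij F2 (s *: e i + y) j k) X.
  apply: near_eq_is_derive D; near=> s; rewrite gijE //.
  by near: s; exact: near_line.
by move=> D'; case: (is_derive_lineP (f := fun z => gij F2 z j k) D').
Unshelve. all: by end_near. Qed.

(** The first term is the Christoffel symbol of the pull-back of a constant metric. The derivatives
    of the correction term combine into a multiple of [half_dF2 y (e k)], which tangent vectors do
    not see. *)
Lemma Gamma1E y i j k : U y ->
  let e m := delta_mx 0 m in
  Gamma1 F2 k i j y = h ^- 2 * ip (d2zeta y (e i) (e j)) (dzeta y (e k))
    + half_dF2 y (e k) * (h ^- 2 * (h ^+ 2 - 1) * (metric y (e i) (e j) / F2 y
      - half_dF2 y (e i) * half_dF2 y (e j) / F2 y ^+ 2)).
Proof.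
move=> Uy e; rewrite /Gamma1 !partial_gij // -!/(e _).
rewrite (d2zetaC (e j) (e i)) // (d2zetaC (e k) (e i)) // (d2zetaC (e k) (e j)) //.
rewrite !(bilinC (dzeta _ _) (d2zeta _ _ _)) //.
rewrite (metricC (e j) (e i)) // (metricC (e k) (e i)) // (metricC (e k) (e j)) //.
by field; have [_ -> ->] := U_neq0 Uy; rewrite (lt0r_neq0 h_gt0).
Qed.

(** Against tangent vectors the connection is that of the flat pull-back, so the covariant
    acceleration becomes the ordinary second derivative of [zeta] along [c]. *)
Lemma coaccelerationE c (t : R) v : U (c t) -> half_dF2 (c t) v = 0 ->
  let x := derive1 c t in
  \sum_k coacceleration F2 c t k * v 0 k =
  h ^- 2 * ip (d2zeta (c t) x x + dzeta (c t) (derive1 (derive1 c) t)) (dzeta (c t) v).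
Proof.
move=> Uc phi0 x; set x' := derive1 (derive1 c) t; set y := c t in Uc phi0 *.
have h0 := lt0r_neq0 h_gt0.
have M : metric y v x' = h ^- 2 * ip (dzeta y x') (dzeta y v).
  apply: (mulfI (expf_neq0 2 h0)); rewrite metric_pullback // phi0.
  by rewrite !mul0r mulr0 addr0 mulrA mulfV ?expf_neq0 // mul1r (bilinC _ _ aT).
rewrite bilinDl mulrDr -M -bilin_gij //.
rewrite /coacceleration -/y -/x -/x'.
under eq_bigr do rewrite mulrDl.
rewrite big_split /= addrC; congr (_ + _); last first.
  apply: eq_bigr => i _; rewrite mulr_suml; apply: eq_bigr => j _; ring.
pose G k i j := h ^- 2 * ip (d2zeta y (delta_mx 0 i) (delta_mx 0 j)) (dzeta y (delta_mx 0 k)).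
pose S i j := h ^- 2 * (h ^+ 2 - 1) * (metric y (delta_mx 0 i) (delta_mx 0 j) / F2 y
      - half_dF2 y (delta_mx 0 i) * half_dF2 y (delta_mx 0 j) / F2 y ^+ 2).
(* In the second summand the sum over [k] is [half_dF2 y v], which is 0. *)
transitivity (\sum_k ((\sum_i \sum_j G k i j * x 0 i * x 0 j) * v 0 k +
   (\sum_i \sum_j S i j * x 0 i * x 0 j) * (half_dF2 y (delta_mx 0 k) * v 0 k))).
  apply: eq_bigr => k _; rewrite mulrCA mulrA -mulrDl; congr (_ * _).
  rewrite mulr_sumr -big_split; apply: eq_bigr => i _ /=.
  rewrite mulr_sumr -big_split; apply: eq_bigr => j _ /=.
  by rewrite Gamma1E // /G /S; ring.
rewrite big_split /= -mulr_sumr.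
rewrite (scalar_sum_delta (f := half_dF2 y)) ?phi0 ?mulr0 ?addr0;
  [|exact: half_dF2D|exact: half_dF2Z].
(* Linearity is used in one slot at a time: [G1], [G2] and [G3] contract the basis vectors with [x],
   [x] and [v] in turn. *)
pose G1 k i w := h ^- 2 * ip (d2zeta y (delta_mx 0 i) w) (dzeta y (delta_mx 0 k)).
pose G2 k w := h ^- 2 * ip (d2zeta y w x) (dzeta y (delta_mx 0 k)).
pose G3 w := h ^- 2 * ip (d2zeta y x x) (dzeta y w).
rewrite -[RHS](scalar_sum_delta (f := G3) v).
- apply: eq_bigr => k _; congr (_ * _).
  rewrite -[G3 _](scalar_sum_delta (f := G2 k) x).
  + apply: eq_bigr => i _; rewrite -[G2 _ _](scalar_sum_delta (f := G1 k i) x).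
    * by rewrite mulr_suml; apply: eq_bigr => j _; rewrite /G /G1; ring.
    * by move=> u w; rewrite /G1 d2zetaDr bilinDl; ring.
    * by move=> m w; rewrite /G1 d2zetaZr bilinZl; ring.
  + by move=> u w; rewrite /G2 !(d2zetaC _ x) // d2zetaDr bilinDl; ring.
  + by move=> m w; rewrite /G2 !(d2zetaC _ x) // d2zetaZr bilinZl; ring.
- by move=> u w; rewrite /G3 dzetaD bilinDr; ring.
- by move=> m w; rewrite /G3 dzetaZ bilinZr; ring.
Qed.

(** * Inverse of the differential of [zeta] *)

Lemma dq_dzeta y v : U y -> dq y (dzeta y v) = J y * h * (l y v * q y + dq y v).
Proof.
move=> Uy; have [y0 _ _] := U_sign Uy; have [q0 _ _] := U_neq0 Uy.
have -> : q y = eps * gam a b y / q y by rewrite -sqr_qf // expr2 mulfK.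
rewrite /dq /dzeta rformZr rformDr rformZr rform_Zvecr rform_dZr /gam.
by field.
Qed.

Lemma bform_dzeta y v : bf (dzeta y v) = J y * (l y v * A y + dA y v).
Proof. by rewrite bformZ bformD bformZ bform_Zvec bform_dZ. Qed.

Lemma dq_Zvec y : U y -> dq y (Z y) = h * q y.
Proof.
move=> Uy; have [y0 _ _] := U_sign Uy; have [q0 _ _] := U_neq0 Uy.
have -> : q y = eps * gam a b y / q y by rewrite -sqr_qf // expr2 mulfK.
by rewrite /dq rform_Zvecr /gam; field.
Qed.

(** For [w = dzeta y v], the values of [dq y] and [b] on [w] are linear in [l y v], [dq y v] and
    [b v]. Eliminating with the definition of [l] expresses these three by [w], as [l0], [dq0] and
    [b0]; then [v] is read off from [dzeta]. *)
Let l0 y w := g / 2 / (B y * J y) * (A y * dq y w / h - q y * bf w).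
Let dq0 y w := dq y w / (J y * h) - l0 y w * q y.
Let b0 y w := bf w / J y - l0 y w * A y - g / 2 * dq0 y w.
Definition dzeta_inv y w := h^-1 *: ((J y)^-1 *: w - l0 y w *: Z y
  - ((h - 1) * b0 y w - g / 2 * dq0 y w) *: beta).

Lemma dzetaK y v : U y -> dzeta_inv y (dzeta y v) = v.
Proof.
move=> Uy; have [q0 B0 J0] := U_neq0 Uy; have h0 := lt0r_neq0 h_gt0.
have l0E : l0 y (dzeta y v) = l y v.
  rewrite /l0 dq_dzeta // bform_dzeta /l /dlogJ /dA /Af.
  by field; rewrite B0 J0 h0.
have dq0E : dq0 y (dzeta y v) = dq y v.
  by rewrite /dq0 l0E dq_dzeta //; field; rewrite J0 h0.
have b0E : b0 y (dzeta y v) = bf v.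
  by rewrite /b0 l0E dq0E bform_dzeta // /dA; field.
rewrite /dzeta_inv l0E dq0E b0E /dzeta scalerA mulVf // scale1r.
by apply/rowP => i; rewrite !mxE; field.
Qed.

Lemma dzeta_invK y w : U y -> dzeta y (dzeta_inv y w) = w.
Proof.
move=> Uy; have [q0 B0 J0] := U_neq0 Uy; have h0 := lt0r_neq0 h_gt0.
set v := dzeta_inv y w.
have dqv : dq y v = dq0 y w.
  have dqb : dq y beta = 0 by rewrite /dq rform_raiser // mulr0 mul0r.
  rewrite /v /dzeta_inv; move: (Z y) (dq_Zvec Uy) => z dqz.
  rewrite !(dqD, dqN, dqZ) dqb dqz /dq0.
  by field; rewrite J0 h0.
have bv : bf v = b0 y w.
  rewrite /v /dzeta_inv; move: (Z y) (bform_Zvec y) => z bz.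
  rewrite !(bformD, bformN, bformZ) bform_raise // bz.
  by rewrite /b0; field; rewrite J0 h0.
have lv : l y v = l0 y w.
  rewrite /l /dlogJ dqv bv /b0 /dq0 /l0 /Af.
  by field; rewrite J0 h0 B0.
rewrite /dzeta /dZ lv dqv bv /v /dzeta_inv.
by apply/rowP => i; rewrite !mxE; field; rewrite h0 J0.
Qed.

(** The velocity of the curve built below is [dzeta_inv] of a velocity on the pseudo-sphere; its
    differentiability provides the second derivative required of a geodesic. *)
Lemma derivable_dzeta_inv c (w : R -> 'rV[R]_N) (t : R) x w' :
  is_derive t (1:R) c x -> is_derive t (1:R) w w' -> U (c t) ->
  derivable (fun s => dzeta_inv (c s) (w s)) t 1.
Proof.
move=> Dc Dw Uc; have [q0 B0 J0] := U_neq0 Uc; have h0 := lt0r_neq0 h_gt0.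
have Db := is_derive1_bform b Dc; have Dq := is_derive_qf Dc Uc.
have DA := is_derive1D Db (is_derive1Ml (g / 2) Dq).
have Dbw := is_derive1_bform b Dw; have Ddq := is_derive_dq Dc Dw Uc.
have DJ := J_derive Dc Uc; have DB := is_derive_Bf Dc Uc.
have BJ0 : B (c t) * J (c t) != 0 by rewrite mulf_neq0.
have Jh0 : J (c t) * h != 0 by rewrite mulf_neq0.
have Ch := is_derive1_cst h t; have Ch' := is_derive1_cst (h^-1) t.
have Dl0 := is_derive1M
  (is_derive1Ml (g / 2) (is_derive1V (f := fun s => B (c s) * J (c s)) BJ0
      (is_derive1M DB DJ)))
  (is_derive1B (is_derive1M (is_derive1M DA Ddq) Ch') (is_derive1M Dq Dbw)).
have Ddq0 := is_derive1B (is_derive1M Ddq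
  (is_derive1V (f := fun s => J (c s) * h) Jh0 (is_derive1M DJ Ch)))
  (is_derive1M Dl0 Dq).
have DVJ := is_derive1V (f := fun s => J (c s)) J0 DJ.
have Db0 := is_derive1B (is_derive1B (is_derive1M Dbw DVJ) (is_derive1M Dl0 DA))
  (is_derive1Ml (g / 2) Ddq0).
have D1 := is_derive1Z (is_derive1B (is_derive1Ml (h - 1) Db0)
  (is_derive1Ml (g / 2) Ddq0)) (is_derive1_cst beta t).
have D := is_derive1Z Ch' (is_deriveB (is_deriveB (is_derive1Z DVJ Dw)
  (is_derive1Z Dl0 (is_derive_Zvec Dc Uc))) D1).
exact: (@ex_derive _ _ _ _ _ _ _ D).
Qed.

(** * Inverse of [zeta] *)

Definition Zinv y := h^-1 *: (y - ((h - 1) * bf y - g / 2 * q y) *: beta).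
(** [J] has degree 0, so its value at the preimage is already known from [Zinv y], which lies on the
    same ray. *)
Definition zeta_inv y := (J (Zinv y))^-1 *: Zinv y.

Hypothesis J_homogeneous : forall k y, 0 < k -> U y -> J (k *: y) = J y.
Hypothesis U_cone : forall k y, 0 < k -> U y -> U (k *: y).

Lemma qf_scale y z k : 0 <= k -> gam a b y = k ^+ 2 * gam a b z -> q y = k * q z.
Proof.
move=> k0 yz; rewrite /qf yz normrM (ger0_norm (sqr_ge0 k)) sqrtrM ?sqr_ge0 //.
by rewrite sqrtr_sqr (ger0_norm k0).
Qed.

Lemma qfZ k y : 0 <= k -> q (k *: y) = k * q y.
Proof.
by move=> k0; apply: qf_scale => //; rewrite /gam rformZl rformZr; ring.
Qed.

Lemma ZvecZ k y : 0 <= k -> Z (k *: y) = k *: Z y.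
Proof.
move=> k0; rewrite /Z /Zvec bformZ qfZ //.
by apply/rowP => i; rewrite !mxE; ring.
Qed.

Lemma ZinvZ k y : 0 <= k -> Zinv (k *: y) = k *: Zinv y.
Proof.
move=> k0; rewrite /Zinv bformZ qfZ //.
by apply/rowP => i; rewrite !mxE; ring.
Qed.

Lemma bform_Zinv y : bf (Zinv y) = bf y - g / 2 * q y / h.
Proof.
rewrite /Zinv !(bformD, bformN, bformZ) bform_raise //.
by field; rewrite lt0r_neq0.
Qed.

Lemma rform_Zinv y u : r (Zinv y) u = r y u / h.
Proof.
rewrite /Zinv rformZl -scaleNr rformDl rformZl rform_raise //.
by field; rewrite lt0r_neq0.
Qed.

Lemma qf_Zinv y : q (Zinv y) = q y / h.
Proof.
rewrite mulrC; apply: qf_scale; first by rewrite invr_ge0 ltW.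
by rewrite /gam rform_Zinv (rformC b aT) rform_Zinv; field; rewrite lt0r_neq0.
Qed.

Lemma qf_Zvec y : q (Z y) = h * q y.
Proof.
apply: qf_scale; first exact: ltW.
by rewrite /gam rform_Zvec (rformC b aT) rform_Zvec; ring.
Qed.

(** The coefficient [(h - 1) b - g q / 2] takes the same value at a point and at its image under
    [Z], so the multiple of [beta] to subtract can be computed from the image. *)
Lemma ZinvK y : Z (Zinv y) = y.
Proof.
have h0 := lt0r_neq0 h_gt0.
rewrite /Z /Zvec bform_Zinv qf_Zinv /Zinv.
by apply/rowP => i; rewrite !mxE; field.
Qed.

Lemma ZvecK y : Zinv (Z y) = y.
Proof.
have h0 := lt0r_neq0 h_gt0.
rewrite /Zinv bform_Zvec qf_Zvec /Z /Zvec /Af.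
by apply/rowP => i; rewrite !mxE; field.
Qed.

Lemma zetaK y : U y -> zeta_inv (zeta y) = y.
Proof.
move=> Uy; have [_ _ J0] := U_sign Uy.
rewrite /zeta_inv /zeta ZinvZ; last exact: ltW.
by rewrite ZvecK J_homogeneous // scalerA mulVf ?scale1r // lt0r_neq0.
Qed.

Lemma zeta_invK z : U (Zinv z) -> U (zeta_inv z) /\ zeta (zeta_inv z) = z.
Proof.
move=> Uz; have [_ _ J0] := U_sign Uz; have k0 : 0 < (J (Zinv z))^-1 by rewrite invr_gt0.
split; first exact: U_cone.
rewrite /zeta /zeta_inv J_homogeneous // -/(Z _) ZvecZ; last exact: ltW.
by rewrite ZinvK scalerA mulfV ?scale1r // lt0r_neq0.
Qed.

Lemma is_derive_Zinv (z : R -> 'rV[R]_N) (t : R) z' : is_derive t (1:R) z z' ->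
  U (Zinv (z t)) -> exists y', is_derive t (1:R) (fun s => Zinv (z s)) y'.
Proof.
move=> Dz /U_sign[z0 _ _].
have z1 : 0 < eps * gam a b (z t).
  have -> : gam a b (z t) = h ^+ 2 * gam a b (Zinv (z t)).
    by rewrite /gam rform_Zinv (rformC b aT) rform_Zinv; field; rewrite lt0r_neq0.
  by rewrite mulrCA mulr_gt0 // exprn_gt0.
have D := is_derive1Z (is_derive1_cst h^-1 t) (is_deriveB Dz
  (is_derive1Z (is_derive1B (is_derive1Ml (h - 1) (is_derive1_bform b Dz))
     (is_derive1Ml (g / 2) (is_derive_qf_sign Dz z1))) (is_derive1_cst beta t))).
by eexists; exact: D.
Qed.

(** [is_derive_Zinv] leaves the value of the derivative open; differentiating
    [zeta (zeta_inv z) = z] forces it, as [dzeta] is injective. *)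
Lemma is_derive_zeta_inv (z : R -> 'rV[R]_N) (t : R) z' : is_derive t (1:R) z z' ->
  U (Zinv (z t)) ->
  is_derive t (1:R) (fun s => zeta_inv (z s)) (dzeta_inv (zeta_inv (z t)) z').
Proof.
move=> Dz Uz; have [y' Dy] := is_derive_Zinv Dz Uz.
have [_ _ J0] := U_neq0 Uz.
have Dc := is_derive1Z (is_derive1V (f := fun s => J (Zinv (z s))) J0 (J_derive Dy Uz)) Dy.
have [Uc zz] := zeta_invK Uz.
apply: (is_derive_eq Dc _); set x := (X in X = _).
have Dz' := is_derive_zeta Dc Uc.
suff -> : z' = dzeta (zeta_inv (z t)) x by rewrite dzetaK.
have Dz2 : is_derive t (1:R) z (dzeta (zeta_inv (z t)) x).
  apply: near_eq_is_derive Dz'; near=> s.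
  have Us : U (Zinv (z s)) by near: s; exact: U_open Dy Uz.
  by case: (zeta_invK Us).
by case: Dz => _ <-; case: Dz2 => _ <-.
Unshelve. all: by end_near. Qed.

(** * Geodesics of the indicatrix *)

Implicit Types (t s K : R).

Lemma half_dF2_bilin y u : half_dF2 y u = ip (zeta y) (dzeta y u).
Proof. by []. Qed.

Lemma bilin_scaleD (z1 z2 : 'rV[R]_N) k m : ip (k *: z1 + m *: z2) (k *: z1 + m *: z2) =
  k ^+ 2 * ip z1 z1 + 2 * k * m * ip z1 z2 + m ^+ 2 * ip z2 z2.
Proof.
by rewrite !(bilinDl, bilinDr, bilinZl, bilinZr) (bilinC z2 z1 aT); ring.
Qed.

Definition free_motion c := forall t, 0 <= t <= 1 ->
  [/\ U (c t) /\ F2 (c t) = eps, derivable c t 1, derivable (derive1 c) t 1 &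
      forall v, 'D_v F2 (c t) = 0 -> \sum_k coacceleration F2 c t k * v 0 k = 0].

(** Every vector orthogonal to [z] is the image under [dzeta] of a tangent vector, so the geodesic
    equation makes [z''] a multiple of [z]. Differentiating [ip (z t) (z t) = eps] twice yields the
    factor, which is constant because the speed [E] is. *)
Lemma geodesic_ode c : free_motion c ->
  exists K V, [/\ ip (zeta (c 0)) V = 0, K = - eps * ip V V,
    forall t, 0 <= t <= 1 -> zeta (c t) = csK K t *: zeta (c 0) + snK K t *: V &
    forall t, 0 <= t <= 1 -> ds F2 (c t) (derive1 c t) = Num.sqrt `|K| / h].
Proof.
move=> Hc.
pose z t := zeta (c t); pose w t := dzeta (c t) (derive1 c t).
pose X t := d2zeta (c t) (derive1 c t) (derive1 c t)
  + dzeta (c t) (derive1 (derive1 c) t).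
have zz t : 0 <= t <= 1 -> ip (z t) (z t) = eps.
  by move=> /Hc[[Uc Fc] _ _ _]; rewrite bilin_zeta.
have Dz t : 0 <= t <= 1 -> is_derive t (1:R) z (w t).
  by move=> /Hc[[Uc _] /derivable_derive1 Dc _ _]; exact: is_derive_zeta.
have Dw t : 0 <= t <= 1 -> is_derive t (1:R) w (X t).
  move=> /Hc[[Uc _] /derivable_derive1 Dc /derivable_derive1 Dc' _].
  exact: is_derive_dzeta.
have itv01 (t : R) : 0 < t < 1 -> 0 <= t <= 1 by lra.
pose m t := ip (z t) (w t).
have Dm t : 0 <= t <= 1 -> is_derive t (1:R) m (ip (w t) (w t) + ip (z t) (X t)).
  by move=> t01; exact: is_derive1_bilin (Dz _ t01) (Dw _ t01).
(* Nothing is known of [c] outside [[0, 1]], so the constraint is differentiated in the interior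
   only; [m0] reaches the end points. *)
have m_int t : 0 < t < 1 -> m t = 0.
  move=> t01; have Dzt := Dz _ (itv01 _ t01).
  have D1 := is_derive1_bilin a Dzt Dzt.
  have D0 : is_derive t (1:R) (fun s => ip (z s) (z s)) 0.
    apply: near_eq_is_derive (is_derive1_cst eps t).
    near=> s; rewrite zz //; apply: itv01.
    by near: s; exact: near_itv01.
  have := is_derive1_unique D1 D0; rewrite (bilinC (w t) _ aT) -/(m t); lra.
have m0 t : 0 <= t <= 1 -> m t = 0.
  move=> t01; have h01 : 0 < (1 / 2 : R) < 1 by lra.
  have md s : 0 <= s <= 1 -> derivable m s 1 by move=> /Dm[].
  have m' s : 0 < s < 1 -> is_derive s (1:R) m 0.
    move=> s01; apply: near_eq_is_derive (is_derive1_cst 0 s).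
    by near=> x; rewrite m_int //; near: x; exact: near_itv01.
  rewrite (derive0_constant md m' t01) -(derive0_constant md m' (itv01 _ h01)).
  exact: m_int.
have Xorth t u : 0 <= t <= 1 -> ip (z t) u = 0 -> ip (X t) u = 0.
  move=> t01 zu; have [[Uc _] _ _ geo] := Hc _ t01.
  have phi : half_dF2 (c t) (dzeta_inv (c t) u) = 0.
    by rewrite half_dF2_bilin dzeta_invK.
  have := geo (dzeta_inv (c t) u); rewrite derive_F2 // phi mulr0 => /(_ erefl).
  rewrite coaccelerationE // dzeta_invK // => /eqP.
  by rewrite mulf_eq0 invr_eq0 expf_eq0 /= (gt_eqF h_gt0) => /eqP.
(* Test against [u] minus its component along [z t], which is [(eps * ip (z t) u) *: z t] since
   [eps^2 = 1]. *)
have XE t : 0 <= t <= 1 -> X t = (eps * ip (X t) (z t)) *: z t.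
  move=> t01; apply/eqP; rewrite -subr_eq0; apply/eqP.
  apply: (bilin_nondegenerate a_unit) => u.
  have := Xorth t (u - (eps * ip (z t) u) *: z t) t01.
  rewrite !bilinBr !(bilinZr _ (eps * _)) zz // bilinBl (bilinZl _ (eps * _)) => Xo.
  rewrite -[RHS]Xo; first by ring.
  by rewrite mulrAC -expr2 sqr_eps mul1r subrr.
pose E t := ip (w t) (w t).
have DE t : 0 <= t <= 1 -> is_derive t (1:R) E 0.
  move=> t01; apply: is_derive_eq (is_derive1_bilin a (Dw _ t01) (Dw _ t01)) _.
  by rewrite (bilinC (w t) _ aT) (Xorth _ _ t01 (m0 _ t01)) addr0.
have E0 t : 0 <= t <= 1 -> E t = E 0.
  apply: derive0_constant => s s01; first by case: (DE _ s01).
  by apply: DE; exact: itv01.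
pose K := - eps * E 0.
(* The derivative of [m] is [E + ip (z t) (X t)], and it vanishes where [m] is 0 on a
   neighbourhood. *)
have Xint t : 0 < t < 1 -> X t = K *: z t.
  move=> t01; have t01' := itv01 _ t01.
  rewrite XE //; congr (_ *: _).
  have D0 : is_derive t (1:R) m 0.
    apply: near_eq_is_derive (is_derive1_cst 0 t).
    by near=> x; rewrite m_int //; near: x; exact: near_itv01.
  have := is_derive1_unique (Dm _ t01') D0.
  rewrite -/(E t) E0 // (bilinC (z t) _ aT) => /eqP.
  by rewrite addrC addr_eq0 => /eqP ->; rewrite /K; ring.
exists K, (w 0); split=> //.
- by apply: m0; rewrite lexx ler01.
- move=> t t01; apply/rowP => i; rewrite -/(z t) -/(z 0).
  rewrite [RHS]mxE [X in _ = X + _]mxE [X in _ = _ + X]mxE.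
  have Di s : 0 <= s <= 1 -> is_derive s (1:R) (fun s => z s 0 i) (w s 0 i).
    by move=> /Dz/is_derive_mxP.
  apply: (linear_ode (f := fun s => z s 0 i) (f' := fun s => w s 0 i) (K := K) Di _ _ t01).
  + by move=> s /Dw/is_derive_mxP/(_ i)[].
  + move=> s s01; have /is_derive_mxP/(_ i) := Dw _ (itv01 _ s01).
    by rewrite Xint // mxE.
- move=> t t01; have [[Uc _] _ _ _] := Hc _ t01; rewrite /ds bilin_gij //.
  have h0 := lt0r_neq0 h_gt0.
  have -> : metric (c t) (derive1 c t) (derive1 c t) = h ^- 2 * E 0.
    apply: (mulfI (expf_neq0 2 h0)); rewrite metric_pullback // half_dF2_bilin.
    rewrite -/(z t) -/(w t) -/(m t) m0 // !mul0r mulr0 addr0 -/(E t) E0 //.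
    by rewrite mulrA mulfV ?mul1r // expf_neq0.
  rewrite normrM sqrtrM ?normr_ge0 // mulrC; congr (_ * _).
    congr Num.sqrt; rewrite /K normrM normrN.
    have -> : `|eps| = 1 by case: eps2 => ->; rewrite ?normrN normr1.
    by rewrite mul1r.
  by rewrite ger0_norm ?invr_ge0 ?exprn_ge0 ?ltW // sqrtrV ?exprn_ge0 ?ltW // sqrtr_sqr gtr0_norm.
Unshelve. all: by end_near. Qed.

Lemma arc_length_constant (f : 'rV[R]_N -> R) c k :
  (forall t, 0 <= t <= 1 -> ds f (c t) (derive1 c t) = k) -> arc_length f c = k.
Proof.
move=> dsk; rewrite /arc_length (@eq_Rintegral _ _ _ _ _ (fun=> k)).
  have L : (lebesgue_measure `[0%R, 1%R]%classic = 1 :> \bar R)%E.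
    by rewrite lebesgue_measure_itv /= lte_fin ltr01 -EFinB subr0.
  by rewrite Rintegral_cst // [fine _](congr1 fine L) mulr1.
by move=> t; rewrite inE /= in_itv /= => /dsk.
Qed.

Lemma free_motion_norm c t : free_motion c -> 0 <= t <= 1 ->
  ip (zeta (c t)) (zeta (c t)) = eps.
Proof. by move=> Hc /Hc[[Uc Fc] _ _ _]; rewrite bilin_zeta. Qed.

Lemma geodesic_endpoint c K V : free_motion c -> ip (zeta (c 0)) V = 0 ->
  (forall t, 0 <= t <= 1 -> zeta (c t) = csK K t *: zeta (c 0) + snK K t *: V) ->
  csK K 1 = eps * ip (zeta (c 0)) (zeta (c 1)).
Proof.
move=> Hc zV zE; have z0 : ip (zeta (c 0)) (zeta (c 0)) = eps.
  by apply: free_motion_norm; rewrite ?lexx ?ler01.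
rewrite (zE 1) ?lexx ?ler01 // bilinDr (bilinZr _ (csK _ _)) (bilinZr _ (snK _ _)).
by rewrite zV z0 mulr0 addr0 mulrCA -expr2 sqr_eps mulr1.
Qed.

(** Common end points fix [K] by [csK_inj], then [V] because [snK K 1] is nonzero; injectivity of
    [zeta] returns to the curves. *)
Lemma geodesic_determined c c' K V K' V' :
  free_motion c -> free_motion c' -> c 0 = c' 0 -> c 1 = c' 1 ->
  - pi ^+ 2 < K -> - pi ^+ 2 < K' ->
  ip (zeta (c 0)) V = 0 -> ip (zeta (c' 0)) V' = 0 ->
  (forall t, 0 <= t <= 1 -> zeta (c t) = csK K t *: zeta (c 0) + snK K t *: V) ->
  (forall t, 0 <= t <= 1 -> zeta (c' t) = csK K' t *: zeta (c' 0) + snK K' t *: V') ->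
  forall t, 0 <= t <= 1 -> c t = c' t.
Proof.
move=> Hc Hc' e0 e1 Kpi Kpi' zV zV' zE zE' t t01.
have i1 : 0 <= (1 : R) <= 1 by rewrite ler01 lexx.
have KK : K = K'.
  apply: csK_inj => //; rewrite (geodesic_endpoint Hc zV zE) (geodesic_endpoint Hc' zV' zE').
  by rewrite e0 e1.
have VV : V = V'.
  have S1 : snK K 1 != 0 by rewrite lt0r_neq0 // snK_gt0 // lexx ltr01.
  apply: (scalerI S1); apply: (addrI (csK K 1 *: zeta (c 0))).
  by rewrite -zE // KK e0 -zE' // e1.
have [[Uc _] _ _ _] := Hc _ t01; have [[Uc' _] _ _ _] := Hc' _ t01.
have E : zeta (c t) = zeta (c' t) by rewrite zE // zE' // KK VV e0.
by have := congr1 zeta_inv E; rewrite !zetaK.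
Qed.

(** * The arc of the pseudo-sphere joining two points *)

Section Arc.
Variables (p1 p2 : 'rV[R]_N) (K : R).
Hypothesis K_gt : - pi ^+ 2 < K.
Hypothesis p1_norm : ip (zeta p1) (zeta p1) = eps.
Hypothesis p2_norm : ip (zeta p2) (zeta p2) = eps.
Hypothesis K_angle : csK K 1 = eps * ip (zeta p1) (zeta p2).
Hypothesis U1 : U p1.
Hypothesis U2 : U p2.

(** The initial velocity, solved from [arc 1 = zeta p2]. *)
Let V := (snK K 1)^-1 *: (zeta p2 - csK K 1 *: zeta p1).

Definition arc t := csK K t *: zeta p1 + snK K t *: V.

Let S1 : snK K 1 != 0.
Proof. by rewrite lt0r_neq0 // snK_gt0 // lexx ltr01. Qed.

Lemma bilin_p12 : ip (zeta p1) (zeta p2) = eps * csK K 1.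
Proof. by rewrite K_angle mulrA -expr2 sqr_eps mul1r. Qed.

Lemma bilin_p1V : ip (zeta p1) V = 0.
Proof.
rewrite /V bilinZr bilinBr (bilinZr _ (csK _ _)) p1_norm bilin_p12; ring.
Qed.

Lemma bilin_VV : ip V V = - eps * K.
Proof.
have C := csK_sqr K 1; rewrite /V bilinZr bilinZl bilinBl !bilinBr.
rewrite !(bilinZr _ (csK _ _)) !(bilinZl _ (csK _ _)) p1_norm p2_norm.
rewrite (bilinC (zeta p2) _ aT) bilin_p12.
apply: (mulfI (expf_neq0 2 S1)).
transitivity (eps * (1 - csK K 1 ^+ 2)); first by field.
by rewrite -[X in eps * (X - _)]C; ring.
Qed.

Lemma arc_norm t : ip (arc t) (arc t) = eps.
Proof.
rewrite /arc bilin_scaleD p1_norm bilin_p1V bilin_VV -[RHS]mulr1 -(csK_sqr K t).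
ring.
Qed.

Lemma arc0 : arc 0 = zeta p1.
Proof. by rewrite /arc csK0 snK0 scale1r scale0r addr0. Qed.

Lemma arc1 : arc 1 = zeta p2.
Proof. by rewrite /arc /V (scalerA (snK K 1)) mulfV // scale1r addrC subrK. Qed.

Let arc' t := (K * snK K t) *: zeta p1 + csK K t *: V.

Lemma is_derive_arc t : is_derive t (1:R) arc (arc' t).
Proof.
have D := is_derive1D
  (is_derive1Z (is_derive_csK K t) (is_derive1_cst (zeta p1) t))
  (is_derive1Z (is_derive_snK K t) (is_derive1_cst V t)).
by apply: is_derive_eq D _; rewrite !scaler0 !addr0.
Qed.

Lemma is_derive_arc' t : is_derive t (1:R) arc' (K *: arc t).
Proof.
have D := is_derive1D
  (is_derive1Z (is_derive1Ml K (is_derive_snK K t)) (is_derive1_cst (zeta p1) t))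
  (is_derive1Z (is_derive_csK K t) (is_derive1_cst V t)).
by apply: is_derive_eq D _; rewrite !scaler0 !addr0 /arc scalerDr !scalerA.
Qed.

Hypothesis arc_U : forall t, 0 <= t <= 1 -> U (Zinv (arc t)).

Definition geodesic_arc t := zeta_inv (arc t).

Lemma geodesic_arc0 : geodesic_arc 0 = p1.
Proof. by rewrite /geodesic_arc arc0 zetaK. Qed.

Lemma geodesic_arc1 : geodesic_arc 1 = p2.
Proof. by rewrite /geodesic_arc arc1 zetaK. Qed.

Lemma geodesic_arc_motion : free_motion geodesic_arc.
Proof.
move=> t t01; set c := geodesic_arc; have Ut := arc_U t01.
have [Uc zc] := zeta_invK Ut.
have [y' Dy] := is_derive_Zinv (is_derive_arc t) Ut.
(* The arc is defined on the whole line, so even at 0 and 1 a full neighbourhood is available and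
   the derivatives are two-sided. *)
have near_U : \forall s \near t, U (Zinv (arc s)) by exact: U_open Dy Ut.
have Dc s : U (Zinv (arc s)) -> is_derive s (1:R) c (dzeta_inv (c s) (arc' s)).
  exact: is_derive_zeta_inv (is_derive_arc s).
have c'E : \forall s \near t, dzeta_inv (c s) (arc' s) = derive1 c s.
  near=> s; have Us : U (Zinv (arc s)) by near: s.
  by rewrite derive1E; case: (Dc s Us) => _ ->.
have dc' : derivable (derive1 c) t 1.
  by apply: near_eq_derivable c'E _; exact: derivable_dzeta_inv (Dc t Ut) (is_derive_arc' t) Uc.
have Fc : F2 (c t) = eps by have := bilin_zeta Uc; rewrite zc arc_norm => <-.
split; [by split|by case: (Dc t Ut)|exact: dc'|].
move=> v; rewrite derive_F2 // => /eqP; rewrite mulf_eq0 pnatr_eq0 /= => /eqP phi0.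
have Dct : is_derive t (1:R) c (derive1 c t) by apply: derivable_derive1; case: (Dc t Ut).
rewrite coaccelerationE //; have Dw := is_derive_dzeta Dct (derivable_derive1 dc') Uc.
have Dw' : is_derive t (1:R) arc' (d2zeta (c t) (derive1 c t) (derive1 c t)
    + dzeta (c t) (derive1 (derive1 c) t)).
  apply: near_eq_is_derive Dw; near=> s.
  have Us : U (Zinv (arc s)) by near: s.
  have [Ucs _] := zeta_invK Us.
  by rewrite -(near c'E s) // dzeta_invK.
(* The acceleration on the pseudo-sphere is [K] times the position, hence orthogonal to the image of
   any tangent vector. *)
rewrite (is_derive1_unique Dw' (is_derive_arc' t)) (bilinZl _ K) -{1}zc.
by rewrite -half_dF2_bilin phi0 !mulr0.
Unshelve. all: by end_near. Qed.

End Arc.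

(** On the pseudo-sphere [2 (eps * ip (z 0) (z t) - 1)] is [- eps] times the square of the chord
    [z t - z 0], so the first derivative of [c] at 0 suffices for this second-order limit. *)
Lemma second_order_angle c x : is_derive (0:R) (1:R) c x ->
  (\forall t \near (0:R), U (c t) /\ F2 (c t) = eps) ->
  let K := - eps * ip (dzeta (c 0) x) (dzeta (c 0) x) in
  [/\ bilin (gij F2 (c 0)) x x = - eps * K / h ^+ 2,
      ds F2 (c 0) x = Num.sqrt `|K| / h &
      2 * (eps * ip (zeta (c 0)) (zeta (c t)) - 1) / t ^+ 2 @[t --> 0^'] --> K].
Proof.
move=> Dc nU K; have [Uc Fc] := nbhs_singleton nU.
pose w := dzeta (c 0) x; pose z t := zeta (c t).
have Dz : is_derive (0:R) (1:R) z w := is_derive_zeta Dc Uc.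
have zw : ip (z 0) w = 0.
  have D1 := is_derive1_bilin a Dz Dz.
  have D0 : is_derive (0:R) (1:R) (fun s => ip (z s) (z s)) 0.
    apply: near_eq_is_derive (is_derive1_cst eps (0:R)).
    near=> s; have [Us <-] : U (c s) /\ F2 (c s) = eps by near: s.
    by rewrite bilin_zeta.
  have := is_derive1_unique D1 D0; rewrite (bilinC w _ aT) -/(z 0); lra.
have gE : bilin (gij F2 (c 0)) x x = - eps * K / h ^+ 2.
  have h0 := lt0r_neq0 h_gt0.
  rewrite bilin_gij //; apply: (mulfI (expf_neq0 2 h0)).
  rewrite metric_pullback // half_dF2_bilin -/w -/(z 0) zw !mul0r mulr0 addr0.
  by rewrite mulrC divfK ?expf_neq0 // /K -/w mulrA mulrNN -expr2 sqr_eps mul1r.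
split=> //.
  have hV : 0 <= (h ^+ 2)^-1 by rewrite invr_ge0 exprn_ge0 // ltW.
  have -> : ds F2 (c 0) x = Num.sqrt (`|K| / h ^+ 2).
    rewrite /ds gE !normrM normrN (ger0_norm hV).
    by have -> : `|eps| = 1 by [case: eps2 => ->; rewrite ?normrN normr1]; rewrite mul1r.
  by rewrite sqrtrM // sqrtrV ?exprn_ge0 ?ltW // sqrtr_sqr (gtr0_norm h_gt0).
pose d t i := t^-1 * (z t 0 i - z 0 0 i).
have dw i : d t i @[t --> 0^'] --> w 0 i.
  have /is_derive_mxP/(_ i)[D <-] := Dz.
  have -> : (fun t => d t i) = (fun t => t^-1 *: (((fun s => z s 0 i) \o shift 0) (t *: 1) - z 0 0 i)).
    by apply/funext => t /=; rewrite addr0 [_%:A]mulr1.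
  exact: D.
have : - eps * (\sum_i \sum_j a i j * d t i * d t j) @[t --> 0^'] --> K.
  apply: cvgM; first exact: cvg_cst.
  apply: cvg_big => //; first exact: add_continuous.
  move=> i _; apply: cvg_big => //; first exact: add_continuous.
  move=> j _; apply: cvgM => //; apply: cvgM => //; exact: cvg_cst.
apply: near_eq_cvg_to; near=> t.
have [Ut Ft] : U (c t) /\ F2 (c t) = eps.
  by near: t; exact: nbhs_dnbhs.
have t0 : t != 0 by near: t; exact: nbhs_dnbhs_neq.
have -> : \sum_i \sum_j a i j * d t i * d t j = t ^- 2 * ip (z t - z 0) (z t - z 0).
  rewrite /bilin mulr_sumr; apply: eq_bigr => i _; rewrite mulr_sumr.
  by apply: eq_bigr => j _; rewrite /d ![(z t - z 0) _ _]mxE ![(- z 0) _ _]mxE; field.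
rewrite bilinBl !bilinBr !bilin_zeta // Fc Ft (bilinC (zeta (c t)) _ aT).
rewrite -/(z 0) -/(z t).
transitivity (t ^- 2 * (2 * (eps * ip (z 0) (z t)) - 2 * eps ^+ 2)); first by ring.
by rewrite sqr_eps; field.
Unshelve. all: by end_near. Qed.

(** * Rays, the indicatrix and the angle *)

Lemma gamZ k y : gam a b (k *: y) = k ^+ 2 * gam a b y.
Proof. by rewrite /gam rformZl rformZr; ring. Qed.

Lemma BfZ k y : 0 <= k -> B (k *: y) = k ^+ 2 * B y.
Proof. by move=> k0; rewrite /Bf gamZ bformZ qfZ //; ring. Qed.

Lemma F2Z k y : 0 < k -> U y -> F2 (k *: y) = k ^+ 2 * F2 y.
Proof.
by move=> k0 Uy; rewrite /= J_homogeneous // BfZ ?(ltW k0) //; ring.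
Qed.

(** On the indicatrix [1 = k^2 |B y| (J y)^2], so the scalar [k J y] in front of [Z y] no longer
    involves [J]. *)
Lemma zeta_ray y k : 0 < k -> U y -> F2 (k *: y) = eps ->
  zeta (k *: y) = (Num.sqrt `|B y|)^-1 *: Z y.
Proof.
move=> k0 Uy Fk; have [y0 B0 J0] := U_sign Uy.
rewrite /zeta J_homogeneous // -/(Z _) ZvecZ ?(ltW k0) // scalerA; congr (_ *: _).
have s0 : 0 < Num.sqrt `|B y| by rewrite sqrtr_gt0 normr_eps.
apply: (mulIf (lt0r_neq0 s0)); rewrite mulVf ?lt0r_neq0 //.
apply/eqP; rewrite -(@eqrXn2 _ 2) ?mulr_ge0 ?(ltW J0) ?(ltW k0) ?(ltW s0) //.
rewrite expr1n exprMn sqr_sqrtr // normr_eps //; apply/eqP.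
by rewrite -sqr_eps -[X in _ = X * _]Fk F2Z //; ring.
Qed.

Definition cos_angle y1 y2 :=
  eps * ip (Z y1) (Z y2) / (Num.sqrt `|B y1| * Num.sqrt `|B y2|).

Lemma cos_angle_ray y1 y2 k1 k2 : U y1 -> U y2 -> 0 < k1 -> 0 < k2 ->
  F2 (k1 *: y1) = eps -> F2 (k2 *: y2) = eps ->
  eps * ip (zeta (k1 *: y1)) (zeta (k2 *: y2)) = cos_angle y1 y2.
Proof.
move=> U1 U2 k10 k20 F1 F2'; rewrite !zeta_ray // bilinZl bilinZr /cos_angle invfM.
ring.
Qed.

Section Sector.
Variable D : set 'rV[R]_N.
Hypothesis D_U : forall y, D y -> U y.
Hypothesis D_cone : forall k y, 0 < k -> D y -> D (k *: y).
Let S := indicatrix F2 D eps.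

Lemma ray_meets_unique y : D y -> exists! p, ray_meets S y p.
Proof.
move=> Dy; have Uy := D_U Dy; have [y0 B0 J0] := U_sign Uy.
have F0 : 0 < eps * F2 y by rewrite /= mulrA mulr_gt0 // exprn_gt0.
have s0 : 0 < Num.sqrt (eps * F2 y) by rewrite sqrtr_gt0.
pose k := (Num.sqrt (eps * F2 y))^-1; have k0 : 0 < k by rewrite invr_gt0.
have s2 : Num.sqrt (eps * F2 y) ^+ 2 = eps * F2 y by rewrite sqr_sqrtr // ltW.
exists (k *: y); split.
  split; last by exists k.
  split; first exact: D_cone.
  rewrite F2Z // /k exprVn s2 invfM -mulrA mulVf ?F2_neq0 // mulr1.
  by case: eps2 => ->; rewrite ?invr1 ?invrN1.
move=> p [[_ Fp] [m m0 pE]]; rewrite pE; congr (_ *: _).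
move: Fp; rewrite pE F2Z // => Fm.
apply: (mulIf (lt0r_neq0 s0)); rewrite /k mulVf ?lt0r_neq0 //.
apply/esym/eqP; rewrite -(@eqrXn2 _ 2) ?mulr_ge0 ?(ltW m0) ?(ltW s0) //.
by rewrite expr1n exprMn s2 mulrCA Fm -expr2 sqr_eps.
Qed.

Lemma ray_meets_U y p : D y -> ray_meets S y p ->
  exists2 k, 0 < k & [/\ p = k *: y, F2 (k *: y) = eps & D p].
Proof.
by move=> Dy [[Dp Fp] [k k0 pE]]; exists k => //; split=> //; rewrite -pE.
Qed.

Lemma cos_angle_meets y1 y2 p1 p2 : D y1 -> D y2 -> ray_meets S y1 p1 ->
  ray_meets S y2 p2 -> eps * ip (zeta p1) (zeta p2) = cos_angle y1 y2.
Proof.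
move=> D1 D2 /(ray_meets_U D1)[k1 k10 [-> F1 _]] /(ray_meets_U D2)[k2 k20 [-> F2' _]].
by apply: cos_angle_ray => //; exact: D_U.
Qed.

Lemma cos_angle_indicatrix p1 p2 : S p1 -> S p2 ->
  eps * ip (zeta p1) (zeta p2) = cos_angle p1 p2.
Proof.
by move=> [D1 F1] [D2 F2']; apply: cos_angle_meets => //; split=> //;
  exists 1; rewrite ?scale1r.
Qed.

Lemma zeta_norm p : S p -> ip (zeta p) (zeta p) = eps.
Proof. by move=> [Dp Fp]; rewrite bilin_zeta //; exact: D_U. Qed.

Lemma joining_motion p1 p2 c : geodesic_joining F2 S p1 p2 c -> free_motion c.
Proof.
move=> [_ _ Hc] t /Hc[[Dc Fc] d1 d2 geo]; split=> //; split=> //.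
exact: D_U.
Qed.

Lemma geodesic_joiningP p1 p2 c : geodesic_joining F2 S p1 p2 c ->
  exists K V, [/\ ip (zeta p1) V = 0, K = - eps * ip V V,
    forall t, 0 <= t <= 1 -> zeta (c t) = csK K t *: zeta p1 + snK K t *: V,
    csK K 1 = eps * ip (zeta p1) (zeta p2) &
    arc_length F2 c = Num.sqrt `|K| / h].
Proof.
move=> Gc; have Mc := joining_motion Gc; case: Gc => c0 c1 _.
have [K [V]] := geodesic_ode Mc; rewrite c0 => -[zV KE zE dsE].
exists K, V; split=> //; last exact: arc_length_constant.
by rewrite -c0 -c1; apply: (geodesic_endpoint Mc (V := V)); rewrite c0.
Qed.

(** The bound on [K] is a hypothesis because its source differs: the sign of the tangent metric in
    the time-like sector, the nonvanishing of [b] along the curve in the space-like one. *)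
Lemma geodesic_joining_unique p1 p2 c c' : 
  (forall c K V, geodesic_joining F2 S p1 p2 c -> ip (zeta p1) V = 0 ->
     K = - eps * ip V V ->
     (forall t, 0 <= t <= 1 -> zeta (c t) = csK K t *: zeta p1 + snK K t *: V) ->
     - pi ^+ 2 < K) ->
  geodesic_joining F2 S p1 p2 c -> geodesic_joining F2 S p1 p2 c' ->
  forall t, 0 <= t <= 1 -> c t = c' t.
Proof.
move=> K_gt G G'; have [K [V [zV KE zE _ _]]] := geodesic_joiningP G.
have [K' [V' [zV' KE' zE' _ _]]] := geodesic_joiningP G'.
have Kpi := K_gt _ _ _ G zV KE zE; have Kpi' := K_gt _ _ _ G' zV' KE' zE'.
have M := joining_motion G; have M' := joining_motion G'.
case: G G' => c0 c1 _ [c0' c1' _].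
apply: (geodesic_determined (K := K) (V := V) (K' := K') (V' := V')) => //.
- by rewrite c0 c0'.
- by rewrite c1 c1'.
- by rewrite c0.
- by rewrite c0'.
- by rewrite c0.
- by rewrite c0'.
Qed.

Lemma geodesic_joining_exists p1 p2 K : S p1 -> S p2 -> - pi ^+ 2 < K ->
  csK K 1 = eps * ip (zeta p1) (zeta p2) ->
  (forall t, 0 <= t <= 1 -> U (Zinv (arc p1 p2 K t)) /\ D (zeta_inv (arc p1 p2 K t))) ->
  exists c, geodesic_joining F2 S p1 p2 c.
Proof.
move=> S1 S2 Kpi KE arcD; exists (geodesic_arc p1 p2 K).
have [D1 F1] := S1; have [D2 F2'] := S2.
have U1 := D_U D1; have U2 := D_U D2.
have M : free_motion (geodesic_arc p1 p2 K).
  apply: geodesic_arc_motion => //; [exact: zeta_norm|exact: zeta_norm|].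
  by move=> t /arcD[].
split; [exact: geodesic_arc0|exact: geodesic_arc1|].
move=> t t01; have [[Uc Fc] d1 d2 geo] := M t t01.
by split=> //; split=> //; case: (arcD t t01).
Qed.

(** Spherical linear interpolation: both coefficients are nonnegative, so staying in the sector
    becomes a convexity question. *)
Lemma arcE p1 p2 K t : - pi ^+ 2 < K -> 0 <= t <= 1 ->
  arc p1 p2 K t = (snK K (1 - t) / snK K 1) *: zeta p1 + (snK K t / snK K 1) *: zeta p2.
Proof.
move=> Kpi t01; have S1 : snK K 1 != 0 by rewrite lt0r_neq0 // snK_gt0 // lexx ltr01.
rewrite /arc snK_sub //; apply/rowP => i.
move: (zeta p1) (zeta p2) => z1 z2; rewrite !mxE; field.
exact: S1.
Qed.

Lemma infinitesimal_angle c : (\forall t \near (0:R), S (c t)) -> derivable c 0 1 ->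
  exists K,
  [/\ bilin (gij F2 (c 0)) (derive1 c 0) (derive1 c 0) = - eps * K / h ^+ 2,
      ds F2 (c 0) (derive1 c 0) = Num.sqrt `|K| / h &
      2 * (cos_angle (c 0) (c t) - 1) / t ^+ 2 @[t --> 0^'] --> K].
Proof.
move=> nS /derivable_derive1 Dc.
have nU : \forall t \near (0:R), U (c t) /\ F2 (c t) = eps.
  by apply: filterS nS => t [Dt Ft]; split=> //; exact: D_U.
have [gE dsE lim] := second_order_angle Dc nU.
eexists; split; [exact: gE|exact: dsE|].
move: lim; apply: near_eq_cvg_to; near=> t.
rewrite cos_angle_indicatrix //; first exact: nbhs_singleton nS.
by near: t; exact: nbhs_dnbhs.
Unshelve. all: by end_near. Qed.

End Sector.
End Conformal.

(** * The future-time-like sector *)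

Section Lorentzian.
Context {R : realType}.

Lemma lorentzian_unit (N : nat) (a : 'M[R]_N) : lorentzian a -> a \in unitmx.
Proof.
move=> [_ [P Pu]] PaP.
have : P *m a *m P^T \in unitmx.
  rewrite PaP unitmxE det_diag unitfE; apply/prodf_neq0 => i _; rewrite mxE.
  by case: ifP => _; rewrite ?oppr_eq0 oner_eq0.
by rewrite !unitmx_mul => /andP[/andP[]].
Qed.

Lemma lorentz_form_orthogonal (n : nat) (x y : 'I_n.+1 -> R) :
  let s (x y : 'I_n.+1 -> R) := x ord0 * y ord0 - \sum_(i < n) x (lift ord0 i) * y (lift ord0 i) in
  0 < s x x -> s x y = 0 -> s y y <= 0.
Proof.
move=> s; rewrite /s; set sx := \sum_i _; set sxy := \sum_i _; set sy := \sum_i _.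
move=> xx /eqP; rewrite subr_eq0 => /eqP xy; rewrite leNgt; apply/negP => yy.
(* Since [sxy] is the product of the time components, this sum of squares equals
   [y0^2 sx + x0^2 sy - 2 x0^2 y0^2], which is negative when [sx < x0^2] and [sy < y0^2]. *)
have : 0 <= \sum_(i < n) (y ord0 * x (lift ord0 i) - x ord0 * y (lift ord0 i)) ^+ 2.
  by apply: sumr_ge0 => i _; exact: sqr_ge0.
have -> : \sum_(i < n) (y ord0 * x (lift ord0 i) - x ord0 * y (lift ord0 i)) ^+ 2 =
   y ord0 ^+ 2 * sx - 2 * x ord0 * y ord0 * sxy + x ord0 ^+ 2 * sy.
  rewrite !mulr_sumr -sumrB -big_split /=; apply: eq_bigr => i _; ring.
rewrite -xy; apply/negP; rewrite -ltNge.
have sx0 : 0 <= sx by apply: sumr_ge0 => i _; rewrite -expr2 sqr_ge0.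
have sy0 : 0 <= sy by apply: sumr_ge0 => i _; rewrite -expr2 sqr_ge0.
move: (x ord0) (y ord0) xx yy => x0 y0 xx yy.
have x2 : 0 < x0 ^+ 2 by nra.
have y2 : 0 < y0 ^+ 2 by nra.
have : x0 ^+ 2 * sy < x0 ^+ 2 * y0 ^+ 2 by rewrite ltr_pM2l //; nra.
have : y0 ^+ 2 * sx < y0 ^+ 2 * x0 ^+ 2 by rewrite ltr_pM2l //; nra.
nra.
Qed.

Lemma lorentzian_orthogonal (N : nat) (a : 'M[R]_N) (T u : 'rV[R]_N) :
  lorentzian a -> 0 < bilin a T T -> bilin a T u = 0 -> bilin a u u <= 0.
Proof.
move=> [_ [P Pu PaP]].
case: N => [|n] in a T u P Pu PaP *; first by rewrite /bilin !big_ord0 ltxx.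
have E (v w : 'rV_n.+1) : bilin a v w = (v *m invmx P) 0 ord0 * (w *m invmx P) 0 ord0
    - \sum_(i < n) (v *m invmx P) 0 (lift ord0 i) * (w *m invmx P) 0 (lift ord0 i).
  rewrite bilin_mulmx -{1}(mulmxKV Pu v) -{1}(mulmxKV Pu w) trmx_mul.
  rewrite !mulmxA -(mulmxA _ P a) -(mulmxA _ (P *m a)) PaP mxE big_ord_recl.
  rewrite mul_mx_diag !mxE /= mulr1; congr (_ + _).
  by rewrite -sumrN; apply: eq_bigr => i _; rewrite !mxE /=; ring.
rewrite !E; exact: (@lorentz_form_orthogonal n (fun i => (T *m invmx P) 0 i) (fun i => (u *m invmx P) 0 i)).
Qed.

Section Degenerate.
Context {N : nat}.
Variables (a : 'M[R]_N) (b : 'rV[R]_N).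
Implicit Types (u v w y : 'rV[R]_N).
Hypothesis ha : lorentzian a.
Hypothesis hb : conorm2 a b = -1.
Let aT : a^T = a. Proof. by case: ha. Qed.
Let a_unit : a \in unitmx. Proof. exact: lorentzian_unit. Qed.
Local Notation r := (rform a b).

(** The degenerate form [r] is [a] composed with the projection [P] along [beta] onto the kernel of
    [b], so the claim is inherited from [a]. *)
Lemma rform_orthogonal u v : 0 < r u u -> r u v = 0 -> r v v <= 0.
Proof.
pose P w := w + bform b w *: raise a b.
have bP w : bform b (P w) = 0 by rewrite bformD bformZ bform_raise //; ring.
have E w w' : r w w' = bilin a (P w) (P w').
  rewrite (bilinE a b) !bP mulr0 subr0 rformDl !rformDr rformZl !rformZr.
  by rewrite !(rform_raise, rform_raiser) //; ring.
by rewrite !E; exact: lorentzian_orthogonal.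
Qed.

Lemma rform_reverse_cauchy u v : 0 < r u u -> r u u * r v v <= r u v ^+ 2.
Proof.
move=> uu; have := @rform_orthogonal u (r u u *: v - r u v *: u) uu.
rewrite /rform !(bilinBr, bilinBl) !(bilinZr, bilinZl) -!/(rform a b _ _).
rewrite (rformC b aT v u) => /(_ _)H.
have {H} : r u u * (r u u * r v v - r u v ^+ 2) <= 0.
  by have := H ltac:(ring); rewrite [leLHS](_ : _ = r u u * (r u u * r v v - r u v ^+ 2)) //; ring.
by rewrite pmulr_rle0 // subr_le0.
Qed.

(** [r T v *: u - r T u *: v] is orthogonal to [T], hence of nonpositive square; all terms of that
    square would be nonnegative, two of them positive, if [r u v <= 0]. *)
Lemma rform_same_cone T u v : 0 < r T T -> 0 < r u u -> 0 < r v v ->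
  0 < r T u -> 0 < r T v -> 0 < r u v.
Proof.
move=> TT uu vv Tu Tv; have := @rform_orthogonal T (r T v *: u - r T u *: v) TT.
rewrite /rform !(bilinBr, bilinBl) !(bilinZr, bilinZl) -!/(rform a b _ _).
rewrite (rformC b aT v u) => H; have {H} := H ltac:(ring).
move=> H; rewrite ltNge; apply/negP => uv; have : 0 < r T v * (r T v * r u u).
  by rewrite !mulr_gt0.
have : 0 < r T u * (r T u * r v v) by rewrite !mulr_gt0.
have : r T v * (r T u * r u v) <= 0 by rewrite !pmulr_rle0.
lra.
Qed.

End Degenerate.
End Lorentzian.

Section TimeSector.
Context {R : realType} {N : nat}.
Variables (a : 'M[R]_N) (b T : 'rV[R]_N) (g : R).
Implicit Types (u v w y : 'rV[R]_N) (t s : R) (c : R -> 'rV[R]_N).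
Hypothesis ha : lorentzian a.
Hypothesis hb : conorm2 a b = -1.
Hypothesis hT : 0 < bilin a T T.
Let aT : a^T = a. Proof. by case: ha. Qed.
Let a_unit : a \in unitmx. Proof. exact: lorentzian_unit. Qed.
Let eps2 : (1 : R) = 1 \/ (1 : R) = -1. Proof. by left. Qed.
Local Notation r := (rform a b).
Local Notation bf := (bform b).
Local Notation q := (qf a b).
Local Notation B := (Bf a b g).
Local Notation A := (Af a b g).
Local Notation h := (h_time g).
Local Notation J := (J_time a b g).
Let D := time_sector a b g T.
(** The domain of the calculus, given by strict inequalities between functions of [b] and [q]; the
    time orientation enters only with [D]. *)
Let U : set 'rV[R]_N := [set y | 0 < gam a b y /\ 0 < B y].

Let h_gt0 : 0 < h.
Proof. by rewrite sqrtr_gt0; have := sqr_ge0 g; lra. Qed.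

Let h2 : h ^+ 2 = 1 + 1 * g ^+ 2 / 4.
Proof. by rewrite sqr_sqrtr; have := sqr_ge0 g; lra. Qed.

Let q_gt0 y : 0 < gam a b y -> 0 < q y.
Proof. by move=> y0; apply: (qf_gt0 eps2); rewrite mul1r. Qed.

Lemma gplus_gminus : [/\ 0 < gplus g h, gminus g h < 0 & gplus g h * gminus g h = -1].
Proof.
have e : gplus g h * gminus g h = -1.
  rewrite /gplus /gminus; transitivity (g ^+ 2 / 4 - h ^+ 2); first by field.
  by rewrite h2; field.
move: (h_gt0) e; rewrite /gplus /gminus => h0 e; split=> //; nra.
Qed.

Lemma time_Bf_factor y : 0 < gam a b y ->
  B y = (bf y - gminus g h * q y) * (gplus g h * q y - bf y).
Proof.
move=> y0; rewrite (BfE_sign g eps2) ?mul1r //.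
have [_ _ e] := gplus_gminus.
transitivity (- (gplus g h * gminus g h) * q y ^+ 2 + (gplus g h + gminus g h) * bf y * q y - bf y ^+ 2).
  by rewrite e /gplus /gminus; field.
ring.
Qed.

(** The factors of [B] have a positive product and the positive sum [2 h q]. *)
Lemma time_factors_gt0 y : U y ->
  0 < bf y - gminus g h * q y /\ 0 < gplus g h * q y - bf y.
Proof.
move=> [y0 B0]; have q0 := q_gt0 y0; move: B0; rewrite time_Bf_factor //.
have : 0 < (bf y - gminus g h * q y) + (gplus g h * q y - bf y).
  rewrite [ltRHS](_ : _ = 2 * h * q y); last by rewrite /gplus /gminus; field.
  by rewrite !mulr_gt0.
move: (bf y - _) (_ - bf y) => k m; case: (ltP 0 k) => k0 km; first by rewrite pmulr_rgt0.
by rewrite pmulr_lgt0 ?ltNge ?k0 //; lra.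
Qed.

(** Each case bounds one factor of [B]: multiplying [q > - g_- b] by [g_+] and using [g_+ g_- = -1]
    gives [g_+ q > b], while the other factor is positive by the sign of [b]. The second case is
    symmetric. *)
Lemma time_sectorE y : D y <-> U y /\ 0 < r T y.
Proof.
have [gp gm e] := gplus_gminus.
split=> [[y0 Ty cond]|[[y0 B0] Ty]].
  split=> //; split=> //; have q0 := q_gt0 y0; rewrite time_Bf_factor //.
  have gmq : gminus g h * q y < 0 by rewrite pmulr_llt0.
  have gpq : 0 < gplus g h * q y by rewrite mulr_gt0.
  case: cond => -[b0 bq].
    rewrite mulr_gt0 //; first by lra.
    have : gplus g h * (- gminus g h * bf y) < gplus g h * q y by rewrite ltr_pM2l.
    rewrite [X in X < _ -> _](_ : _ = - (gplus g h * gminus g h) * bf y); last by ring.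
    by rewrite e opprK mul1r subr_gt0.
  rewrite mulr_gt0 //; last by lra.
  have : gminus g h * q y < gminus g h * (- gplus g h * bf y) by rewrite ltr_nM2l.
  rewrite [X in _ < X -> _](_ : _ = - (gplus g h * gminus g h) * bf y); last by ring.
  by rewrite e opprK mul1r subr_gt0.
have [f1 f2] := time_factors_gt0 (conj y0 B0).
split=> //; have q0 := q_gt0 y0; case: (leP 0 (bf y)) => b0; [left|right].
  split=> //; have : gminus g h * (gplus g h * q y) < gminus g h * bf y.
    by rewrite ltr_nM2l // -subr_gt0.
  rewrite mulrA (mulrC (gminus g h)) e; lra.
split; first exact: ltW.
have : gplus g h * (gminus g h * q y) < gplus g h * bf y.
  by rewrite ltr_pM2l // -subr_gt0.
rewrite mulrA e; lra.
Qed.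

Let D_U y : D y -> U y.
Proof. by move=> /time_sectorE[]. Qed.

Let U_cone k y : 0 < k -> U y -> U (k *: y).
Proof.
move=> k0 [y0 B0]; split; rewrite ?gamZ ?BfZ ?ltW // mulr_gt0 // exprn_gt0 //.
Qed.

Let D_cone k y : 0 < k -> D y -> D (k *: y).
Proof.
move=> k0 /time_sectorE[Uy Ty]; apply/time_sectorE.
by split; [exact: U_cone|rewrite rformZr mulr_gt0].
Qed.

Let U_sign y : U y -> [/\ 0 < 1 * gam a b y, 0 < 1 * B y & 0 < J y].
Proof.
move=> Uy; have [f1 f2] := time_factors_gt0 Uy; case: Uy => y0 B0.
by rewrite !mul1r; split=> //; rewrite powR_gt0 // divr_gt0.
Qed.

Let J_homogeneous k y : 0 < k -> U y -> J (k *: y) = J y.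
Proof.
move=> k0 Uy; have [f1 f2] := time_factors_gt0 Uy.
rewrite /J_time bformZ qfZ ?ltW //; congr powR.
have -> : k * bf y - gminus g h * (k * q y) = k * (bf y - gminus g h * q y) by ring.
have -> : gplus g h * (k * q y) - k * bf y = k * (gplus g h * q y - bf y) by ring.
by field; rewrite !lt0r_neq0.
Qed.

Let U_open c t x : is_derive t (1:R) c x -> U (c t) -> \forall s \near t, U (c s).
Proof.
move=> Dc [y0 B0].
have y1 : 0 < 1 * gam a b (c t) by rewrite mul1r.
have Db := is_derive1_bform b Dc; have Dr := is_derive1_bilin (rmx a b) Dc Dc.
have Dq := is_derive_qf_sign aT eps2 Dc y1.
have DB := is_derive1B (is_derive1B Dr (is_derive1M (is_derive1Ml g Db) Dq))
  (is_derive1M Db Db).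
near=> s; split; near: s.
  exact: cvgr_gt (is_derive1_continuous Dr) _ y0.
exact: cvgr_gt (is_derive1_continuous DB) _ B0.
Unshelve. all: by end_near. Qed.

Let J_derive c t x : is_derive t (1:R) c x -> U (c t) ->
  is_derive t (1:R) (fun s => J (c s)) (J (c t) * dlogJ a b g 1 (c t) x).
Proof.
move=> Dc Uc; have [f1 f2] := time_factors_gt0 Uc; have [y0 B0] := Uc.
have y1 : 0 < 1 * gam a b (c t) by rewrite mul1r.
have Db := is_derive1_bform b Dc; have Dq := is_derive_qf_sign aT eps2 Dc y1.
have n2 : gplus g h * q (c t) - bf (c t) != 0 by rewrite lt0r_neq0.
have n1 : bf (c t) - gminus g h * q (c t) != 0 by rewrite lt0r_neq0.
have Drat := is_derive1M (is_derive1B Db (is_derive1Ml (gminus g h) Dq))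
  (is_derive1V (f := fun s => gplus g h * q (c s) - bf (c s)) n2
     (is_derive1B (is_derive1Ml (gplus g h) Dq) Db)).
have rat0 : 0 < (bf (c t) - gminus g h * q (c t)) / (gplus g h * q (c t) - bf (c t)).
  by rewrite divr_gt0.
have DJ := is_derive1_chain (p := fun s =>
  (bf (c s) - gminus g h * q (c s)) / (gplus g h * q (c s) - bf (c s)))
  (is_derive1_powR (- (g / h / 4)) rat0) Drat.
apply: is_derive_eq DJ _.
(* The power with exponent lowered by 1 becomes [J] divided by the ratio, leaving a rational
   identity. *)
rewrite powRB ?(gt_eqF rat0) ?implybT // powRr1 ?ltW // -/(J_time a b g (c t)).
rewrite /dlogJ time_Bf_factor //.
have h0 := lt0r_neq0 h_gt0; have q0 := lt0r_neq0 (q_gt0 y0).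
rewrite /gplus /gminus in n1 n2 *.
field; rewrite h0 q0 !andbT; apply/andP; split.
  rewrite [X in X != 0](_ : _ = 2 * ((- (g / 2) + h) * q (c t) - bf (c t))); last by field.
  by rewrite mulf_neq0.
rewrite [X in X != 0](_ : _ = 2 * (bf (c t) - (- (g / 2) - h) * q (c t))); last by field.
by rewrite mulf_neq0.
Qed.

Local Notation ip := (bilin a).
Local Notation ze := (zeta a b g h J).
Local Notation F2 := (F2_time a b g).
Let S := indicatrix F2 D 1.

Lemma cos_angle_time y1 y2 : cos_angle a b g 1 h y1 y2 = cosh_angle_time a b g y1 y2.
Proof. by rewrite /cos_angle bilin_Zvec2 // mul1r. Qed.

Let T_gt0 : 0 < r T T.
Proof. by rewrite rformE -expr2 ltr_wpDr ?sqr_ge0. Qed.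

(** Two reversed Cauchy inequalities: [q y1 * q y2 <= r y1 y2] for [r] on one cone, and then the one
    of the plane with coordinates [(h q, A)], where [B = (h q)^2 - A^2]. *)
Lemma cosh_angle_time_ge1 y1 y2 : D y1 -> D y2 -> 1 <= cosh_angle_time a b g y1 y2.
Proof.
move=> /time_sectorE[U1 T1] /time_sectorE[U2 T2].
have [[g1 B1] [g2 B2]] := (U1, U2).
have r12 : 0 < r y1 y2 by apply: (rform_same_cone ha hb T_gt0).
have cs := rform_reverse_cauchy ha hb y2 g1.
have q1 := q_gt0 g1; have q2 := q_gt0 g2.
have s1 : q y1 ^+ 2 = r y1 y1 by rewrite (sqr_qf eps2) ?mul1r.
have s2 : q y2 ^+ 2 = r y2 y2 by rewrite (sqr_qf eps2) ?mul1r.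
have qr : q y1 * q y2 <= r y1 y2.
  have qq : 0 <= q y1 * q y2 by rewrite mulr_ge0 ?ltW.
  have := cs; rewrite -s1 -s2 -exprMn ler_sqr ?nnegrE //; exact: ltW.
have BE y : 0 < gam a b y -> B y = (h * q y) ^+ 2 - A y ^+ 2.
  by move=> y0; rewrite time_Bf_factor // /gplus /gminus /Af; field.
rewrite /cosh_angle_time ler_pdivlMr ?mul1r; last by rewrite mulr_gt0 // sqrtr_gt0 normr_gt0 gt_eqF.
rewrite (gtr0_norm B1) (gtr0_norm B2) -sqrtrM ?(ltW B1) //.
have hq1 : 0 < h * q y1 by rewrite mulr_gt0.
have hq2 : 0 < h * q y2 by rewrite mulr_gt0.
have Aq y : U y -> - (h * q y) < A y < h * q y.
  by move=> /time_factors_gt0; rewrite /gplus /gminus /Af => -[? ?]; apply/andP; split; lra.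
have /andP[a1 a1'] := Aq _ U1; have /andP[a2 a2'] := Aq _ U2.
apply: (@le_trans _ _ ((h * q y1) * (h * q y2) - A y1 * A y2)).
  have p : 0 <= (h * q y1) * (h * q y2) - A y1 * A y2 by nra.
  rewrite -[leRHS](ger0_norm p) -sqrtr_sqr ler_wsqrtr // !BE // -subr_ge0.
  rewrite [leRHS](_ : _ = (h * q y1 * A y2 - h * q y2 * A y1) ^+ 2); last by ring.
  exact: sqr_ge0.
rewrite lerB // [leLHS](_ : _ = h ^+ 2 * (q y1 * q y2)); last by ring.
by rewrite ler_pM2l // exprn_gt0.
Qed.

(** A vector orthogonal to a time-like one has nonpositive square, so the trigonometric branch of
    [csK] does not occur here. *)
Let K_ge0 p1 V : S p1 -> ip (ze p1) V = 0 -> 0 <= - 1 * ip V V.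
Proof.
move=> Sp zV; rewrite mulN1r oppr_ge0; apply: lorentzian_orthogonal zV => //.
by rewrite (zeta_norm aT a_unit hb eps2 h2 U_sign D_U Sp).
Qed.

Let pi2 (K : R) : 0 <= K -> - pi ^+ 2 < K.
Proof. by move=> K0; rewrite (lt_le_trans _ K0) // oppr_lt0 exprn_gt0 // pi_gt0. Qed.

(** The arc stays in the sector: on the pseudo-sphere [r z z = 1 + b^2 > 0], and [B] equals 1 at
    [Zinv z]. Moreover [r T z] keeps its sign, since a vector [r]-orthogonal to [T] has nonpositive
    [r]-square. *)
Lemma time_joining_exists p1 p2 : S p1 -> S p2 ->
  1 <= 1 * ip (ze p1) (ze p2) -> exists c, geodesic_joining F2 S p1 p2 c.
Proof.
move=> S1 S2; set x := 1 * _ => x1; have [a0 ax] := arccosh_def x1.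
have [[D1 F1] [D2 F2']] := (S1, S2).
have K0 : 0 <= arccosh x ^+ 2 by exact: sqr_ge0.
have Kcs : csK (arccosh x ^+ 2) 1 = x.
  by rewrite /csK ltNge K0 /= mulr1 sqrtr_sqr ger0_norm.
have z1 := zeta_norm aT a_unit hb eps2 h2 U_sign D_U S1.
have z2 := zeta_norm aT a_unit hb eps2 h2 U_sign D_U S2.
pose z t := arc a b g h J p1 p2 (arccosh x ^+ 2) t.
have zz t : ip (z t) (z t) = 1 := arc_norm aT eps2 (pi2 K0) z1 z2 Kcs t.
have rz t : 0 < r (z t) (z t).
  by rewrite rformE zz -expr2 ltr_wpDr ?sqr_ge0.
have h0 := lt0r_neq0 h_gt0.
have Uz t : U (Zinv a b g h (z t)).
  have y0 : 0 < gam a b (Zinv a b g h (z t)).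
    by rewrite /gam rform_Zinv // (rformC b aT) rform_Zinv // !divr_gt0.
  split=> //; rewrite -(bilin_Zvec_sign aT a_unit hb eps2 h2) ?mul1r //.
  by rewrite ZinvK // zz.
have Tz t : 0 <= t <= 1 -> 0 < r T (z t).
  apply: (nonvanishing_gt0 (f := fun t => r T (z t))).
  - move=> s _; have := is_derive1_bilin (rmx a b) (is_derive1_cst T s)
      (is_derive_arc a b g h J p1 p2 (arccosh x ^+ 2) s).
    by case.
  - move=> s _; apply/eqP => Tz; have := rform_orthogonal ha hb T_gt0 Tz.
    by rewrite leNgt rz.
  - rewrite /z arc0 rformZr rform_Zvecr //.
    have /time_sectorE[U1 T1] := D1; have [_ _ J1] := U_sign U1.
    by rewrite !mulr_gt0.
apply: (geodesic_joining_exists aT a_unit hb eps2 h_gt0 h2 U_sign U_open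
  J_derive J_homogeneous U_cone D_U S1 S2 (pi2 K0) Kcs) => t t01.
split; first exact: Uz.
apply: D_cone; first by have [_ _ ?] := U_sign (Uz t); rewrite invr_gt0.
apply/time_sectorE; split; first exact: Uz.
by rewrite (rformC b aT) rform_Zinv // divr_gt0 // (rformC b aT) Tz.
Qed.

Theorem time_like_angle :
  [/\ forall y, D y -> exists! p, ray_meets S y p,
      forall y1 y2, D y1 -> D y2 -> 1 <= cosh_angle_time a b g y1 y2,
      forall y1 y2 p1 p2, D y1 -> D y2 -> ray_meets S y1 p1 -> ray_meets S y2 p2 ->
         [/\ exists c, geodesic_joining F2 S p1 p2 c,
             forall c c', geodesic_joining F2 S p1 p2 c ->
               geodesic_joining F2 S p1 p2 c' ->
               forall t, 0 <= t <= 1 -> c t = c' t &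
             forall c, geodesic_joining F2 S p1 p2 c ->
               arc_length F2 c = angle_time a b g y1 y2] &
      forall c : R -> 'rV[R]_N, (\forall t \near 0, S (c t)) ->
         derivable c 0 1 ->
         (fun t : R => angle_time a b g (c 0) (c t) / `|t|) @ 0^'
           --> ds F2 (c 0) (derive1 c 0)].
Proof.
split; [exact: (ray_meets_unique eps2 U_sign J_homogeneous D_U D_cone)
  |exact: cosh_angle_time_ge1| |].
- move=> y1 y2 p1 p2 D1 D2 m1 m2.
  have [S1 _] := m1; have [S2 _] := m2.
  have x1 := cosh_angle_time_ge1 D1 D2.
  have xE : 1 * ip (ze p1) (ze p2) = cosh_angle_time a b g y1 y2.
    by rewrite -cos_angle_time (cos_angle_meets h eps2 U_sign J_homogeneous D_U D1 D2 m1 m2).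
  split.
  + by apply: time_joining_exists => //; rewrite xE.
  + move=> c c'; apply: (geodesic_joining_unique aT a_unit hb eps2 h_gt0 h2 U_sign U_open
      J_derive J_homogeneous D_U) => {}c K V _ zV KE _.
    by apply: pi2; rewrite KE; exact: K_ge0 zV.
  + move=> c /(geodesic_joiningP aT a_unit hb eps2 h_gt0 h2 U_sign U_open J_derive D_U).
    move=> [K [V [zV KE _ Kcs ->]]].
    have K0 : 0 <= K by rewrite KE; exact: K_ge0 zV.
    rewrite /angle_time mulrC -xE -Kcs /csK ltNge K0 /= mulr1 coshK ?sqrtr_ge0 //.
    by rewrite ger0_norm.
- move=> c nS dc.
  have [K [_ -> lim]] := infinitesimal_angle aT a_unit hb eps2 h_gt0 h2 U_sign U_open
    J_derive J_homogeneous D_U nS dc.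
  have x1 : \forall t \near 0^', 1 <= cosh_angle_time a b g (c 0) (c t).
    near=> t; apply: cosh_angle_time_ge1; first by case: (nbhs_singleton nS).
    by have [] : S (c t) by near: t; exact: nbhs_dnbhs.
  have lim' : 2 * (cosh_angle_time a b g (c 0) (c t) - 1) / t ^+ 2 @[t --> 0^'] --> K.
    by move: lim; apply: near_eq_cvg_to; near=> t; rewrite cos_angle_time.
  have := arccosh_cvg x1 lim' => L.
  have : arccosh (cosh_angle_time a b g (c 0) (c t)) / `|t| * h^-1 @[t --> 0^']
      --> Num.sqrt `|K| * h^-1 by apply: cvgM => //; exact: cvg_cst.
  by apply: near_eq_cvg_to; near=> t; rewrite /angle_time; ring.
Unshelve. all: by end_near. Qed.

End TimeSector.

(* The part of the sector is convex in [zeta]-coordinates along the arcs of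
   length less than [pi]. *)
Lemma sector_convex {R : realType} (H k m a1 a2 q1 q2 r12 x1 x2 : R) :
  0 < H -> 0 < k -> 0 < m -> 0 < q1 -> 0 < q2 ->
  m * (q1 / H) < k * a1 -> m * (q2 / H) < k * a2 ->
  a1 ^+ 2 + q1 ^+ 2 = 1 -> a2 ^+ 2 + q2 ^+ 2 = 1 ->
  a1 * a2 - r12 <= 1 -> r12 < q1 * q2 -> 0 <= x1 -> 0 <= x2 -> 0 < x1 + x2 ->
  let Gam := x1 ^+ 2 * q1 ^+ 2 + x2 ^+ 2 * q2 ^+ 2 - 2 * x1 * x2 * r12 in
  0 < Gam /\ m ^+ 2 * Gam < (H * (k * (x1 * a1 + x2 * a2))) ^+ 2.
Proof.
move=> H0 k0 m0 q10 q20 s1 s2 n1 n2 x12 rq x10 x20 xx Gam.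
have t1 : m * q1 < H * k * a1.
  by move: s1; rewrite mulrA ltr_pdivrMr //; lra.
have t2 : m * q2 < H * k * a2.
  by move: s2; rewrite mulrA ltr_pdivrMr //; lra.
have mq1 : 0 < m * q1 by rewrite mulr_gt0.
have mq2 : 0 < m * q2 by rewrite mulr_gt0.
have Hk : 0 < H * k by rewrite mulr_gt0.
have a10 : 0 < a1 by rewrite -(pmulr_rgt0 _ Hk); lra.
have a20 : 0 < a2 by rewrite -(pmulr_rgt0 _ Hk); lra.
have u1 : (m * q1) ^+ 2 < (H * k * a1) ^+ 2 by rewrite ltrXn2r ?nnegrE //; lra.
have u2 : (m * q2) ^+ 2 < (H * k * a2) ^+ 2 by rewrite ltrXn2r ?nnegrE //; lra.
set L := (H * k) ^+ 2; have L0 : 0 < L by rewrite exprn_gt0.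
have m20 : 0 < m ^+ 2 by rewrite exprn_gt0.
(* Eliminating [q1] by [a1^2 + q1^2 = 1] puts the bound into a form that can be multiplied with its
   analogue for [a2]. *)
have v1 : m ^+ 2 < (L + m ^+ 2) * a1 ^+ 2.
  move: u1; rewrite !exprMn -/L; have -> : q1 ^+ 2 = 1 - a1 ^+ 2 by lra.
  by rewrite /L exprMn; lra.
have v2 : m ^+ 2 < (L + m ^+ 2) * a2 ^+ 2.
  move: u2; rewrite !exprMn -/L; have -> : q2 ^+ 2 = 1 - a2 ^+ 2 by lra.
  by rewrite /L exprMn; lra.
have w : m ^+ 2 < (L + m ^+ 2) * (a1 * a2).
  have p : 0 <= (L + m ^+ 2) * (a1 * a2) by rewrite !mulr_ge0 ?addr_ge0 ?ltW.
  rewrite -ltr_sqr ?nnegrE ?(ltW m20) ?p //.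
  rewrite [ltRHS](_ : _ = ((L + m ^+ 2) * a1 ^+ 2) * ((L + m ^+ 2) * a2 ^+ 2)); last by ring.
  by rewrite [ltLHS]expr2 ltr_pM // ltW.
have xp : 0 < x1 \/ 0 < x2 by case: (ltP 0 x1) => x1p; [left|right]; lra.
split.
  (* The hypothesis [r12 < q1 * q2] makes the cross term positive when both coefficients are. *)
  have -> : Gam = (x1 * q1 - x2 * q2) ^+ 2 + 2 * (x1 * x2) * (q1 * q2 - r12).
    by rewrite /Gam; ring.
  have [x1p|x1n] := ltP 0 x1; have [x2p|x2n] := ltP 0 x2.
  - rewrite ltr_wpDl ?sqr_ge0 // mulr_gt0 ?subr_gt0 // !mulr_gt0 //.
  - have -> : x2 = 0 by apply/eqP; rewrite eq_le x2n.
    by rewrite mul0r !mulr0 mul0r addr0 subr0 exprn_gt0 // mulr_gt0.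
  - have -> : x1 = 0 by apply/eqP; rewrite eq_le x1n.
    by rewrite !mul0r mulr0 mul0r addr0 sub0r sqrrN exprn_gt0 // mulr_gt0.
  - by exfalso; lra.
rewrite -subr_gt0.
rewrite [ltRHS](_ : _ = x1 ^+ 2 * ((H * k * a1) ^+ 2 - (m * q1) ^+ 2)
  + x2 ^+ 2 * ((H * k * a2) ^+ 2 - (m * q2) ^+ 2)
  + 2 * (x1 * x2) * (L * (a1 * a2) + m ^+ 2 * r12)); last by rewrite /Gam /L; ring.
(* By [r12 >= a1 a2 - 1] the last factor is at least [(L + m^2) a1 a2 - m^2], which is positive by
   [w]. *)
have e3 : 0 <= 2 * (x1 * x2) * (L * (a1 * a2) + m ^+ 2 * r12).
  have mr : m ^+ 2 * (a1 * a2 - 1) <= m ^+ 2 * r12 by rewrite ler_pM2l //; lra.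
  by rewrite !mulr_ge0 //; lra.
have e1 : 0 <= x1 ^+ 2 * ((H * k * a1) ^+ 2 - (m * q1) ^+ 2).
  by rewrite mulr_ge0 ?sqr_ge0 // subr_ge0 ltW.
have e2 : 0 <= x2 ^+ 2 * ((H * k * a2) ^+ 2 - (m * q2) ^+ 2).
  by rewrite mulr_ge0 ?sqr_ge0 // subr_ge0 ltW.
case: xp => xp.
  have : 0 < x1 ^+ 2 * ((H * k * a1) ^+ 2 - (m * q1) ^+ 2).
    by rewrite mulr_gt0 ?exprn_gt0 // subr_gt0.
  lra.
have : 0 < x2 ^+ 2 * ((H * k * a2) ^+ 2 - (m * q2) ^+ 2).
  by rewrite mulr_gt0 ?exprn_gt0 // subr_gt0.
lra.
Qed.

(** * The space-like sector *)

Section SpaceSector.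
Context {R : realType} {N : nat}.
Variables (a : 'M[R]_N) (b : 'rV[R]_N) (g : R).
Implicit Types (u v w y : 'rV[R]_N) (t s K k : R) (c : R -> 'rV[R]_N).
Hypothesis ha : lorentzian a.
Hypothesis hb : conorm2 a b = -1.
Hypothesis hg : -2 < g < 2.
Let aT : a^T = a. Proof. by case: ha. Qed.
Let a_unit : a \in unitmx. Proof. exact: lorentzian_unit. Qed.
Let eps2 : (-1 : R) = 1 \/ (-1 : R) = -1. Proof. by right. Qed.
Local Notation r := (rform a b).
Local Notation bf := (bform b).
Local Notation q := (qf a b).
Local Notation B := (Bf a b g).
Local Notation A := (Af a b g).
Local Notation h := (h_space g).
Local Notation J := (J_space a b g).
Local Notation Z := (Zvec a b g h).
Let D := space_sector a b g.
(** [J_space] divides by [b] and changes branch with its sign; on [U] it is smooth on either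
    side. *)
Let U : set 'rV[R]_N := [set y | gam a b y < 0 /\ bf y != 0].

Let g2 : 0 < 1 - g ^+ 2 / 4.
Proof.
have /andP[g1 g2'] := hg; have : 0 < (2 - g) * (2 + g) by rewrite mulr_gt0 //; lra.
nra.
Qed.

Let h_gt0 : 0 < h.
Proof. by rewrite sqrtr_gt0. Qed.

Let h2 : h ^+ 2 = 1 + -1 * g ^+ 2 / 4.
Proof. by rewrite sqr_sqrtr ?ltW //; ring. Qed.

Let gam_sign y : gam a b y < 0 -> 0 < -1 * gam a b y.
Proof. by rewrite mulN1r oppr_gt0. Qed.

Let q_gt0 y : gam a b y < 0 -> 0 < q y.
Proof. by move=> /gam_sign/(qf_gt0 eps2). Qed.

Let q_sqr y : gam a b y < 0 -> q y ^+ 2 = - gam a b y.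
Proof. by move=> /gam_sign/(sqr_qf eps2); rewrite mulN1r. Qed.

Lemma space_BfE y : gam a b y < 0 -> B y = - ((h * q y) ^+ 2 + A y ^+ 2).
Proof.
move=> y0; rewrite (BfE_sign g eps2 (gam_sign y0)) exprMn h2 /Af.
by field.
Qed.

Lemma space_Bf_lt0 y : gam a b y < 0 -> B y < 0.
Proof.
move=> y0; rewrite space_BfE // oppr_lt0 ltr_pwDl ?sqr_ge0 //.
by rewrite exprn_gt0 // mulr_gt0 // q_gt0.
Qed.

(** At [b = 0] both bounds would read [q < 0]. So [b] has a sign [sg], and the factors [- g_-] and
    [- g_+] become [h + sg * g / 2] against [sg * b]. *)
Lemma space_sectorE y : D y <-> gam a b y < 0 /\ exists sg,
  [/\ sg = 1 \/ sg = -1, 0 < sg * bf y & q y < (h + sg * g / 2) * (sg * bf y)].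
Proof.
split=> [[y0 cond]|[y0 [sg [sgE sb bq]]]]; split=> //; have q0 := q_gt0 y0.
  case: cond => -[b0 bq]; [exists 1|exists (-1)].
    split; first by left.
      rewrite mul1r lt_neqAle b0 andbT; apply/eqP => b0'.
      by move: bq; rewrite -b0' mulr0; lra.
    by move: bq; rewrite /gminus; lra.
  split; first by right.
    rewrite mulN1r oppr_gt0 lt_neqAle b0 andbT; apply/eqP => b0'.
    by move: bq; rewrite b0' mulr0; lra.
  by move: bq; rewrite /gplus; lra.
case: sgE sb bq => ->; rewrite ?mul1r ?mulN1r => b0 bq; [left|right].
  by split; [exact: ltW|rewrite /gminus; lra].
by split; [rewrite -oppr_ge0; exact: ltW|rewrite /gplus; lra].
Qed.

Let D_U y : D y -> U y.
Proof.
move=> /space_sectorE[y0 [sg [_ sb _]]]; split=> //.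
by apply/eqP => b0; move: sb; rewrite b0 mulr0 ltxx.
Qed.

Let U_cone k y : 0 < k -> U y -> U (k *: y).
Proof.
move=> k0 [y0 b0]; split; first by rewrite gamZ pmulr_rlt0 // exprn_gt0.
by rewrite bformZ mulf_neq0 // lt0r_neq0.
Qed.

Let D_cone k y : 0 < k -> D y -> D (k *: y).
Proof.
move=> k0 /space_sectorE[y0 [sg [sgE sb bq]]]; apply/space_sectorE.
split; first by rewrite gamZ pmulr_rlt0 // exprn_gt0.
exists sg; rewrite bformZ qfZ ?(ltW k0) //; split=> //.
  by rewrite mulrCA mulr_gt0.
by rewrite [ltRHS](_ : _ = k * ((h + sg * g / 2) * (sg * bf y))) ?ltr_pM2l //; ring.
Qed.

Let U_sign y : U y -> [/\ 0 < -1 * gam a b y, 0 < -1 * B y & 0 < J y].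
Proof.
move=> [y0 _]; split; [exact: gam_sign| |exact: expR_gt0].
by rewrite mulN1r oppr_gt0 space_Bf_lt0.
Qed.

Let J_homogeneous k y : 0 < k -> U y -> J (k *: y) = J y.
Proof.
move=> k0 [y0 b0]; rewrite /J_space /f_space /= bformZ qfZ ?(ltW k0) // (pmulr_rle0 _ k0).
have -> : (k * q y + g / 2 * (k * bf y)) / (h * (k * bf y)) =
    (q y + g / 2 * bf y) / (h * bf y).
  by field; rewrite b0 !lt0r_neq0.
by [].
Qed.

Let U_open c t x : is_derive t (1:R) c x -> U (c t) -> \forall s \near t, U (c s).
Proof.
move=> Dc [y0 b0].
have Db := is_derive1_bform b Dc; have Dr := is_derive1_bilin (rmx a b) Dc Dc.
near=> s; split; near: s.
  exact: cvgr_lt (is_derive1_continuous Dr) _ y0.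
exact: cvgr_neq0 (is_derive1_continuous Db) b0.
Unshelve. all: by end_near. Qed.

Let J_derive c t x : is_derive t (1:R) c x -> U (c t) ->
  is_derive t (1:R) (fun s => J (c s)) (J (c t) * dlogJ a b g (-1) (c t) x).
Proof.
move=> Dc Uc; have [y0 b0] := Uc.
have Db := is_derive1_bform b Dc.
have Dq := is_derive_qf_sign aT eps2 Dc (gam_sign y0).
have h0 := lt0r_neq0 h_gt0; have q0 := lt0r_neq0 (q_gt0 y0).
have hb0 : h * bf (c t) != 0 by rewrite mulf_neq0.
pose rat s := (q (c s) + g / 2 * bf (c s)) / (h * bf (c s)).
have Drat := is_derive1M (is_derive1D Dq (is_derive1Ml (g / 2) Db))
  (is_derive1V (f := fun s => h * bf (c s)) hb0 (is_derive1Ml h Db)).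
have Datan := is_derive1_chain (p := rat) (is_derive1_atan (rat t)) Drat.
(* The constant of the branch does not change near [t], as [b] does not vanish there. *)
pose C := if bf (c t) <= 0 then - atan (g / h / 2) else - pi - atan (g / h / 2).
have Df := is_derive1D (is_derive1_cst C t) Datan.
have DJ := is_derive1_chain
  (p := fun s => - (1 / 2) * (g / h) * (C + atan (rat s)))
  (is_derive_expR _) (is_derive1Ml (- (1 / 2) * (g / h)) Df).
have JE s : (bf (c s) <= 0) = (bf (c t) <= 0) ->
    expR (- (1 / 2) * (g / h) * (C + atan (rat s))) = J (c s).
  by move=> bE; rewrite /J_space /f_space bE /C; case: ifP.
apply: is_derive_eq (near_eq_is_derive _ DJ) _.
  have [bt|bt] := leP (bf (c t)) 0.
    have bt' : bf (c t) < 0 by rewrite lt_neqAle b0.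
    have nb : \forall s \near t, bf (c s) < 0.
      exact: cvgr_lt (is_derive1_continuous Db) _ bt'.
    apply: filterS nb => s bs.
    by apply: JE; rewrite (ltW bs) bt.
  have nb : \forall s \near t, 0 < bf (c s).
    exact: cvgr_gt (is_derive1_continuous Db) _ bt.
  apply: filterS nb => s bs.
  by apply: JE; rewrite leNgt bs leNgt bt.
rewrite JE //; congr (_ * _).
rewrite /dlogJ space_BfE // /Af /rat.
(* [q^2 + g b q + b^2] is symmetric in [b] and [q], so the square can be completed in either
   variable: [space_BfE] uses one way, the derivative of [atan] the other. *)
have e1 : (h * q (c t)) ^+ 2 + (bf (c t) + g / 2 * q (c t)) ^+ 2 =
    (h * bf (c t)) ^+ 2 + (q (c t) + g / 2 * bf (c t)) ^+ 2.
  by rewrite !exprMn h2; field.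
have e2 : 0 < (h * bf (c t)) ^+ 2 + (q (c t) + g / 2 * bf (c t)) ^+ 2.
  by rewrite ltr_pwDl ?sqr_ge0 // exprn_even_gt0.
have n2 := lt0r_neq0 e2.
rewrite e1.
move: (-1 * _ / q (c t)) => dq.
field; rewrite h0 b0 !andbT.
rewrite [X in X != 0](_ : _ = 4 * ((h * bf (c t)) ^+ 2 + (q (c t) + g / 2 * bf (c t)) ^+ 2)).
  by rewrite mulf_neq0.
by field.
Unshelve. all: by end_near. Qed.

Local Notation ip := (bilin a).
Local Notation ze := (zeta a b g h J).
Local Notation F2 := (F2_space a b g).
Let S := indicatrix F2 D (-1).

Lemma cos_angle_spaceE y1 y2 : cos_angle a b g (-1) h y1 y2 = cos_angle_space a b g y1 y2.
Proof. by rewrite /cos_angle bilin_Zvec2 // /cos_angle_space; congr (_ / _); ring. Qed.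

(* [k] and [m] describe the part [sg * b > 0] of the sector in terms of [zeta]:
   the condition [q < k sg b] becomes [m q < k sg A] since [b = A - g q / 2]. *)
Let kk sg := h + sg * g / 2.
Let mm sg := 1 + kk sg * (sg * g / 2).

(** With [u = sg * g / 2] one has [h^2 + u^2 = 1], so [mm sg] is the positive definite form
    [h^2 + h u + 2 u^2]. *)
Let mm_gt0 sg : sg = 1 \/ sg = -1 -> 0 < mm sg.
Proof.
move=> sgE; pose u := sg * g / 2.
have u2 : h ^+ 2 + u ^+ 2 = 1 by rewrite h2 /u; case: sgE => ->; field.
rewrite /mm /kk -/u.
have -> : 1 + (h + u) * u = h ^+ 2 + u ^+ 2 + (h + u) * u by rewrite u2.
have := sqr_ge0 (h + 2 * u); have : 0 < h ^+ 2 by rewrite exprn_gt0.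
nra.
Qed.

Definition in_part sg y := [/\ gam a b y < 0, 0 < sg * bf y & q y < kk sg * (sg * bf y)].

Lemma in_partE sg y : sg = 1 \/ sg = -1 -> gam a b y < 0 ->
  q y < kk sg * (sg * bf y) <-> mm sg * q y < kk sg * (sg * A y).
Proof.
move=> sgE y0; rewrite /mm /Af; have sg2 : sg * sg = 1 by case: sgE => ->; ring.
have -> : kk sg * (sg * (bf y + g / 2 * q y)) =
  kk sg * (sg * bf y) + kk sg * (sg * g / 2) * q y by ring.
have -> : (1 + kk sg * (sg * g / 2)) * q y = q y + kk sg * (sg * g / 2) * q y by ring.
by rewrite ltrD2r.
Qed.

Lemma in_part_kk sg y : in_part sg y -> 0 < kk sg.
Proof.
move=> [y0 sb bq]; have q0 := q_gt0 y0.
by have : 0 < kk sg * (sg * bf y) by [exact: lt_trans bq]; rewrite pmulr_lgt0.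
Qed.

Lemma in_part_A sg y : sg = 1 \/ sg = -1 -> in_part sg y -> 0 < sg * A y.
Proof.
move=> sgE yP; have k0 := in_part_kk yP; case: yP => y0 sb bq.
have := (in_partE sgE y0).1 bq; have : 0 < mm sg * q y by rewrite mulr_gt0 ?mm_gt0 ?q_gt0.
by move=> h1 /(lt_trans h1); rewrite pmulr_rgt0.
Qed.

Lemma D_in_part y : D y <-> exists2 sg, sg = 1 \/ sg = -1 & in_part sg y.
Proof.
split=> [/space_sectorE[y0 [sg [sgE sb bq]]]|[sg sgE [y0 sb bq]]].
  by exists sg.
by apply/space_sectorE; split=> //; exists sg.
Qed.

Lemma bform_zeta_neq0 y : D y -> bf (ze y) != 0.
Proof.
move=> Dy; have [_ _ J0] := U_sign (D_U Dy).
have /D_in_part[sg sgE /(in_part_A sgE) A0] := Dy.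
have An : A y != 0 by apply: contraTneq A0 => ->; rewrite mulr0 ltxx.
by rewrite bformZ bform_Zvec // mulf_neq0 // lt0r_neq0.
Qed.

(** The scalar hypotheses of [sector_convex] at one end point: [b^2 + q^2] is minus the [a]-square,
    so [(sg * b, q)] lies on the unit circle. *)
Lemma part_zeta sg p : sg = 1 \/ sg = -1 -> S p -> in_part sg p ->
  [/\ 0 < q (ze p), r (ze p) (ze p) = - q (ze p) ^+ 2,
     mm sg * (q (ze p) / h) < kk sg * (sg * bf (ze p)) &
     (sg * bf (ze p)) ^+ 2 + q (ze p) ^+ 2 = 1].
Proof.
move=> sgE Sp pP; have [Dp Fp] := Sp; have Up := D_U Dp; have [_ _ J0] := U_sign Up.
have [y0 sb bq] := pP; have q0 := q_gt0 y0; have h0 := lt0r_neq0 h_gt0.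
have qz : q (ze p) = J p * (h * q p) by rewrite qfZ ?ltW // qf_Zvec.
have rz : r (ze p) (ze p) = - q (ze p) ^+ 2.
  rewrite qz rformZl rformZr rform_Zvec // rform_Zvecr // -/(gam a b p).
  by rewrite 2!exprMn q_sqr //; ring.
split=> //.
- by rewrite qz !mulr_gt0.
- rewrite bformZ bform_Zvec // qz.
  rewrite [ltLHS](_ : _ = J p * (mm sg * q p)); last by field.
  rewrite [ltRHS](_ : _ = J p * (kk sg * (sg * A p))); last by ring.
  by rewrite ltr_pM2l //; exact/in_partE.
- have := zeta_norm aT a_unit hb eps2 h2 U_sign D_U Sp.
  rewrite (bilinE a b) rz exprMn; have -> : sg ^+ 2 = 1 by case: sgE => ->; ring.
  lra.
Qed.

Lemma in_part_combination sg p1 p2 (x1 x2 : R) : sg = 1 \/ sg = -1 -> S p1 -> S p2 ->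
  in_part sg p1 -> in_part sg p2 ->
  -1 * ip (ze p1) (ze p2) <= 1 -> r (ze p1) (ze p2) < q (ze p1) * q (ze p2) ->
  0 <= x1 -> 0 <= x2 -> 0 < x1 + x2 ->
  in_part sg (Zinv a b g h (x1 *: ze p1 + x2 *: ze p2)).
Proof.
move=> sgE S1 S2 P1 P2 ip1 rq x10 x20 xx.
have [q1 r1 s1 n1] := part_zeta sgE S1 P1; have [q2 r2 s2 n2] := part_zeta sgE S2 P2.
have k0 := in_part_kk P1; have m0 := mm_gt0 sgE; have h0 := lt0r_neq0 h_gt0.
have sg2 : sg * sg = 1 by case: sgE => ->; ring.
have x12 : sg * bf (ze p1) * (sg * bf (ze p2)) - r (ze p1) (ze p2) <= 1.
  rewrite [X in X - _](_ : _ = sg * sg * (bf (ze p1) * bf (ze p2))); last by ring.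
  by rewrite sg2 mul1r; move: ip1; rewrite (bilinE a b); lra.
have [Gam0 GamS] := sector_convex h_gt0 k0 m0 q1 q2 s1 s2 n1 n2 x12 rq x10 x20 xx.
have a1 : 0 < sg * bf (ze p1).
  by rewrite -(pmulr_rgt0 _ k0) (lt_trans _ s1) // mulr_gt0 // divr_gt0.
have a2 : 0 < sg * bf (ze p2).
  by rewrite -(pmulr_rgt0 _ k0) (lt_trans _ s2) // mulr_gt0 // divr_gt0.
set Gam := (X in 0 < X) in Gam0 GamS.
set z := x1 *: _ + x2 *: _.
have rz : r z z = - Gam.
  rewrite /z !(rformDl, rformDr) !(rformZl _ _ x1, rformZl _ _ x2, rformZr _ _ x1, rformZr _ _ x2).
  by rewrite r1 r2 (rformC b aT (ze p2)) /Gam; ring.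
have bz : sg * bf z = x1 * (sg * bf (ze p1)) + x2 * (sg * bf (ze p2)).
  by rewrite /z bformD (bformZ _ _ x1) (bformZ _ _ x2); ring.
have bz0 : 0 < sg * bf z.
  rewrite bz; have e1 : 0 <= x1 * (sg * bf (ze p1)) by rewrite mulr_ge0 // ltW.
  have e2 : 0 <= x2 * (sg * bf (ze p2)) by rewrite mulr_ge0 // ltW.
  have [x1p|x1n] := ltP 0 x1; first by rewrite ltr_pwDl // mulr_gt0.
  by rewrite ltr_wpDl // mulr_gt0 //; lra.
have qz2 : q z ^+ 2 = Gam by rewrite q_sqr /gam rz ?opprK // oppr_lt0.
have y0 : gam a b (Zinv a b g h z) < 0.
  rewrite /gam rform_Zinv // (rformC b aT) rform_Zinv // rz.
  by rewrite !pmulr_llt0 ?invr_gt0 // oppr_lt0.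
have Ay : A (Zinv a b g h z) = bf z by rewrite -(bform_Zvec g h hb) ?ZinvK.
have qy : q (Zinv a b g h z) < kk sg * (sg * bf (Zinv a b g h z)).
  apply/(in_partE sgE y0); rewrite Ay qf_Zinv // mulrA ltr_pdivrMr //.
  have c0 : 0 <= kk sg * (sg * bf z) * h := ltW (mulr_gt0 (mulr_gt0 k0 bz0) h_gt0).
  have c1 : 0 <= mm sg * q z by rewrite mulr_ge0 ?sqrtr_ge0 ?(ltW m0).
  rewrite -ltr_sqr ?nnegrE //.
  rewrite exprMn qz2 bz; move: GamS; rewrite -/Gam.
  by rewrite (mulrC _ h).
by split=> //; have := lt_trans (q_gt0 y0) qy; rewrite pmulr_rgt0.
Qed.

Lemma same_part y1 y2 sg : sg = 1 \/ sg = -1 -> 0 < bf y1 * bf y2 -> D y2 ->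
  in_part sg y1 -> in_part sg y2.
Proof.
move=> sgE bb /D_in_part[sg' sgE' P2] [_ s1 _].
suff -> : sg = sg' by [].
case: P2 => _ s2 _; case: sgE sgE' s1 s2 => -> [] -> //;
  rewrite ?mul1r ?mulN1r ?oppr_gt0 => s1 s2; exfalso; move: bb.
  by rewrite pmulr_rgt0 // => /lt_trans/(_ s2); rewrite ltxx.
by rewrite nmulr_rgt0 // => /lt_trans/(_ s2); rewrite ltxx.
Qed.

Lemma in_partZ sg k y : 0 < k -> in_part sg y -> in_part sg (k *: y).
Proof.
move=> k0 [y0 sb bq]; rewrite /in_part gamZ bformZ qfZ ?(ltW k0) //; split.
- by rewrite pmulr_rlt0 // exprn_gt0.
- by rewrite mulrCA mulr_gt0.
- by rewrite [ltRHS](_ : _ = k * (kk sg * (sg * bf y))) ?ltr_pM2l //; ring.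
Qed.

Lemma space_joining_exists y1 y2 p1 p2 : D y1 -> D y2 -> ray_meets S y1 p1 ->
  ray_meets S y2 p2 -> angle_space_defined a b g y1 y2 -> joinable_space a b y1 y2 ->
  exists c, geodesic_joining F2 S p1 p2 c.
Proof.
move=> D1 D2 m1 m2 xd [bb rq].
have xE : -1 * ip (ze p1) (ze p2) = cos_angle_space a b g y1 y2.
  by rewrite -cos_angle_spaceE (cos_angle_meets h eps2 U_sign J_homogeneous D_U D1 D2 m1 m2).
have [S1 [k1 k10 p1E]] := m1; have [S2 [k2 k20 p2E]] := m2.
have /D_in_part[sg sgE P1'] := D1; have P2' := same_part sgE bb D2 P1'.
have P1 : in_part sg p1 by rewrite p1E; exact: in_partZ.
have P2 : in_part sg p2 by rewrite p2E; exact: in_partZ.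
have [q1 r1 s1 n1] := part_zeta sgE S1 P1; have [q2 r2 s2 n2] := part_zeta sgE S2 P2.
have [_ _ J1] := U_sign (D_U S1.1); have [_ _ J2] := U_sign (D_U S2.1).
have rqz : r (ze p1) (ze p2) < q (ze p1) * q (ze p2).
  rewrite !qfZ ?ltW // !qf_Zvec // /zeta rformZl rformZr rform_Zvec // rform_Zvecr //.
  rewrite p1E p2E rformZl rformZr !qfZ ?(ltW k10) ?(ltW k20) // -p1E -p2E.
  rewrite [ltLHS](_ : _ = (J p1 * J p2 * h * h * k1 * k2) * r y1 y2); last by ring.
  rewrite [ltRHS](_ : _ = (J p1 * J p2 * h * h * k1 * k2) * (q y1 * q y2)); last by ring.
  by rewrite ltr_pM2l // !mulr_gt0.
set x := cos_angle_space a b g y1 y2 in xE.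
have /andP[xN1 x1] : -1 <= x <= 1 := xd.
(* The product of the values of [b] is positive, and [r < q1 q2 <= 1] for the two images. Then
   [acos x < pi], which is the bound on [K]. *)
have xgt : -1 < x.
  have k0 := in_part_kk P1; have m0 := mm_gt0 sgE.
  have a1 : 0 < sg * bf (ze p1).
    by rewrite -(pmulr_rgt0 _ k0) (lt_trans _ s1) // mulr_gt0 // divr_gt0.
  have a2 : 0 < sg * bf (ze p2).
    by rewrite -(pmulr_rgt0 _ k0) (lt_trans _ s2) // mulr_gt0 // divr_gt0.
  have sg2 : sg * sg = 1 by case: sgE => ->; ring.
  have xa : x = sg * bf (ze p1) * (sg * bf (ze p2)) - r (ze p1) (ze p2).
    rewrite -xE (bilinE a b).
    rewrite [X in _ = X - _](_ : _ = sg * sg * (bf (ze p1) * bf (ze p2))); last by ring.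
    by rewrite sg2; ring.
  have aa : 0 < sg * bf (ze p1) * (sg * bf (ze p2)) by rewrite mulr_gt0.
  have qq : q (ze p1) * q (ze p2) <= 1.
    have := sqr_ge0 (q (ze p1) - q (ze p2)); have := sqr_ge0 (sg * bf (ze p1)).
    have := sqr_ge0 (sg * bf (ze p2)); nra.
  rewrite xa; lra.
have acI : 0 <= acos x <= pi by rewrite acos_ge0 ?acos_lepi ?xN1.
have acpi : acos x < pi by rewrite acos_ltpi // xgt.
have ac0 : 0 <= acos x by case/andP: acI.
pose K := - acos x ^+ 2.
have Kpi : - pi ^+ 2 < K by rewrite ltrN2 ltrXn2r ?nnegrE ?ac0 ?pi_ge0.
have Kcs : csK K 1 = x.
  have cx : cos (acos x) = x by rewrite acosK // in_itv /= xN1.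
  rewrite /csK /K; case: ltP => [_|].
    by rewrite opprK sqrtr_sqr ger0_norm // mulr1.
  (* If [acos x = 0], then [K = 0] falls into the [cosh] branch, where both sides are 1. *)
  rewrite oppr_ge0 => a0; have a00 : acos x = 0.
    by apply/eqP; rewrite -sqrf_eq0 eq_le a0 sqr_ge0.
  by rewrite a00 expr0n oppr0 sqrtr0 mul0r cosh0 -cx a00 cos0.
have part t : 0 <= t <= 1 -> in_part sg (Zinv a b g h (arc a b g h J p1 p2 K t)).
  move=> t01; rewrite arcE //; have /andP[t0 t1] := t01.
  have Sgt := snK_gt0 Kpi; have S11 : 0 < snK K 1 by apply: Sgt; rewrite ltr01 lexx.
  have sge (s : R) : 0 <= s <= 1 -> 0 <= snK K s.
    move=> /andP[]; rewrite le_eqVlt => /predU1P[<-|s0 s1']; first by rewrite snK0.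
    by rewrite ltW // Sgt // s0.
  apply: in_part_combination => //.
  - by rewrite xE.
  - by rewrite divr_ge0 ?(ltW S11) // sge //; lra.
  - by rewrite divr_ge0 ?(ltW S11) // sge.
  (* The second coefficient is positive for [t > 0], the first one at [t = 0]. *)
  - rewrite -mulrDl divr_gt0 //; have [tp|tn] := ltP 0 t.
      rewrite ltr_wpDl //; first by rewrite sge //; lra.
      by rewrite Sgt // tp.
    by rewrite ltr_pwDl ?sge // Sgt //; lra.
apply: (geodesic_joining_exists aT a_unit hb eps2 h_gt0 h2 U_sign U_open
  J_derive J_homogeneous U_cone D_U S1 S2 Kpi); first by rewrite Kcs xE.
move=> t t01; have Dt : D (Zinv a b g h (arc a b g h J p1 p2 K t)).
  by apply/D_in_part; exists sg => //; exact: part.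
split; first exact: D_U.
by apply: D_cone => //; have [_ _ ?] := U_sign (D_U Dt); rewrite invr_gt0.
Qed.

(* An arc of length at least [pi] would cross [b = 0]. *)
Lemma space_K_gt p1 p2 c K V : geodesic_joining F2 S p1 p2 c ->
  (forall t, 0 <= t <= 1 -> ze (c t) = csK K t *: ze p1 + snK K t *: V) ->
  - pi ^+ 2 < K.
Proof.
move=> [c0 _ Hc] zE; rewrite ltNge; apply/negP => Kpi.
pose f t := csK K t * bf (ze p1) + snK K t * bf V.
have fE t : 0 <= t <= 1 -> f t = bf (ze (c t)).
  by move=> t01; rewrite zE // bformD (bformZ _ _ (csK _ _)) (bformZ _ _ (snK _ _)).
have fn t : 0 <= t <= 1 -> f t != 0.
  by move=> t01; rewrite fE // bform_zeta_neq0 //; case: (Hc t t01) => -[].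
have i0 : 0 <= (0 : R) <= 1 by rewrite lexx ler01.
have Df t : derivable (fun t => f 0 * f t) t 1.
  have := is_derive1Ml (f 0) (is_derive1D
    (is_derive1M (is_derive_csK K t) (is_derive1_cst (bf (ze p1)) t))
    (is_derive1M (is_derive_snK K t) (is_derive1_cst (bf V) t))).
  by case.
have pos : forall t, 0 <= t <= 1 -> 0 < f 0 * f t.
  apply: (nonvanishing_gt0 (f := fun t => f 0 * f t)) => [t _|t t01|].
  - exact: Df.
  - by rewrite mulf_neq0 ?fn.
  - by rewrite -expr2 exprn_even_gt0 //= fn.
have pi0 := @pi_gt0 R; have K0 : K < 0.
  by rewrite (le_lt_trans Kpi) // oppr_lt0 exprn_gt0.
have sK : pi <= Num.sqrt (- K).
  by rewrite -[leLHS](gtr0_norm pi0) -sqrtr_sqr ler_wsqrtr // lerNr.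
have s0 : 0 < Num.sqrt (- K) by rewrite (lt_le_trans pi0).
have t01 : 0 <= pi / Num.sqrt (- K) <= 1.
  by rewrite divr_ge0 ?(ltW s0) ?(ltW pi0) //= ler_pdivrMr // mul1r.
(* At this time [csK] is -1 and [snK] is 0, so the point is antipodal to the initial one and [b] has
   changed sign. *)
have ft : f (pi / Num.sqrt (- K)) = - f 0.
  rewrite /f csK0 snK0 /csK /snK K0 (mulrC (Num.sqrt _) (pi / _)) divfK ?lt0r_neq0 //.
  by rewrite cospi sinpi; ring.
have := pos _ t01; rewrite ft mulrN oppr_gt0; apply/negP.
by rewrite -leNgt -expr2 sqr_ge0.
Qed.

Theorem space_like_angle :
  [/\ forall y, D y -> exists! p, ray_meets S y p,
       forall y1 y2 p1 p2, D y1 -> D y2 -> ray_meets S y1 p1 -> ray_meets S y2 p2 ->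
         angle_space_defined a b g y1 y2 ->
         [/\ joinable_space a b y1 y2 ->
               exists c, geodesic_joining F2 S p1 p2 c,
             forall c c', geodesic_joining F2 S p1 p2 c ->
               geodesic_joining F2 S p1 p2 c' ->
               forall t, 0 <= t <= 1 -> c t = c' t &
             forall c, geodesic_joining F2 S p1 p2 c ->
               arc_length F2 c = angle_space a b g y1 y2],
       forall c : R -> 'rV[R]_N, (\forall t \near 0, S (c t)) ->
         derivable c 0 1 -> bilin (gij F2 (c 0)) (derive1 c 0) (derive1 c 0) < 0 ->
         \forall t \near 0, angle_space_defined a b g (c 0) (c t) &
       forall c : R -> 'rV[R]_N, (\forall t \near 0, S (c t)) ->
         derivable c 0 1 ->
         (\forall t \near 0, angle_space_defined a b g (c 0) (c t)) ->
         (fun t : R => angle_space a b g (c 0) (c t) / `|t|) @ 0^'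
           --> ds F2 (c 0) (derive1 c 0)].
Proof.
split; first exact: (ray_meets_unique eps2 U_sign J_homogeneous D_U D_cone).
- move=> y1 y2 p1 p2 D1 D2 m1 m2 xd.
  have xE : -1 * ip (ze p1) (ze p2) = cos_angle_space a b g y1 y2.
    by rewrite -cos_angle_spaceE (cos_angle_meets h eps2 U_sign J_homogeneous D_U D1 D2 m1 m2).
  split.
  + exact: space_joining_exists.
  + move=> c c'; apply: (geodesic_joining_unique aT a_unit hb eps2 h_gt0 h2 U_sign U_open
      J_derive J_homogeneous D_U) => {}c K V G _ _.
    exact: space_K_gt G.
  + move=> c G.
    have [K [V [zV KE zE Kcs ->]]] :=
      geodesic_joiningP aT a_unit hb eps2 h_gt0 h2 U_sign U_open J_derive D_U G.
    have Kpi := space_K_gt G zE; have /andP[_ x1] := xd.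
    rewrite /angle_space mulrC -xE -Kcs; congr (_ * _).
    move: x1; rewrite -xE -Kcs /csK mulr1; case: ltP => K0 x1.
      rewrite cosK ?ltr0_norm // in_itv /= sqrtr_ge0 ltW // sqrt_lt_pi //.
    (* [K > 0] would make the cosine exceed 1. For [K = 0] the geodesic is null or constant, and
       both length and angle are 0. *)
    have K00 : K = 0.
      apply/eqP; rewrite eq_le K0 andbT leNgt; apply/negP => Kp.
      by move: x1; rewrite mulr1 leNgt cosh_gt1 // sqrtr_gt0.
    by rewrite K00 normr0 sqrtr0 mulr1 cosh0 acos1.
- move=> c nS dc.
  have [K [-> _ lim]] := infinitesimal_angle aT a_unit hb eps2 h_gt0 h2 U_sign U_open
    J_derive J_homogeneous D_U nS dc.
  (* For [eps = -1] the square of the velocity is [K / h^2], so the assumption says [K < 0]. *)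
  rewrite opprK mul1r pmulr_llt0 ?invr_gt0 ?exprn_gt0 // => K0.
  have lim' : 2 * (cos_angle_space a b g (c 0) (c t) - 1) / t ^+ 2 @[t --> 0^'] --> K.
    by move: lim; apply: near_eq_cvg_to; near=> t; rewrite cos_angle_spaceE.
  have x_1 := cvg_of_second_order lim'.
  have ev1 : \forall t \near 0^', 2 * (cos_angle_space a b g (c 0) (c t) - 1) / t ^+ 2 < 0.
    exact: cvgr_lt lim' _ K0.
  have ev2 : \forall t \near 0^', -1 < cos_angle_space a b g (c 0) (c t).
    by apply: cvgr_gt x_1 _ _; lra.
  have S0 := nbhs_singleton nS.
  (* The limits speak of punctured neighbourhoods; [t = 0] itself needs the exact value. *)
  have x0 : cos_angle_space a b g (c 0) (c 0) = 1.
    rewrite -cos_angle_spaceE -(cos_angle_indicatrix h eps2 U_sign J_homogeneous D_U S0 S0).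
    by rewrite (zeta_norm aT a_unit hb eps2 h2 U_sign D_U S0) mulrNN mulr1.
  have ev : \forall t \near 0^', angle_space_defined a b g (c 0) (c t).
    near=> t; have t0 : t != 0 by near: t; exact: nbhs_dnbhs_neq.
    have x1 : 2 * (cos_angle_space a b g (c 0) (c t) - 1) / t ^+ 2 < 0 by near: t.
    have x2 : -1 < cos_angle_space a b g (c 0) (c t) by near: t.
    move: x1; rewrite pmulr_llt0 ?invr_gt0 ?exprn_even_gt0 //= => x1.
    by apply/andP; split; lra.
  have ev' : \forall t \near 0, t != 0 -> angle_space_defined a b g (c 0) (c t) := ev.
  near=> t; have [->|t0] := eqVneq t 0.
    by rewrite /angle_space_defined x0 lexx andbT; lra.
  have H : t != 0 -> angle_space_defined a b g (c 0) (c t) by near: t.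
  exact: H.
- move=> c nS dc xd.
  have [K [_ -> lim]] := infinitesimal_angle aT a_unit hb eps2 h_gt0 h2 U_sign U_open
    J_derive J_homogeneous D_U nS dc.
  have x1 : \forall t \near 0^', -1 <= cos_angle_space a b g (c 0) (c t) <= 1.
    exact: nbhs_dnbhs.
  have lim' : 2 * (cos_angle_space a b g (c 0) (c t) - 1) / t ^+ 2 @[t --> 0^'] --> K.
    by move: lim; apply: near_eq_cvg_to; near=> t; rewrite cos_angle_spaceE.
  have L := acos_cvg x1 lim'.
  have : acos (cos_angle_space a b g (c 0) (c t)) / `|t| * h^-1 @[t --> 0^']
      --> Num.sqrt `|K| * h^-1 by apply: cvgM => //; exact: cvg_cst.
  by apply: near_eq_cvg_to; near=> t; rewrite /angle_space; ring.
Unshelve. all: by end_near. Qed.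

End SpaceSector.

Theorem mainTheorem10 (R : realType) (N : nat)
    (a : 'M[R]_N) (b T : 'rV[R]_N) (g : R)
    (ha : lorentzian a) (hb : conorm2 a b = -1) (hT : 0 < bilin a T T) :
  (* future-time-like sector *)
  (let F2 := F2_time a b g in
   let D := time_sector a b g T in
   let S := indicatrix F2 D 1 in
   let alpha := angle_time a b g in
   [/\ forall y, D y -> exists! p, ray_meets S y p,
       forall y1 y2, D y1 -> D y2 -> 1 <= cosh_angle_time a b g y1 y2,
       forall y1 y2 p1 p2, D y1 -> D y2 -> ray_meets S y1 p1 -> ray_meets S y2 p2 ->
         [/\ exists c, geodesic_joining F2 S p1 p2 c,
             forall c c', geodesic_joining F2 S p1 p2 c ->
               geodesic_joining F2 S p1 p2 c' ->
               forall t, 0 <= t <= 1 -> c t = c' t &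
             forall c, geodesic_joining F2 S p1 p2 c ->
               arc_length F2 c = alpha y1 y2] &
       forall c : R -> 'rV[R]_N, (\forall t \near 0, S (c t)) ->
         derivable c 0 1 ->
         (fun t : R => alpha (c 0) (c t) / `|t|) @ 0^'
           --> ds F2 (c 0) (derive1 c 0)])
  /\
  (* space-like sector *)
  (-2 < g < 2 ->
   let F2 := F2_space a b g in
   let D := space_sector a b g in
   let S := indicatrix F2 D (-1) in
   let alpha := angle_space a b g in
   let alpha_defined := angle_space_defined a b g in
   [/\ forall y, D y -> exists! p, ray_meets S y p,
       forall y1 y2 p1 p2, D y1 -> D y2 -> ray_meets S y1 p1 -> ray_meets S y2 p2 ->
         alpha_defined y1 y2 ->
         [/\ joinable_space a b y1 y2 ->
               exists c, geodesic_joining F2 S p1 p2 c,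
             forall c c', geodesic_joining F2 S p1 p2 c ->
               geodesic_joining F2 S p1 p2 c' ->
               forall t, 0 <= t <= 1 -> c t = c' t &
             forall c, geodesic_joining F2 S p1 p2 c ->
               arc_length F2 c = alpha y1 y2],
       forall c : R -> 'rV[R]_N, (\forall t \near 0, S (c t)) ->
         derivable c 0 1 -> bilin (gij F2 (c 0)) (derive1 c 0) (derive1 c 0) < 0 ->
         \forall t \near 0, alpha_defined (c 0) (c t) &
       forall c : R -> 'rV[R]_N, (\forall t \near 0, S (c t)) ->
         derivable c 0 1 ->
         (\forall t \near 0, alpha_defined (c 0) (c t)) ->
         (fun t : R => alpha (c 0) (c t) / `|t|) @ 0^'
           --> ds F2 (c 0) (derive1 c 0)]).
Proof.
by split=> [|hg]; [exact: time_like_angle|exact: space_like_angle].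
Qed.
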